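(* Let $\gamma\in(0,\infty)$, $\Lambda=I_{2\times2}$, and let $Q$ be a $\Lambda$-periodic admissible quadratic form. Suppose that $Q$ is independent of $y_2$ and of the form $$Q(x_3,y,G)=\lambda(x_3,y_1)\,(\mathrm{tr}\,G)^2+2\mu(x_3,y_1)\,|\mathrm{sym}\,G|^2$$ with Lamé coefficients $\lambda,\mu$ satisfying $$\lambda(x_3,y_1)=\lambda(-x_3,y_1)=\lambda(x_3,-y_1),\qquad\mu(x_3,y_1)=\mu(-x_3,y_1)=\mu(x_3,-y_1)$$ for all $x_3\in(-\frac12,\frac12)$ and a.e. $y_1\in(-\frac12,\frac12)$. Then the homogenized quadratic form $Q^\gamma_{\rm hom}$ associated with $Q$ is orthotropic. Moreover, the corrector pairs $(M_i,\varphi_i)$ associated with $G_i$, $i=1,2,3$, satisfy $M_1=M_2=M_3=0$, and a.e. in $\Box$, $$\partial_{y_2}\varphi_1=\partial_{y_2}\varphi_2=\partial_{y_2}\varphi_3=0,\qquad\varphi_1\cdot e_2=\varphi_2\cdot e_2=\varphi_3\cdot e_1=\varphi_3\cdot e_3=0,$$ $$\mathbb L\big(\iota(x_3G_3)+\mathrm{sym}\nabla_\gamma\varphi_3\big):(e_j\otimes e_j)=0\qquad\text{for }j=1,2,3.$$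
   Context: **Notation.** $|\cdot|$ and $:$ are the Frobenius norm and inner product, $\mathrm{sym}\,G=\frac12(G+G^\top)$; for $G\in\mathbb R^{2\times2}$, $\iota(G)\in\mathbb R^{3\times3}$ has upper-left block $G$ and vanishing third row and column. In the formulas for $\varphi_i$ and $\mathbb L$, $e_1,e_2,e_3$ is the canonical basis of $\mathbb R^3$. $G_1=e_1\otimes e_1$, $G_2=e_2\otimes e_2$, $G_3=\frac1{\sqrt2}(e_1\otimes e_2+e_2\otimes e_1)$ (here with the canonical basis of $\mathbb R^2$) is the canonical orthonormal basis of $\mathbb R^{2\times2}_{\rm sym}$; write $G=\sum_i\widehat G_iG_i$. $\Box=(-\frac12,\frac12)\times[-\frac12,\frac12)^2$ with points $(x_3,y)$, $y=(y_1,y_2)$. For $0<\alpha\le\beta<\infty$, $\mathcal Q(\alpha,\beta)$ is the set of quadratic forms on $\mathbb R^{3\times3}$ with $\alpha|\mathrm{sym}\,G|^2\le Q(G)\le\beta|\mathrm{sym}\,G|^2$, with tensor $\mathbb L$ given by $\mathbb LF:G=\frac12(Q(F+G)-Q(F)-Q(G))$. A Borel $Q:(-\frac12,\frac12)\times\mathbb R^2\times\mathbb R^{3\times3}\to\mathbb R$ is an $I_{2\times 2}$-periodic admissible quadratic form if $Q(x_3,y,\cdot)\in\mathcal Q(\alpha,\beta)$ for a.e. $(x_3,y)$ and $Q(x_3,\cdot,G)$ is $\mathbb Z^2$-periodic for all $G$ and a.e. $x_3$. $\nabla_\gamma=(\partial_{y_1},\partial_{y_2},\frac1\gamma\partial_3)$;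 $H^1_\gamma(\Box;\mathbb R^3)$ is the space of $\varphi\in H^1_{\rm loc}((-\frac12,\frac12)\times\mathbb R^2;\mathbb R^3)$, $\mathbb Z^2$-periodic in $y$, with $\int_\Box|\varphi|^2+|\nabla_\gamma\varphi|^2<\infty$. $Q^\gamma_{\rm hom}(G)=\inf_{M,\varphi}\int_\Box Q(x_3,y,\iota(x_3G+M)+\mathrm{sym}\nabla_\gamma\varphi)\,d(x_3,y)$ for $G\in\mathbb R^{2\times2}_{\rm sym}$, the infimum over $M\in\mathbb R^{2\times2}_{\rm sym}$, $\varphi\in H^1_\gamma(\Box;\mathbb R^3)$. It is orthotropic if there are $q_1,q_2,q_{12},q_3\in\mathbb R$ with $Q^\gamma_{\rm hom}(G)=\widehat G_1^2q_1+\widehat G_1\widehat G_2q_{12}+\widehat G_2^2q_2+\widehat G_3^2q_3$ for all $G$. The corrector $(M_i,\varphi_i)$ associated with $G_i$ is the unique pair $M_i\in\mathbb R^{2\times2}_{\rm sym}$, $\varphi_i\in H^1_\gamma(\Box;\mathbb R^3)$ with $\int_\Box\varphi_i=0$ such that $\int_\Box\mathbb L(\iota(x_3G_i+M_i)+\mathrm{sym}\nabla_\gamma\varphi_i):(\iota(M')+\mathrm{sym}\nabla_\gamma\varphi')=0$ for all $M'\in\mathbb R^{2\times2}_{\rm sym}$, $\varphi'\in H^1_\gamma(\Box;\mathbb R^3)$. *)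

(* Defs.v *)
From HB Require Import structures.
From mathcomp Require Import all_boot all_order all_algebra.
From mathcomp Require Import all_classical all_reals all_analysis.

Set Implicit Arguments.
Unset Strict Implicit.
Unset Printing Implicit Defensive.
Import Order.TTheory GRing.Theory Num.Theory.
Import numFieldNormedType.Exports.
Local Open Scope classical_set_scope.
Local Open Scope ring_scope.

(* The library's sigma-finite instance for [m1 \x m2] is shadowed by the one
   for products of subprobabilities, hence this lemma and the instances on
   [area] and [volume]. *)
Lemma sigma_finite_product d1 d2 (T1 : measurableType d1)
    (T2 : measurableType d2) (R : realType)
    (m1 : {sigma_finite_measure set T1 -> \bar R})
    (m2 : {sigma_finite_measure set T2 -> \bar R}) :
  sigma_finite setT (m1 \x m2)%E.
Proof.
have /sigma_finiteP[F [TF ndF Foo]] := sigma_finiteT m1.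
have /sigma_finiteP[G [TG ndG Goo]] := sigma_finiteT m2.
exists (fun n => F n `*` G n).
  rewrite -setXTT TF TG predeqE => -[x y]; split.
    move=> [/= [n _ Fnx] [k _ Gky]]; exists (maxn n k) => //; split.
    - by move: x Fnx; exact/subsetPset/ndF/leq_maxl.
    - by move: y Gky; exact/subsetPset/ndG/leq_maxr.
  by move=> [n _ []/= ? ?]; split; exists n.
move=> k; have [? ?] := Foo k; have [? ?] := Goo k.
split; first exact: measurableX.
by rewrite product_measure1E// lte_mul_pinfty// ge0_fin_numE.
Qed.

Definition area {R : realType} :
    set (measurableTypeR R * measurableTypeR R)%type -> \bar R :=
  (@lebesgue_measure R \x @lebesgue_measure R)%E.
HB.instance Definition _ (R : realType) := Measure.on (@area R).
HB.instance Definition _ (R : realType) :=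
  Measure_isSigmaFinite.Build _ _ _ (@area R)
    (sigma_finite_product (@lebesgue_measure R) (@lebesgue_measure R)).

(* Points are (x3, (y1, y2)). *)
Notation pt3 R :=
  (measurableTypeR R * (measurableTypeR R * measurableTypeR R))%type.

Definition volume {R : realType} : set (pt3 R) -> \bar R :=
  (@lebesgue_measure R \x @area R)%E.
HB.instance Definition _ (R : realType) := Measure.on (@volume R).
HB.instance Definition _ (R : realType) :=
  Measure_isSigmaFinite.Build _ _ _ (@volume R)
    (sigma_finite_product (@lebesgue_measure R) (@area R)).

Section Sets.
Context {R : realType}.
Implicit Type p : pt3 R.

Definition half_open_cell : set R := [set t | - 2^-1 <= t < 2^-1].

Definition thickness : set R := [set t | - 2^-1 < t < 2^-1].

Definition slab : set (pt3 R) := [set p | thickness p.1].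

Definition cell : set (pt3 R) :=
  [set p | [/\ thickness p.1, half_open_cell p.2.1 & half_open_cell p.2.2]].

Definition translate (k1 k2 : int) p : pt3 R :=
  (p.1, (p.2.1 + k1%:~R, p.2.2 + k2%:~R)).

Definition dir_y1 : pt3 R := (0, (1, 0)).
Definition dir_y2 : pt3 R := (0, (0, 1)).
Definition dir_x3 : pt3 R := (1, (0, 0)).

End Sets.

Section Matrices.
Context {R : realType}.

Definition frobenius m n (A B : 'M[R]_(m, n)) : R := \tr (A^T *m B).

Definition sqnorm m n (A : 'M[R]_(m, n)) : R := frobenius A A.

Definition sym n (A : 'M[R]_n) : 'M[R]_n := 2^-1 *: (A + A^T).

Definition embed (G : 'M[R]_2) : 'M[R]_3 := block_mx G 0 0 (0 : 'M[R]_1).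

Definition G1 : 'M[R]_2 := delta_mx 0 0.
Definition G2 : 'M[R]_2 := delta_mx 1 1.
Definition G3 : 'M[R]_2 := (Num.sqrt 2)^-1 *: (delta_mx 0 1 + delta_mx 1 0).

End Matrices.

(* The indices of the canonical basis e_1, e_2, e_3 of R^3. *)
Definition i1 : 'I_3 := @Ordinal 3 0 isT.
Definition i2 : 'I_3 := @Ordinal 3 1 isT.
Definition i3 : 'I_3 := @Ordinal 3 2 isT.

Section Sobolev.
Context {R : realType}.
Implicit Types (f g psi : pt3 R -> R) (phi : pt3 R -> 'cV[R]_3).

(* Smoothness through iterated directional derivatives, all continuous. *)
Fixpoint Ck (k : nat) f : Prop :=
  continuous f /\
  if k is k'.+1 then
    forall v : pt3 R, (forall p, derivable f p v) /\ Ck k' ('D_v f)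
  else True.

Definition test_function psi : Prop :=
  (forall k, Ck k psi) /\
  exists K : set (pt3 R),
    [/\ compact K, K `<=` slab & forall p, ~ K p -> psi p = 0].

Definition L2loc f : Prop :=
  measurable_fun slab f /\
  forall K : set (pt3 R), compact K -> K `<=` slab ->
    (\int[volume]_(p in K) ((f p) ^+ 2)%:E < +oo)%E.

Definition weak_partial (v : pt3 R) f g : Prop :=
  L2loc g /\
  forall psi, test_function psi ->
    \int[volume]_(p in slab) (f p * 'D_v psi p) =
    - \int[volume]_(p in slab) (g p * psi p).

(* A representative of the weak derivative, unique up to null sets of [slab];
   junk (zero) when [f] has none. *)
Definition partial (v : pt3 R) f : pt3 R -> R :=
  xget (fun=> 0) [set g | weak_partial v f g].

Definition H1loc f : Prop :=
  L2loc f /\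
  forall v, v = dir_y1 \/ v = dir_y2 \/ v = dir_x3 ->
    exists g, weak_partial v f g.

Definition component (i : 'I_3) phi : pt3 R -> R := fun p => phi p i 0.

(* Columns are ordered as the coordinates (y1, y2, x3), so that the third
   component of [phi] matches the x3 direction. *)
Definition nabla (gamma : R) phi (p : pt3 R) : 'M[R]_3 :=
  \matrix_(i, j)
    nth 0 [:: partial dir_y1 (component i phi) p;
              partial dir_y2 (component i phi) p;
              gamma^-1 * partial dir_x3 (component i phi) p] j.

Definition H1gamma (gamma : R) phi : Prop :=
  [/\ forall i, H1loc (component i phi),
      forall k1 k2 : int,
        {ae volume, forall p, slab p -> phi (translate k1 k2 p) = phi p} &
      (\int[volume]_(p in cell)
         (sqnorm (phi p) + sqnorm (nabla gamma phi p))%:E < +oo)%E].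

End Sobolev.

Section Energy.
Context {R : realType}.
Implicit Types (q : 'M[R]_3 -> R) (Q : pt3 R -> 'M[R]_3 -> R).
Implicit Types (G M : 'M[R]_2) (phi : pt3 R -> 'cV[R]_3).

Definition quadratic_form q : Prop :=
  exists B : {biscalar 'M[R]_3}, forall A, q A = B A A.

Definition quadratic_class (alpha beta : R) q : Prop :=
  quadratic_form q /\
  forall A, alpha * sqnorm (sym A) <= q A <= beta * sqnorm (sym A).

(* [tensor q F G] is LF : G. *)
Definition tensor q (F G : 'M[R]_3) : R := 2^-1 * (q (F + G) - q F - q G).

Definition borel_on_slab Q : Prop :=
  forall B : set R, measurable B ->
    <<s [set A : set (pt3 R * 'M[R]_3)%type | open A] >>
      [set z | slab z.1 /\ B (Q z.1 z.2)].

Definition admissible (alpha beta : R) Q : Prop :=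
  [/\ borel_on_slab Q,
      {ae volume, forall p, slab p -> quadratic_class alpha beta (Q p)} &
      forall A, {ae (@lebesgue_measure R), forall x3 : R, thickness x3 ->
        forall (y : R * R) (k1 k2 : int),
          Q (translate k1 k2 (x3, y)) A = Q (x3, y) A}].

Definition strain (gamma : R) G M phi (p : pt3 R) : 'M[R]_3 :=
  embed ((p.1 : R) *: G + M) + sym (nabla gamma phi p).

Definition Qhom (gamma : R) Q G : R :=
  inf [set x : R | exists M phi, [/\ M^T = M, H1gamma gamma phi &
    x = \int[volume]_(p in cell) Q p (strain gamma G M phi p)]].

Definition orthotropic (q : 'M[R]_2 -> R) : Prop :=
  exists q1 q2 q12 q3 : R, forall G (g1 g2 g3 : R),
    G = g1 *: G1 + g2 *: G2 + g3 *: G3 ->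
    q G = g1 ^+ 2 * q1 + g1 * g2 * q12 + g2 ^+ 2 * q2 + g3 ^+ 2 * q3.

(* Uniqueness (up to null sets) is a consequence of the coercivity of Q, not
   part of the predicate. *)
Definition corrector (gamma : R) Q G M phi : Prop :=
  [/\ M^T = M,
      H1gamma gamma phi,
      forall i, \int[volume]_(p in cell) component i phi p = 0 &
      forall M' phi', M'^T = M' -> H1gamma gamma phi' ->
        \int[volume]_(p in cell)
          tensor (Q p) (strain gamma G M phi p)
            (embed M' + sym (nabla gamma phi' p)) = 0].

Definition even_coefficient (c : R -> R -> R) : Prop :=
  forall x3, thickness x3 ->
    {ae (@lebesgue_measure R), forall y1 : R, thickness y1 ->
      c x3 y1 = c (- x3) y1 /\ c x3 y1 = c x3 (- y1)}.

End Energy.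

(* Main.v *)
Require Import Defs.
From HB Require Import structures.
From mathcomp Require Import all_boot all_order all_algebra.
From mathcomp Require Import all_classical all_reals all_analysis.
From mathcomp Require Import measurable_realfun.
From mathcomp Require Import ring lra.
Set Implicit Arguments.
Unset Strict Implicit.
Unset Printing Implicit Defensive.
Import Order.TTheory GRing.Theory Num.Theory.
Import numFieldNormedType.Exports.
Local Open Scope classical_set_scope.
Local Open Scope ring_scope.

(* A symmetry of the slab under which the Lame coefficients are invariant pulls
   fields back, with suitable signs on their components, without changing the
   energy.  The infimum defining the homogenized form inherits the invariance:
   y2 -> -y2 shows that it is even in the third coordinate of G, and it satisfies
   the parallelogram identity because the energy does, so it is an orthotropic
   quadratic form.
   A corrector minimizes the energy, and its Euler-Lagrange equation makes any
   other field of equal energy differ from it by a field with zero strain.  Such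
   a field is constant: the second derivatives of an infinitesimal rigid motion
   vanish, and periodicity kills its affine part.  A corrector is therefore fixed
   by every symmetry preserving its energy.  The reflection x3 -> -x3 gives
   M = -M; translations in y2 show that phi does not depend on y2; and then the
   sign changes of components attached to y2 -> -y2 leave the energy unchanged,
   which makes the stated components vanish. *)

(** * Smooth functions of one variable *)

(** Weak derivatives are chosen representatives, so formulas for the gradient of a transformed field
    hold only almost everywhere. Working with an arbitrary representative, [has_grad], and with
    uniqueness of weak derivatives lets the transformation rules be exact formulas. Distributional
    identities are tested on products a(x3) b(y1) c(y2) of one-variable bumps: they approach
    indicators of boxes, and boxes generate the measurable sets. A bump is a multiple of a fixed one
    plus a derivative, so a vanishing gradient forces constancy. Invariance under a translation by t
    reaches the derivative without difference quotients: a step minus its translate by t has a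
    derivative that pairs to zero with every invariant function, while it tends itself to the
    indicator of an interval of length t. Uniqueness of correctors is phrased through energies, so
    the Euler-Lagrange equation is never transported by a symmetry. The final sign changes alter the
    gradient correctly except in its y2 column; they are admissible only once this column is known
    to vanish, which dictates the order of the arguments. *)

Section SmoothLine.
Context {R : realType}.
Implicit Types f g : R -> R.

(** Only the existence of derivatives is recorded; at each order continuity follows from the next
    derivative. *)
Fixpoint smooth_upto (n : nat) f : Prop :=
  if n is n'.+1 then
    (forall x, derivable f x 1) /\ smooth_upto n' (derive1 f)
  else True.

Definition smooth f := forall n, smooth_upto n f.

Lemma smooth_uptoW n f : smooth_upto n.+1 f -> smooth_upto n f.
Proof.
elim: n f => [//|n IH] f [df sf]; split => //; exact: IH.
Qed.

Lemma smooth_upto_is_derive n f (df : R -> R) :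
  (forall x : R, is_derive x 1 f (df x)) -> smooth_upto n df ->
  smooth_upto n.+1 f.
Proof.
move=> fd sd; split; first by move=> x; have [] := fd x.
rewrite (_ : (derive1 f) = df)//; apply/funext => x.
by rewrite derive1E; have [_ ->] := fd x.
Qed.

Lemma smooth_upto_derive1 n f (x : R) : smooth_upto n.+1 f ->
  is_derive x 1 f (derive1 f x).
Proof. by move=> [df _]; rewrite derive1E; split. Qed.

Lemma smooth_upto_cst n (c : R) : smooth_upto n (cst c).
Proof.
elim: n c => [//|n IH] c; apply: (@smooth_upto_is_derive _ _ (cst 0)).
exact: (IH 0).
Qed.

Lemma smooth_uptoD n f g : smooth_upto n f -> smooth_upto n g ->
  smooth_upto n (f \+ g).
Proof.
elim: n f g => [//|n IH] f g sf sg.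
apply: (@smooth_upto_is_derive _ _ ((derive1 f) \+ (derive1 g))).
  move=> x; have fx := smooth_upto_derive1 x sf.
  have gx := smooth_upto_derive1 x sg.
  exact: is_deriveD.
by apply: IH; [case: sf|case: sg].
Qed.

Lemma smooth_uptoM n f g : smooth_upto n f -> smooth_upto n g ->
  smooth_upto n (f \* g).
Proof.
elim: n f g => [//|n IH] f g sf sg.
apply: (@smooth_upto_is_derive _ _ ((f \* (derive1 g)) \+ (g \* (derive1 f)))).
  move=> x; have fx := smooth_upto_derive1 x sf.
  have gx := smooth_upto_derive1 x sg.
  exact: is_deriveM.
by apply: smooth_uptoD; apply: IH;
  [exact: smooth_uptoW|case: sg|exact: smooth_uptoW|case: sf].
Qed.

Lemma smooth_cst c : smooth (cst c).
Proof. by move=> n; exact: smooth_upto_cst. Qed.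

Lemma smoothD f g : smooth f -> smooth g -> smooth (f \+ g).
Proof. by move=> sf sg n; exact: smooth_uptoD. Qed.

Lemma smoothM f g : smooth f -> smooth g -> smooth (f \* g).
Proof. by move=> sf sg n; exact: smooth_uptoM. Qed.

Lemma smoothZ c f : smooth f -> smooth (fun x => c * f x).
Proof. by move=> sf; apply: (@smoothM (cst c)) => //; exact: smooth_cst. Qed.

Lemma smoothX k f : smooth f -> smooth (fun x => f x ^+ k).
Proof.
move=> sf; elim: k => [|k IH]; first exact: (@smooth_cst 1).
rewrite (_ : (fun x => _) = f \* (fun x => f x ^+ k)); first exact: smoothM.
by apply/funext => x; rewrite /= exprS.
Qed.

Lemma smooth_derive1 f : smooth f -> smooth (derive1 f).
Proof. by move=> sf n; case: (sf n.+1). Qed.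

Lemma smooth_is_derive f (x : R) : smooth f -> is_derive x 1 f (derive1 f x).
Proof. by move=> sf; exact: (smooth_upto_derive1 x (sf 1%N)). Qed.

Lemma smooth_continuous f : smooth f -> continuous f.
Proof.
move=> sf x; apply: differentiable_continuous; apply/derivable1_diffP.
by case: (sf 1%N).
Qed.

Lemma smooth_primitive f g : (forall x : R, is_derive x 1 f (g x)) -> smooth g ->
  smooth f.
Proof.
move=> fg sg [//|n]; exact: (smooth_upto_is_derive fg).
Qed.

Lemma smooth_affine (a b : R) f : smooth f -> smooth (fun x => f (a * x + b)).
Proof.
have ab (x : R) : is_derive x 1 (fun x : R => a * x + b) a.
  by apply: is_derive_eq; rewrite addr0 [LHS]mulr1.
move=> sf n; elim: n f sf => [//|n IH] f sf.
apply: (@smooth_upto_is_derive _ _ (fun x => a * (derive1 f) (a * x + b))).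
  move=> x; rewrite mulrC; apply: (@is_derive1_comp _ f) => //.
  exact: smooth_is_derive.
apply: (@smooth_uptoM _ (cst a)); first exact: smooth_upto_cst.
exact/IH/smooth_derive1.
Qed.

(** For k = 0 this is the classical function that is flat at the origin. The factor x^-k makes the
    family stable under differentiation up to linear combinations, so one induction shows all
    members smooth. *)
Definition flat (k : nat) (x : R) : R :=
  if 0 < x then x^-1 ^+ k * expR (- x^-1) else 0.

Lemma flat_ge0 k x : 0 <= flat k x.
Proof.
rewrite /flat; case: ifPn => // x0.
by rewrite mulr_ge0 ?exprn_ge0 ?invr_ge0 ?expR_ge0// ltW.
Qed.

(** With y = 1/x this is y^(k+2) <= (k+2)! e^y, which keeps a single term of the exponential series.
    The square on the right makes the difference quotient at 0 vanish in the limit. *)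
Lemma flat_le_sqr k (x : R) : flat k x <= (k.+2)`!%:R * x ^+ 2.
Proof.
rewrite /flat; case: ifPn => [x0|_]; last by rewrite mulr_ge0 ?sqr_ge0.
have y0 : 0 < x^-1 by rewrite invr_gt0.
have fact0 : (0 : R) < (k.+2)`!%:R by rewrite ltr0n fact_gt0.
have := @expR_ge1Dxn _ x^-1 k.+1 (ltW y0).
set f : R := _`!%:R in fact0 *; set y := x^-1 in y0 * => h.
have {}h : y ^+ k.+2 <= f * expR y.
  rewrite mulrC -ler_pdivrMr//; apply: le_trans h.
  by rewrite lerDr.
rewrite expRN -[X in _ <= X * _](mulfK (lt0r_neq0 (expR_gt0 y))).
rewrite -ler_pdivrMr ?exprn_gt0// -mulrAC.
by rewrite ler_wpM2r ?invr_ge0 ?expR_ge0// -exprVn -/y -exprD addn2.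
Qed.

Lemma flat_derive k (x : R) :
  is_derive x 1 (flat k) (flat k.+2 x - k%:R * flat k.+1 x).
Proof.
case: (ltgtP x 0) => [x0|x0|->].
- apply: (@near_eq_is_derive _ _ _ (cst 0)).
    near=> z; have zx : z < 0 by near: z; apply: lt_nbhsl.
    by rewrite /flat/= ltNge (ltW zx).
  by rewrite /flat ltNge (ltW x0)/= mulr0 subrr; exact: is_derive_cst.
- apply: (@near_eq_is_derive _ _ _ (fun z : R => z^-1 ^+ k * expR (- z^-1))).
    near=> z; have zx : 0 < z by near: z; apply: lt_nbhsr.
    by rewrite /flat/= zx.
  rewrite /flat x0.
  have xn0 : x != 0 by rewrite gt_eqF.
  have dV : is_derive x 1 (fun z : R => z^-1) (- x ^- 2).
    have := @is_deriveV R id x 1 1 xn0 (is_derive_id _ _).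
    by rewrite /GRing.scale/= mulr1.
  have dN : is_derive x 1 (fun z : R => - z^-1) (x ^- 2).
    by rewrite -[X in is_derive _ _ _ X]opprK; exact: is_deriveN.
  have dE : is_derive x 1 (fun z : R => expR (- z^-1)) (expR (- x^-1) * x ^- 2).
    exact: (@is_derive1_comp _ expR).
  have dX : is_derive x 1 (fun z : R => z^-1 ^+ k)
     (k%:R * x^-1 ^+ k.-1 * - x ^- 2).
    have := @is_deriveX R R (fun z : R => z^-1) k x 1 _ dV.
    by rewrite exprfctE.
  have := is_deriveM dX dE; congr is_derive.
  rewrite /GRing.scale/= -!exprVn.
  case: k {dX dN dE dV} => [|k]; rewrite ?expr0 /=; first by ring.
  rewrite !exprS; ring.
- have f0 j : flat j 0 = 0 by rewrite /flat ltxx.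
  rewrite !f0 mulr0 subrr.
  (* At the origin [flat_le_sqr] bounds the quotient by (k+2)! times |h|. *)
  have cv : (fun h : R => h^-1 *: ((flat k \o shift 0) (h *: 1) - flat k 0))
      @ 0^' --> (0 : R).
    apply/cvgr0Pnorm_lt => /= e e0.
    have fact0 : (0 : R) < (k.+2)`!%:R by rewrite ltr0n fact_gt0.
    near=> h.
    rewrite f0 subr0 /= addr0 /GRing.scale/= mulr1 normrM.
    rewrite (ger0_norm (flat_ge0 _ _)).
    have h0 : h != 0 by near: h; exact: nbhs_dnbhs_neq.
    have hn0 : 0 < `|h| by rewrite normr_gt0.
    rewrite normfV mulrC ltr_pdivrMr//.
    apply: le_lt_trans (flat_le_sqr k h) _.
    rewrite -real_normK ?num_real// expr2 mulrA ltr_pM2r//.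
    rewrite mulrC -ltr_pdivlMr//.
    near: h; apply: (@dnbhs0_lt R R); exact: divr_gt0.
  split; first by apply/cvg_ex; exists 0.
  exact: cvg_lim cv.
Unshelve. all: by end_near. Qed.

Lemma smooth_flat k : smooth (flat k).
Proof.
move=> n; elim: n k => [//|n IH] k.
apply: (smooth_upto_is_derive (flat_derive k)).
rewrite (_ : (fun _ => _) = flat k.+2 \+ (cst (- k%:R) \* flat k.+1)).
  apply: smooth_uptoD => //; apply: smooth_uptoM => //.
  exact: smooth_upto_cst.
by apply/funext => x /=; rewrite mulNr.
Qed.

(** Positive exactly on ]p, q[ and below 1 everywhere: powers of 1 - [bump] tend to 0 inside the
    interval and remain 1 outside. *)
Definition bump (p q x : R) : R := flat 0 (x - p) * flat 0 (q - x).

Lemma smooth_bump p q : smooth (bump p q).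
Proof.
apply: smoothM.
  have := @smooth_affine 1 (- p) _ (smooth_flat 0).
  by under eq_fun do rewrite mul1r.
have := @smooth_affine (-1) q _ (smooth_flat 0).
by under eq_fun do rewrite mulN1r addrC.
Qed.

Lemma flat0_lt1 x : flat 0 x < 1.
Proof.
rewrite /flat; case: ifPn => // x0.
by rewrite expr0 mul1r expR_lt1 oppr_lt0 invr_gt0.
Qed.

Lemma flat0_gt0 x : (0 < flat 0 x) = (0 < x).
Proof.
by rewrite /flat; case: ifPn; rewrite ?ltxx// expr0 mul1r expR_gt0.
Qed.

Lemma bump_ge0 p q x : 0 <= bump p q x.
Proof. by rewrite mulr_ge0 ?flat_ge0. Qed.

Lemma bump_lt1 p q x : bump p q x < 1.
Proof.
rewrite /bump; have := flat0_lt1 (x - p); have := flat0_lt1 (q - x).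
have := flat_ge0 0 (x - p); have := flat_ge0 0 (q - x); nra.
Qed.

Lemma bump_gt0 p q x : (0 < bump p q x) = (p < x < q).
Proof.
rewrite /bump; have [px|px] := boolP (p < x); last first.
  rewrite (_ : flat 0 (x - p) = 0) ?mul0r ?ltxx//.
  by apply/eqP; rewrite -leNgt in px; rewrite eq_le flat_ge0 leNgt flat0_gt0 -leNgt subr_le0 px.
by rewrite pmulr_rgt0 ?flat0_gt0 subr_gt0.
Qed.

Lemma bump_eq0 p q x : ~~ (p < x < q) -> bump p q x = 0.
Proof.
by rewrite -bump_gt0 -leNgt => h; apply/eqP; rewrite eq_le h bump_ge0.
Qed.

(* A smooth substitute for the indicator function of ]p, q[, to which it
   converges as n grows. *)
Definition plateau (p q : R) (n : nat) (x : R) : R :=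
  1 - (1 - bump p q x) ^+ n.

Lemma smooth_plateau p q n : smooth (plateau p q n).
Proof.
apply: (@smoothD (cst 1) (fun x => - (1 - bump p q x) ^+ n)).
  exact: smooth_cst.
rewrite (_ : (fun x => _) = (fun x => -1 * ((1 - bump p q x) ^+ n))); last first.
  by apply/funext => x; rewrite mulN1r.
apply/smoothZ/smoothX/(@smoothD (cst 1) (fun x => - bump p q x)).
  exact: smooth_cst.
rewrite (_ : (fun x => _) = (fun x => -1 * bump p q x)); last first.
  by apply/funext => x; rewrite mulN1r.
exact/smoothZ/smooth_bump.
Qed.

Lemma plateau_ge0 p q n x : 0 <= plateau p q n x.
Proof.
rewrite subr_ge0 exprn_ile1// ?subr_ge0 ?(ltW (bump_lt1 _ _ _))//.
by rewrite gerBl bump_ge0.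
Qed.

Lemma plateau_le1 p q n x : plateau p q n x <= 1.
Proof. by rewrite gerBl exprn_ge0// subr_ge0 ltW// bump_lt1. Qed.

Lemma plateau_eq0 p q n x : ~~ (p < x < q) -> plateau p q n x = 0.
Proof. by move=> /bump_eq0 h; rewrite /plateau h subr0 expr1n subrr. Qed.

Lemma cvg_plateau p q x :
  (fun n => plateau p q n x) @ \oo --> (\1_`]p, q[%classic x : R).
Proof.
rewrite indicE; have [xpq|xpq] := boolP (p < x < q); last first.
  rewrite memNset; last by rewrite /= in_itv/=; exact/negP.
  by under eq_fun do rewrite plateau_eq0//; exact: cvg_cst.
rewrite mem_set; last by rewrite /= in_itv.
rewrite [X in _ --> X](_ : _ = 1 - 0); last by rewrite subr0.
apply: cvgB; first exact: cvg_cst.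
apply: cvg_expr; rewrite ger0_norm; last by rewrite subr_ge0 ltW ?bump_lt1.
by rewrite gtrBl bump_gt0.
Qed.

End SmoothLine.

(** * Measure-preserving maps *)

Section Preserving.
Local Open Scope ereal_scope.
Context d (X : measurableType d) (R : realType).

Definition preserving (mu : set X -> \bar R) (T : X -> X) : Prop :=
  measurable_fun setT T /\
  forall A, measurable A -> mu (T @^-1` A) = mu A.

Context (mu : {measure set X -> \bar R}).
Implicit Types (T : X -> X) (D : set X).

Lemma preserving_measurable_preimage T D : preserving mu T -> measurable D ->
  measurable (T @^-1` D).
Proof. by move=> [mT _] mD; rewrite -[_ @^-1` _]setTI; exact: mT. Qed.

Lemma preserving_measurable_fun T d' (Y : measurableType d') D (f : X -> Y) :
  preserving mu T -> measurable D -> measurable_fun D f ->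
  measurable_fun (T @^-1` D) (f \o T).
Proof.
move=> pT mD mf _ B mB.
by apply: (preserving_measurable_preimage pT (D := D `&` f @^-1` B)); exact: mf.
Qed.

Lemma preserving_ge0_integral T D (f : X -> \bar R) : preserving mu T ->
  measurable D -> measurable_fun D f -> {in D, forall y, 0 <= f y} ->
  \int[mu]_(x in D) f x = \int[mu]_(x in T @^-1` D) f (T x).
Proof.
move=> [mT pT] mD mf f0.
rewrite -[RHS](ge0_integral_pushforward mT)//.
have := @eq_measure_integral _ X R D
  (measure_function_pushforward__canonical__measure_function_Measure mu mT)
  mu f.
by apply => A mA _; rewrite /= /pushforward pT.
Qed.

(** Positive and negative parts are transported separately, so non-integrable functions are covered
    too. *)
Lemma preserving_integral T D (f : X -> \bar R) : preserving mu T ->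
  measurable D -> measurable_fun D f ->
  \int[mu]_(x in D) f x = \int[mu]_(x in T @^-1` D) f (T x).
Proof.
move=> pT mD mf; rewrite integralE [RHS]integralE.
rewrite (preserving_ge0_integral pT mD); last 2 first.
  exact: measurable_funepos.
  by move=> x _; exact: funepos_ge0.
rewrite (@preserving_ge0_integral _ _ f^\- pT mD); last 2 first.
  exact: measurable_funeneg.
  by move=> x _; exact: funeneg_ge0.
congr (_ - _); apply: eq_integral => x _.
  by have := congr1 (fun h => h x) (funepos_comp f T) => /= <-.
by have := congr1 (fun h => h x) (funeneg_comp f T) => /= <-.
Qed.

Lemma preserving_Rintegral T D (f : X -> R) : preserving mu T ->
  measurable D -> measurable_fun D f ->
  (\int[mu]_(x in D) f x = \int[mu]_(x in T @^-1` D) f (T x))%R.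
Proof.
move=> pT mD mf; congr fine.
by rewrite (preserving_integral pT mD)//; exact/measurable_EFinP.
Qed.

Lemma preserving_ae T (P : X -> Prop) : preserving mu T ->
  {ae mu, forall x, P x} -> {ae mu, forall x, P (T x)}.
Proof.
move=> pT [N [mN N0 PN]]; exists (T @^-1` N); split.
- exact: (preserving_measurable_preimage pT).
- by have [_ ->] := pT.
- by move=> x /= nPx; exact: PN.
Qed.

End Preserving.

(** The section at x of the preimage is the preimage under g of the section at f x; the integral of
    its measure over x is then transported by f. *)
Lemma preserving_prod d1 d2 (X : measurableType d1) (Y : measurableType d2)
    (R : realType) (m1 : {measure set X -> \bar R})
    (m2 : {sigma_finite_measure set Y -> \bar R}) (f : X -> X) (g : Y -> Y) :
  preserving m1 f -> preserving m2 g ->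
  preserving (m1 \x m2)%E (fun p => (f p.1, g p.2)).
Proof.
move=> pf [mg pg]; have [mf _] := pf; split.
  apply/measurable_fun_pairP; split => /=.
    exact: (measurableT_comp mf measurable_fst).
  exact: (measurableT_comp mg measurable_snd).
move=> A mA; rewrite /product_measure1.
rewrite [RHS](preserving_integral pf) ?preimage_setT//; last first.
  exact: measurable_fun_xsection.
apply: eq_integral => x _ /=.
rewrite -[RHS]pg; last exact: measurable_xsection.
by congr (m2 _); apply/seteqP; split=> y /=; rewrite /xsection/= !inE.
Qed.

Section PreservingLine.
Context {R : realType}.
Notation leb := (@lebesgue_measure R).

Lemma preserving_id d (X : measurableType d) (mu : {measure set X -> \bar R}) :
  preserving mu id.
Proof. by split; [exact: measurable_id|]. Qed.

(** The pushforward by f agrees with Lebesgue measure on half-open intervals, and these determine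
    it. *)
Lemma preserving_ocitv (f : measurableTypeR R -> measurableTypeR R)
    (mf : measurable_fun setT f) :
  (forall a b : R, a < b -> leb (f @^-1` `]a, b]%classic) = (b - a)%:E) ->
  preserving leb f.
Proof.
move=> h; split => // A mA; apply/esym.
apply: (@lebesgue_measure_unique R
  (measure_function_pushforward__canonical__measure_function_Measure leb mf)) => // X.
move=> /= [[a b] _ <-] /=; rewrite /pushforward.
have [ab|ba] := ltP a b.
  by rewrite h// lebesgue_measure_itv/= lte_fin ab.
by rewrite set_itv_ge ?bnd_simp -?leNgt// preimage_set0 !measure0.
Qed.

Lemma preserving_shift (t : R) : preserving leb (fun x : R => x + t).
Proof.
have mf : measurable_fun (setT : set (measurableTypeR R)) (fun x : R => x + t).
  exact: measurable_funD.
apply: (preserving_ocitv mf) => a b ab.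
rewrite (_ : _ @^-1` _ = `](a - t), (b - t)]%classic).
  rewrite lebesgue_measure_itv/= lte_fin ltrD2r ab -EFinB; congr EFin; ring.
by apply/seteqP; split => x /=; rewrite !in_itv/= ltrBlDr lerBrDr.
Qed.

Lemma preserving_opp : preserving leb (fun x : R => - x).
Proof.
have mf : measurable_fun (setT : set (measurableTypeR R)) (fun x : R => - x).
  exact: measurableT_comp.
apply: (preserving_ocitv mf) => a b ab.
rewrite (_ : _ @^-1` _ = `[- b, - a[%classic).
  rewrite lebesgue_measure_itv/= lte_fin ltrN2 ab -EFinB; congr EFin; ring.
by apply/seteqP; split => x /=; rewrite !in_itv/= lerNl ltrNr andbC.
Qed.

End PreservingLine.

Section Isometries.
Context {R : realType}.
Implicit Types p : pt3 R.

Definition yshift (t1 t2 : R) p : pt3 R := (p.1, (p.2.1 + t1, p.2.2 + t2)).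
Definition flip3 p : pt3 R := (- p.1, p.2).
Definition flip2 p : pt3 R := (p.1, (p.2.1, - p.2.2)).

Lemma preserving_volume (f1 f2 f3 : R -> R) :
  preserving (@lebesgue_measure R) f1 -> preserving (@lebesgue_measure R) f2 ->
  preserving (@lebesgue_measure R) f3 ->
  preserving (@volume R) (fun p => (f1 p.1, (f2 p.2.1, f3 p.2.2))).
Proof.
move=> h1 h2 h3; exact: (@preserving_prod _ _ _ _ R (@lebesgue_measure R) (@area R) _
  (fun q => (f2 q.1, f3 q.2)) h1 (preserving_prod h2 h3)).
Qed.

Lemma preserving_volume_yshift t1 t2 : preserving volume (yshift t1 t2).
Proof.
exact: (@preserving_volume id (fun x => x + t1) (fun x => x + t2)
  (preserving_id _) (preserving_shift t1) (preserving_shift t2)).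
Qed.

Lemma preserving_volume_flip3 : preserving volume flip3.
Proof.
rewrite (_ : flip3 = (fun p => (- p.1, (p.2.1, p.2.2)))).
  exact: (@preserving_volume (fun x => - x) id id
    preserving_opp (preserving_id _) (preserving_id _)).
by apply/funext => -[? [? ?]].
Qed.

Lemma preserving_volume_flip2 : preserving volume flip2.
Proof.
exact: (@preserving_volume id id (fun x => - x)
  (preserving_id _) (preserving_id _) preserving_opp).
Qed.

End Isometries.

(** * Integrals of products of functions of separate variables *)

Section ProductIntegral.
Local Open Scope ereal_scope.
Context d1 d2 (X : measurableType d1) (Y : measurableType d2) (R : realType).
Context (m1 : {sigma_finite_measure set X -> \bar R})
  (m2 : {sigma_finite_measure set Y -> \bar R}).
Context (f : X -> R) (g : Y -> R).
Context (intf : m1.-integrable setT (EFin \o f))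
  (intg : m2.-integrable setT (EFin \o g)).

Lemma integrable_prod_tensor :
  (m1 \x m2).-integrable setT (fun p => (f p.1 * g p.2)%:E).
Proof.
have mf : measurable_fun setT f by apply/measurable_EFinP/(measurable_int _ intf).
have mg : measurable_fun setT g by apply/measurable_EFinP/(measurable_int _ intg).
apply/integrable12ltyP.
  apply/measurable_EFinP; apply: measurable_funM.
    exact: (measurableT_comp mf measurable_fst).
  exact: (measurableT_comp mg measurable_snd).
have ifn := integrable_norm intf; have ign := integrable_norm intg.
under eq_integral => x _.
  under eq_integral do rewrite /= normrM EFinM.
  rewrite integralZl//; over.
have h' := integrable_fin_num measurableT ign.
under eq_integral do rewrite -(fineK h').
rewrite integralZr//.
have h := integrable_fin_num measurableT ifn.
by rewrite -(fineK h) -EFinM ltry.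
Qed.

Lemma Rintegral_prod_tensor :
  (\int[m1 \x m2]_p (f p.1 * g p.2) = (\int[m1]_x f x) * (\int[m2]_y g y))%R.
Proof.
rewrite /Rintegral -[X in fine X = _](integral12_prod_meas1 integrable_prod_tensor).
rewrite /fubini_F /=.
under eq_integral => x _.
  under eq_integral do rewrite /= EFinM.
  rewrite integralZl//; over.
have h := integrable_fin_num measurableT intg.
under eq_integral do rewrite -(fineK h).
rewrite integralZr//; have h' := integrable_fin_num measurableT intf.
by rewrite -(fineK h') -EFinM.
Qed.

End ProductIntegral.

(** * Open sets and the product sigma-algebra *)

Section Open.
Context {R : realType}.

Lemma rat_approx (x e : R) : 0 < e -> exists q : rat, `|x - ratr q| < e.
Proof.
move=> e0; have [|q] := @rat_in_itvoo R (x - e) (x + e); first by lra.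
rewrite in_itv/= => /andP[h1 h2]; exists q.
by rewrite ltr_distl; apply/andP; split; lra.
Qed.

(** Open sets come from the product topology, measurable sets from measurable rectangles. They meet
    because an open set is the union of the countably many balls with rational centre and radius
    1/(n+1) that it contains, and each ball is a rectangle. *)
Lemma open_pt3_measurable (A : set (pt3 R)) : open A -> measurable A.
Proof.
move=> oA.
pose c (q : rat * (rat * rat) * nat) : pt3 R :=
  (ratr q.1.1, (ratr q.1.2.1, ratr q.1.2.2)).
pose r (q : rat * (rat * rat) * nat) : R := q.2.+1%:R^-1.
pose B (q : rat * (rat * rat) * nat) : set (pt3 R) := ball (c q) (r q).
pose C q : set (pt3 R) := if pselect (B q `<=` A) then B q else set0.
have -> : A = \bigcup_q C q.
  apply/seteqP; split => [p Ap|p [q _]]; last first.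
    by rewrite /C; case: pselect => // BA; exact: BA.
  have [e /= e0 eA] : exists2 e : R, 0 < e & ball p e `<=` A.
    by have /nbhs_ballP[e e0 eA] := open_nbhs_nbhs (conj oA Ap); exists e.
  (* Two radii below e/2: a ball of this radius that contains p stays within distance e of p. *)
  have [n ne] : exists n, n.+1%:R^-1 < e / 2.
    have e20 : 0 < e / 2 by rewrite divr_gt0.
    have [n _ nlt] := near_infty_natSinv_lt (PosNum e20).
    by exists n; have := nlt n (leqnn n).
  have rn0 : (0 : R) < n.+1%:R^-1 by rewrite invr_gt0 ltr0n.
  have [q1 h1] := rat_approx p.1 rn0.
  have [q2 h2] := rat_approx p.2.1 rn0.
  have [q3 h3] := rat_approx p.2.2 rn0.
  have Bp : B ((q1, (q2, q3)), n) p.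
    by do !split => //=; rewrite /ball/= distrC.
  exists ((q1, (q2, q3)), n) => //; rewrite /C; case: pselect => //= nBA.
  exfalso; apply: nBA => z Bz; apply: eA.
  apply: (@le_ball _ _ _ (n.+1%:R^-1 + n.+1%:R^-1)).
    by rewrite (splitr e) lerD// ltW.
  by apply: ball_triangle Bz; exact: ball_sym.
apply: countable_bigcupT_measurable => [|q]; first exact: countableP.
rewrite /C; case: pselect => [BA|nBA]; rewrite ?/=; last exact: measurable0.
suff: measurable (ball (c q).1 (r q) `*` (ball (c q).2.1 (r q) `*` ball (c q).2.2 (r q))) by [].
by do !apply: measurableX; apply: measurable_ball.
Qed.

Lemma continuous_pt3_measurable (f : pt3 R -> R) : continuous f ->
  measurable_fun setT f.
Proof.
move=> /continuousP cf; apply: (measurability _ (RGenOpens.measurableE R)).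
move=> _ [_ [a [b ->] <-]]; rewrite setTI.
apply: open_pt3_measurable; apply: cf; exact: interval_open.
Qed.

End Open.

(** * Integrals over boxes *)

Section RintegralTools.
Context d (T : measurableType d) (R : realType).
Context (mu : {measure set T -> \bar R}).
Implicit Types (D E : set T) (f g : T -> R).

Lemma Rintegral_support D E f : E `<=` D ->
  (forall x, D x -> ~ E x -> f x = 0) ->
  \int[mu]_(x in D) f x = \int[mu]_(x in E) f x.
Proof.
move=> ED f0; rewrite Rintegral_mkcond [RHS]Rintegral_mkcond.
apply: eq_Rintegral => x _; rewrite !patchE.
have [Ex|nEx] := pselect (E x).
  by rewrite !mem_set//; exact: ED.
rewrite (memNset nEx); have [Dx|nDx] := pselect (D x).
  by rewrite mem_set// f0.
by rewrite memNset.
Qed.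

Lemma integrable_support D E f : measurable D -> measurable E -> E `<=` D ->
  (forall x, D x -> ~ E x -> f x = 0) ->
  mu.-integrable E (EFin \o f) -> mu.-integrable D (EFin \o f).
Proof.
move=> mD mE ED f0; rewrite [X in X -> _]integrable_mkcond// => h.
have := integrableS measurableT mD (@subsetT _ _) h.
apply: eq_integrable => // x; rewrite inE => Dx; rewrite patchE.
have [Ex|nEx] := pselect (E x); first by rewrite mem_set.
by rewrite memNset//= f0.
Qed.

Lemma ae_eq_Rintegral D f g : measurable D -> measurable_fun D f ->
  measurable_fun D g -> {ae mu, forall x, D x -> f x = g x} ->
  \int[mu]_(x in D) f x = \int[mu]_(x in D) g x.
Proof.
move=> mD mf mg fg; congr fine; apply: ae_eq_integral => //.
- exact/measurable_EFinP.
- exact/measurable_EFinP.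
- by apply: filterS fg => x h Dx; rewrite h.
Qed.

Lemma dominated_Rintegral_cvg D (f_ : nat -> T -> R) f g : measurable D ->
  (forall n, measurable_fun D (f_ n)) -> measurable_fun D f ->
  (forall x, D x -> f_ n x @[n --> \oo] --> f x) ->
  mu.-integrable D (EFin \o g) ->
  (forall n x, D x -> `|f_ n x| <= g x) ->
  mu.-integrable D (EFin \o f) /\
  \int[mu]_(x in D) f_ n x @[n --> \oo] --> \int[mu]_(x in D) f x.
Proof.
move=> mD mf_ mf cvgf intg f_g.
have [||||intf _ h] := @dominated_convergence _ T R mu D mD
   (fun n => EFin \o f_ n) (EFin \o f) (EFin \o g) _ _ _ intg.
- by move=> n; exact/measurable_EFinP.
- exact/measurable_EFinP.
- by apply: aeW => x Dx; apply: cvg_EFin; [exact: nearW|exact: cvgf].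
- by apply: aeW => x n Dx; rewrite lee_fin f_g.
split => //; apply: fine_cvg.
rewrite fineK; first exact: h.
exact: integrable_fin_num.
Qed.

End RintegralTools.

Section Boxes.
Context {R : realType}.
Implicit Types (p q : pt3 R).

Definition obox p q : set (pt3 R) :=
  `]p.1, q.1[%classic `*`
  (`]p.2.1, q.2.1[%classic `*` `]p.2.2, q.2.2[%classic).

Definition cbox p q : set (pt3 R) :=
  `[p.1, q.1]%classic `*`
  (`[p.2.1, q.2.1]%classic `*` `[p.2.2, q.2.2]%classic).

Lemma oboxP p q x : obox p q x <->
  [/\ p.1 < x.1 < q.1, p.2.1 < x.2.1 < q.2.1 & p.2.2 < x.2.2 < q.2.2].
Proof.
by rewrite /obox/=; split; rewrite !in_itv/= => -[? []] // ? ?; split.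
Qed.

Lemma measurable_obox p q : measurable (obox p q).
Proof. by do !apply: measurableX; exact: measurable_itv. Qed.

Lemma measurable_cbox p q : measurable (cbox p q).
Proof. by do !apply: measurableX; exact: measurable_itv. Qed.

Lemma compact_cbox p q : compact (cbox p q).
Proof. by do !apply: compact_setX; exact: segment_compact. Qed.

Lemma obox_sub_cbox p q : obox p q `<=` cbox p q.
Proof.
move=> x /oboxP[h1 h2 h3]; rewrite /cbox/= !in_itv/=.
by split; [|split]; apply/andP; split; apply: ltW; move: h1 h2 h3 => /andP[? ?] /andP[? ?] /andP[? ?].
Qed.

Lemma volume_cbox p q : (volume (cbox p q) < +oo)%E.
Proof.
rewrite /volume /cbox product_measure1E//; last first.
  by apply: measurableX; exact: measurable_itv.
rewrite [X in (_ * X)%E](_ : _ = area (`[p.2.1, q.2.1]%classic `*` `[p.2.2, q.2.2]%classic))//.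
rewrite /area product_measure1E//.
rewrite /= !lebesgue_measure_itv/= !lte_fin.
by do !case: ifP => _; rewrite ?mule0 ?mul0e// -?EFinB -?EFinM ?ltry.
Qed.

Lemma volume_obox p q : p.1 < q.1 -> p.2.1 < q.2.1 -> p.2.2 < q.2.2 ->
  volume (obox p q) =
  ((q.1 - p.1) * ((q.2.1 - p.2.1) * (q.2.2 - p.2.2)))%:E.
Proof.
move=> h1 h2 h3.
rewrite /volume /obox product_measure1E//; last first.
  by apply: measurableX; exact: measurable_itv.
rewrite [X in (_ * X)%E](_ : _ = area (`]p.2.1, q.2.1[%classic `*` `]p.2.2, q.2.2[%classic))//.
rewrite /area product_measure1E//.
by rewrite /= !lebesgue_measure_itv/= !lte_fin h1 h2 h3.
Qed.

(** The corners are not ordered, so empty intersections are boxes as well. *)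
Definition boxes : set (set (pt3 R)) := [set B | exists p q, B = obox p q].

Lemma setI_closed_boxes : setI_closed boxes.
Proof.
move=> _ _ [p [q ->]] [p' [q' ->]].
exists (Num.max p.1 p'.1, (Num.max p.2.1 p'.2.1, Num.max p.2.2 p'.2.2)).
exists (Num.min q.1 q'.1, (Num.min q.2.1 q'.2.1, Num.min q.2.2 q'.2.2)).
apply/seteqP; split => x.
  move=> [] /oboxP[h1 h2 h3] /oboxP[h1' h2' h3']; apply/oboxP => /=.
  by rewrite !gt_max !lt_min; split; lra.
move=> /oboxP /=; rewrite !gt_max !lt_min => -[h1 h2 h3].
by split; apply/oboxP; split; lra.
Qed.

Let S' := g_sigma_algebraType boxes.

(** Half-spaces are countable unions of boxes; through them each coordinate becomes measurable for
    the sigma-algebra generated by boxes. *)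
Lemma boxes_ray1 (a : R) : <<s boxes >> [set p : pt3 R | a < p.1].
Proof.
rewrite (_ : mkset _ =
  \bigcup_n obox (a, (- n%:R, - n%:R)) (n%:R, (n%:R, n%:R))).
  have := @bigcupT_measurable _ S'; apply => n.
  by apply: sub_sigma_algebra; exists (a, (- n%:R, - n%:R)), (n%:R, (n%:R, n%:R)).
apply/seteqP; split => [p /= ap|p [n _ /oboxP[/= + _ _]]]; last by case/andP.
have [n h] : exists n, `|p.1| + `|p.2.1| + `|p.2.2| < n%:R.
  exists (Num.truncn (`|p.1| + `|p.2.1| + `|p.2.2|)).+1.
  by apply: truncnS_gt.
exists n => //; apply/oboxP => /=; rewrite ap/= -!ltr_norml.
have := normr_ge0 p.1; have := normr_ge0 p.2.1; have := normr_ge0 p.2.2.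
by move: (ler_norm p.1) => *; split; lra.
Qed.

Lemma boxes_ray2 (a : R) : <<s boxes >> [set p : pt3 R | a < p.2.1].
Proof.
rewrite (_ : mkset _ =
  \bigcup_n obox (- n%:R, (a, - n%:R)) (n%:R, (n%:R, n%:R))).
  have := @bigcupT_measurable _ S'; apply => n.
  by apply: sub_sigma_algebra; exists (- n%:R, (a, - n%:R)), (n%:R, (n%:R, n%:R)).
apply/seteqP; split => [p /= ap|p [n _ /oboxP[/= _ + _]]]; last by case/andP.
have [n h] : exists n, `|p.1| + `|p.2.1| + `|p.2.2| < n%:R.
  exists (Num.truncn (`|p.1| + `|p.2.1| + `|p.2.2|)).+1.
  by apply: truncnS_gt.
exists n => //; apply/oboxP => /=; rewrite ap/= -!ltr_norml.
have := normr_ge0 p.1; have := normr_ge0 p.2.1; have := normr_ge0 p.2.2.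
by move: (ler_norm p.2.1) => *; split; lra.
Qed.

Lemma boxes_ray3 (a : R) : <<s boxes >> [set p : pt3 R | a < p.2.2].
Proof.
rewrite (_ : mkset _ =
  \bigcup_n obox (- n%:R, (- n%:R, a)) (n%:R, (n%:R, n%:R))).
  have := @bigcupT_measurable _ S'; apply => n.
  by apply: sub_sigma_algebra; exists (- n%:R, (- n%:R, a)), (n%:R, (n%:R, n%:R)).
apply/seteqP; split => [p /= ap|p [n _ /oboxP[/= _ _ +]]]; last by case/andP.
have [n h] : exists n, `|p.1| + `|p.2.1| + `|p.2.2| < n%:R.
  exists (Num.truncn (`|p.1| + `|p.2.1| + `|p.2.2|)).+1.
  by apply: truncnS_gt.
exists n => //; apply/oboxP => /=; rewrite ap/= -!ltr_norml.
have := normr_ge0 p.1; have := normr_ge0 p.2.1; have := normr_ge0 p.2.2.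
by move: (ler_norm p.2.2) => *; split; lra.
Qed.

(** The harder inclusion says that the identity is measurable out of the space carrying the box
    sigma-algebra, which is checked coordinate by coordinate on rays. *)
Lemma measurable_boxes : (@measurable _ (pt3 R)) = <<s boxes >>.
Proof.
apply/seteqP; split; last first.
  apply: smallest_sub; first exact: sigma_algebra_measurable.
  by move=> _ [p [q ->]]; exact: measurable_obox.
have ray (f : S' -> measurableTypeR R) :
    (forall a, <<s boxes >> [set p | a < f p]) -> measurable_fun setT f.
  move=> h; apply: (measurability _ (RGenOInfty.measurableE R)).
  move=> _ [_ [a ->] <-]; rewrite setTI; have := h a; congr (<<s _ >> _).
  by apply/seteqP; split => x /=; rewrite in_itv/= andbT.
have mid : measurable_fun (setT : set S') (id : S' -> pt3 R).
  apply/measurable_fun_pairP; split; first exact: (ray _ boxes_ray1).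
  apply/measurable_fun_pairP; split; first exact: (ray _ boxes_ray2).
  exact: (ray _ boxes_ray3).
by move=> A mA; have := mid measurableT A mA; rewrite setTI preimage_id.
Qed.

(** The sets whose intersection with the large box has zero integral form a Dynkin system containing
    the pi-system of boxes. Hence g integrates to 0 over every measurable subset of that box. *)
Lemma ae0_of_boxes (g : pt3 R -> R) p q :
  volume.-integrable (obox p q) (EFin \o g) ->
  (forall p' q', obox p' q' `<=` obox p q ->
     \int[volume]_(x in obox p' q') g x = 0) ->
  {ae volume, forall x, obox p q x -> g x = 0}.
Proof.
set D := obox p q => intg g0.
have mD : measurable D by exact: measurable_obox.
have mg : measurable_fun D g.
  by apply/measurable_EFinP; exact: measurable_int intg.
have intA A : measurable A -> A `<=` D -> volume.-integrable A (EFin \o g).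
  by move=> mA AD; exact: (integrableS mD mA AD intg).
have H A : <<s boxes >> A -> \int[volume]_(x in A `&` D) g x = 0.
  move: A; apply: (@dynkin_induction _ _ boxes
    [set A | \int[volume]_(x in A `&` D) g x = 0]
    measurable_boxes setI_closed_boxes) => /=.
  - by rewrite setTI; exact: g0.
  - move=> B BB; have [p' [q' E]] : boxes (B `&` D).
      by apply: setI_closed_boxes => //; exists p, q.
    by rewrite /= E; apply: g0; rewrite -E; exact: subIsetr.
  - move=> S mS S0.
    have := @Rintegral_setU _ _ R volume (S `&` D) (~` S `&` D) g.
    rewrite -setIUl setUCr setTI g0// S0 add0r => <- //.
    + exact: measurableI.
    + by apply: measurableI => //; exact: measurableC.
    + by apply/disj_setPS => x [[? _] []].
  - move=> F mF tF F0; rewrite setI_bigcupl /Rintegral integral_bigcup.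
    + rewrite eseries0// => i _ _; rewrite -[LHS]fineK.
        by move: (F0 i); rewrite /Rintegral => ->.
      apply: integrable_fin_num; first exact: measurableI.
      by apply: intA; [exact: measurableI|exact: subIsetr].
    + exact: trivIset_setIr.
    + by move=> k; exact: measurableI.
    + apply: intA; first by apply: bigcupT_measurable => k; exact: measurableI.
      by move=> x [k _ []].
have h : ae_eq volume D (EFin \o g) (cst 0%E).
  apply: integral_ae_eq => // E ED mE.
  rewrite integral0 -[LHS]fineK.
    have := H E; rewrite -measurable_boxes => /(_ mE).
    by rewrite (setIidl ED) /Rintegral => ->.
  by apply: integrable_fin_num => //; exact: intA.
by apply: filterS h => x + Dx => /(_ Dx) [].
Qed.

(** These boxes exhaust the slab at a positive distance from its faces; the margin 1/(n+2) never
    exceeds 1/2. *)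
Definition inner_box (n : nat) : set (pt3 R) :=
  obox (- (2^-1 - n.+2%:R^-1), (- n%:R, - n%:R)) (2^-1 - n.+2%:R^-1, (n%:R, n%:R)).

Lemma inner_box_cover (p : pt3 R) : slab p -> exists n, inner_box n p.
Proof.
rewrite /slab/= /thickness/= => tp.
have e0 : 0 < 2^-1 - `|p.1| by rewrite subr_gt0 ltr_norml.
have [n1 _ h1] := near_infty_natSinv_lt (PosNum e0).
pose m := Num.truncn (`|p.2.1| + `|p.2.2|).
have hm : `|p.2.1| + `|p.2.2| < m.+1%:R by apply: truncnS_gt.
exists (maxn n1 m.+1); apply/oboxP; rewrite /= -!ltr_norml.
have hM : m.+1%:R <= (maxn n1 m.+1)%:R :> R by rewrite ler_nat leq_maxr.
have hN : (maxn n1 m.+1).+2%:R^-1 < 2^-1 - `|p.1|.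
  have /= := h1 (maxn n1 m.+1).+1; apply.
  by rewrite /= (leq_trans (leq_maxl n1 m.+1)).
have := normr_ge0 p.2.1; have := normr_ge0 p.2.2.
split; first by rewrite ltrBrDl -ltrBrDr.
  by apply: le_lt_trans (lt_le_trans hm hM); rewrite lerDl.
by apply: le_lt_trans (lt_le_trans hm hM); rewrite lerDr.
Qed.

Lemma inner_box_slab p q : - 2^-1 < p.1 -> q.1 < 2^-1 -> cbox p q `<=` slab.
Proof.
move=> hp hq x [/=]; rewrite in_itv/= => /andP[h1 h2] _.
by rewrite /slab/= /thickness/=; apply/andP; split; lra.
Qed.

End Boxes.

(** * Tensor-product test functions *)

Section Lines.
Context {R : realType}.
Implicit Types (V : normedModType R).

Lemma quotient_line V (f : V -> R) (x v : V) (h : R) :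
  h^-1 *: (((fun t : R => f (t *: v + x)) \o shift 0) (h *: 1) - f (0 *: v + x))
  = h^-1 *: ((f \o shift x) (h *: v) - f x).
Proof. by rewrite /= addr0 scale0r add0r [h *: 1]mulr1. Qed.

Lemma derive_lineE V (f : V -> R) (x v : V) :
  'D_1 (fun t : R => f (t *: v + x)) 0 = 'D_v f x.
Proof.
apply: (congr1 (fun F : R -> R => lim (F @ 0^'))).
by apply/funext => h; rewrite quotient_line.
Qed.

(** Directional derivatives are computed along lines, where the one-variable chain and product rules
    apply. *)
Lemma is_derive_line V (f : V -> R) (x v : V) (d : R) :
  is_derive (0 : R) 1 (fun t : R => f (t *: v + x)) d -> is_derive x v f d.
Proof.
move=> [df dv]; split; first exact: (derivable1P f x v).2.
by rewrite -dv derive_lineE.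
Qed.

Lemma derive_line V (f : V -> R) (x v : V) : derivable f x v ->
  is_derive (0 : R) 1 (fun t : R => f (t *: v + x)) ('D_v f x).
Proof.
move=> df; split; first exact: (derivable1P f x v).1.
exact: derive_lineE.
Qed.

Lemma is_derive_oppdir V (f : V -> R) (x v : V) : derivable f x v ->
  is_derive x (- v) f (- 'D_v f x).
Proof.
move=> /derive_line df; apply: is_derive_line.
have dN : is_derive (0 : R) 1 (fun t : R => - t) (- 1).
  exact: is_deriveN.
rewrite -[X in is_derive _ _ _ X]mulrN1.
have := @is_derive1_comp R (fun t : R => f (t *: v + x)) (fun t : R => - t)
  0 ('D_v f x) (- 1).
rewrite oppr0 => /(_ df dN); congr is_derive.
by apply/funext => t /=; rewrite scalerN scaleNr.
Qed.

End Lines.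

Section Smooth3.
Context {R : realType}.
Implicit Types (f g : pt3 R -> R) (p v : pt3 R).

Lemma Ck_continuous k f : Ck k f -> continuous f.
Proof. by case: k => [|k] []. Qed.

Lemma Ck_is_derive k f p v : Ck k.+1 f -> is_derive p v f ('D_v f p).
Proof. by move=> [_ /(_ v)[df _]]; split. Qed.

Lemma Ck_of_derive k f (df : pt3 R -> pt3 R -> R) : continuous f ->
  (forall v p, is_derive p v f (df v p)) -> (forall v, Ck k (df v)) ->
  Ck k.+1 f.
Proof.
move=> cf dfE Cdf; split => // v; split; first by move=> p; have [] := dfE v p.
rewrite (_ : 'D_v f = df v)//; apply/funext => p.
by have [_ ->] := dfE v p.
Qed.

Lemma CkD k f g : Ck k f -> Ck k g -> Ck k (f \+ g).
Proof.
elim: k f g => [|k IH] f g Cf Cg.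
  by split => // p; apply: continuousD; [case: Cf|case: Cg] => cf _; exact: cf.
apply: (@Ck_of_derive _ _ (fun v => 'D_v f \+ 'D_v g)).
- by move=> p; apply: continuousD; [case: Cf|case: Cg] => cf _; exact: cf.
- move=> v p; have := Ck_is_derive p v Cf; have := Ck_is_derive p v Cg.
  by move=> ? ?; exact: is_deriveD.
- by move=> v; apply: IH; [case: Cf|case: Cg] => _ /(_ v)[].
Qed.

Lemma CkZ k (c : R) f : Ck k f -> Ck k (fun p => c * f p).
Proof.
elim: k f => [|k IH] f Cf.
  by split => // p; apply: continuousM; [exact: cvg_cst|case: Cf => cf _; exact: cf].
apply: (@Ck_of_derive _ _ (fun v p => c * 'D_v f p)).
- by move=> p; apply: continuousM; [exact: cvg_cst|case: Cf => cf _; exact: cf].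
- move=> v p; have dfp := Ck_is_derive p v Cf.
  exact: (@is_deriveZ _ _ _ f c).
- by move=> v; apply: IH; case: Cf => _ /(_ v)[].
Qed.

(** T carries the line through p in direction v to the line through T p in direction L v.
    Derivatives of f \o T are therefore derivatives of f composed with T, and the induction
    closes. *)
Lemma Ck_affine k f (T L : pt3 R -> pt3 R) : continuous T ->
  (forall (h : R) v p, T (h *: v + p) = h *: L v + T p) ->
  Ck k f -> Ck k (f \o T).
Proof.
move=> cT TL; elim: k f => [|k IH] f Cf.
  by split => // p; apply: continuous_comp; [exact: cT|case: Cf => cf _; exact: cf].
apply: (@Ck_of_derive _ _ (fun v => 'D_(L v) f \o T)).
- by move=> p; apply: continuous_comp; [exact: cT|case: Cf => cf _; exact: cf].
- move=> v p; apply: is_derive_line.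
  have := Ck_is_derive (T p) (L v) Cf => -[/derive_line + _].
  by congr is_derive; apply/funext => t /=; rewrite TL.
- by move=> v; apply: IH; case: Cf => _ /(_ (L v))[].
Qed.

Lemma derive_affine f (T L : pt3 R -> pt3 R) p v :
  (forall (h : R) v p, T (h *: v + p) = h *: L v + T p) ->
  derivable f (T p) (L v) ->
  'D_v (f \o T) p = 'D_(L v) f (T p).
Proof.
move=> TL /derive_line df.
have [_ <-] : is_derive p v (f \o T) ('D_(L v) f (T p)); last by [].
apply: is_derive_line; move: df; congr is_derive.
by apply/funext => t /=; rewrite TL.
Qed.

Definition tens (a b c : R -> R) (p : pt3 R) : R := a p.1 * b p.2.1 * c p.2.2.

Lemma continuous_tens (a b c : R -> R) : continuous a -> continuous b ->
  continuous c -> continuous (tens a b c).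
Proof.
move=> ca cb cc p; 
apply: (@continuousM _ _ (fun p => a p.1 * b p.2.1) (fun p => c p.2.2) p).
  apply: (@continuousM _ _ (fun p => a p.1) (fun p => b p.2.1) p).
- by apply: continuous_comp; [exact: cvg_fst|exact: ca].
- apply: continuous_comp; last exact: cb.
  by apply: (continuous_comp (f := snd)); [exact: cvg_snd|exact: cvg_fst].
- apply: continuous_comp; last exact: cc.
  by apply: (continuous_comp (f := snd)); [exact: cvg_snd|exact: cvg_snd].
Qed.

Lemma is_derive_coord (a : R -> R) (x v : R) : smooth a ->
  is_derive (0 : R) 1 (fun t : R => a (t * v + x)) (v * derive1 a x).
Proof.
move=> sa; have := smooth_is_derive (0 * v + x) sa => da.
have dl : is_derive (0 : R) 1 (fun t : R => t * v + x) v.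
  by apply: is_derive_eq; rewrite addr0 scaler0 add0r [LHS]mulr1.
have := @is_derive1_comp R a (fun t => t * v + x) 0 _ _ da dl; rewrite mul0r add0r mulrC.
exact.
Qed.

Lemma is_derive_tens (a b c : R -> R) p v : smooth a -> smooth b -> smooth c ->
  is_derive p v (tens a b c)
    (v.1 * tens (derive1 a) b c p + v.2.1 * tens a (derive1 b) c p
     + v.2.2 * tens a b (derive1 c) p).
Proof.
move=> sa sb sc; apply: is_derive_line.
have da := is_derive_coord p.1 v.1 sa.
have db := is_derive_coord p.2.1 v.2.1 sb.
have dc := is_derive_coord p.2.2 v.2.2 sc.
have := is_deriveM (is_deriveM da db) dc.
rewrite /= !mul0r !add0r => h; apply: is_derive_eq h _.
rewrite /tens /GRing.scale/= mulrfctE !mul0r !add0r; ring.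
Qed.

Lemma Ck_tens k (a b c : R -> R) : smooth a -> smooth b -> smooth c ->
  Ck k (tens a b c).
Proof.
have ct (a' b' c' : R -> R) : smooth a' -> smooth b' -> smooth c' ->
    continuous (tens a' b' c').
  by move=> *; apply: continuous_tens; exact: smooth_continuous.
elim: k a b c => [|k IH] a b c sa sb sc; first by split => //; exact: ct.
apply: (@Ck_of_derive _ _ (fun v p =>
  v.1 * tens (derive1 a) b c p + v.2.1 * tens a (derive1 b) c p
     + v.2.2 * tens a b (derive1 c) p)).
- exact: ct.
- by move=> v p; exact: is_derive_tens.
- move=> v; apply: (@CkD _ (fun p => v.1 * tens (derive1 a) b c p
     + v.2.1 * tens a (derive1 b) c p) (fun p => v.2.2 * tens a b (derive1 c) p)).
    apply: (@CkD _ (fun p => v.1 * tens (derive1 a) b c p)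
      (fun p => v.2.1 * tens a (derive1 b) c p)); apply: CkZ; apply: IH => //;
      exact: smooth_derive1.
  by apply: CkZ; apply: IH => //; exact: smooth_derive1.
Qed.

Lemma derive_tens_y1 (a b c : R -> R) p : smooth a -> smooth b -> smooth c ->
  'D_dir_y1 (tens a b c) p = tens a (derive1 b) c p.
Proof.
move=> sa sb sc; have [_ ->] := is_derive_tens p dir_y1 sa sb sc.
by rewrite /= !mul0r mul1r add0r addr0.
Qed.

Lemma derive_tens_y2 (a b c : R -> R) p : smooth a -> smooth b -> smooth c ->
  'D_dir_y2 (tens a b c) p = tens a b (derive1 c) p.
Proof.
move=> sa sb sc; have [_ ->] := is_derive_tens p dir_y2 sa sb sc.
by rewrite /= !mul0r mul1r !add0r.
Qed.

Lemma derive_tens_x3 (a b c : R -> R) p : smooth a -> smooth b -> smooth c ->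
  'D_dir_x3 (tens a b c) p = tens (derive1 a) b c p.
Proof.
move=> sa sb sc; have [_ ->] := is_derive_tens p dir_x3 sa sb sc.
by rewrite /= !mul0r mul1r !addr0.
Qed.

Definition bumps (a : R -> R) : Prop :=
  smooth a /\ exists r : R, forall x, r <= `|x| -> a x = 0.

(** The radius is strictly below 1/2, so a factor in x3 of this kind vanishes near both faces of the
    slab. *)
Definition thin_bumps (a : R -> R) : Prop :=
  smooth a /\ exists2 r : R, r < 2^-1 & forall x, r <= `|x| -> a x = 0.

Lemma thin_bumpsW a : thin_bumps a -> bumps a.
Proof. by move=> [sa [r _ h]]; split => //; exists r. Qed.

Lemma derive1_eq0 (a : R -> R) (r : R) : smooth a ->
  (forall x, r <= `|x| -> a x = 0) -> forall x, r < `|x| -> derive1 a x = 0.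
Proof.
move=> sa h x rx; rewrite derive1E.
rewrite (@near_eq_derive _ _ _ a (cst 0)); first by rewrite derive_cst.
near=> z; rewrite h//=; apply: ltW; near: z.
have c : (fun z : R => `|z|) @ x --> `|x| by exact: norm_continuous.
exact: (c _ (lt_nbhsr rx)).
Unshelve. all: by end_near. Qed.

Lemma bumps_derive1 a : bumps a -> bumps (derive1 a).
Proof.
move=> [sa [r h]]; split; first exact: smooth_derive1.
exists (r + 1) => x rx; apply: (derive1_eq0 sa h).
by apply: lt_le_trans rx; rewrite ltrDl.
Qed.

Lemma thin_bumps_derive1 a : thin_bumps a -> thin_bumps (derive1 a).
Proof.
move=> [sa [r r2 h]]; split; first exact: smooth_derive1.
(* The derivative is known to vanish only strictly beyond r, so the radius moves to the midpoint
   between r and 1/2. *)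
exists ((r + 2^-1) / 2); first by lra.
by move=> x rx; apply: (derive1_eq0 sa h); lra.
Qed.

Lemma bumpsZD (s t : R) a b : bumps a -> bumps b ->
  bumps (fun x => s * a x + t * b x).
Proof.
move=> [sa [r h]] [sb [r' h']]; split.
  by apply: smoothD; exact: smoothZ.
exists (Num.max r r') => x; rewrite ge_max => /andP[? ?].
by rewrite h// h'// !mulr0 addr0.
Qed.

Lemma thin_bumpsZD (s t : R) a b : thin_bumps a -> thin_bumps b ->
  thin_bumps (fun x => s * a x + t * b x).
Proof.
move=> [sa [r r2 h]] [sb [r' r2' h']]; split.
  by apply: smoothD; exact: smoothZ.
exists (Num.max r r'); first by rewrite gt_max r2.
move=> x; rewrite ge_max => /andP[? ?].
by rewrite h// h'// !mulr0 addr0.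
Qed.

Lemma bumps_plateau (p q : R) n : bumps (plateau p q n).
Proof.
split; first exact: smooth_plateau.
exists (Num.max `|p| `|q|) => x; rewrite ge_max => /andP[px qx].
apply: plateau_eq0; apply/negP => /andP[h1 h2].
have := ler_norm q; have := ler_norm (- p); rewrite normrN.
by case: (ler0P x) px qx => ? *; lra.
Qed.

Lemma thin_bumps_plateau (p q : R) n : - 2^-1 < p -> q < 2^-1 -> p < q ->
  thin_bumps (plateau p q n).
Proof.
move=> p2 q2 pq; split; first exact: smooth_plateau.
exists (Num.max (- p) q); first by rewrite gt_max ltrNl p2.
move=> x; rewrite ge_max => /andP[px qx].
apply: plateau_eq0; apply/negP => /andP[h1 h2].
by case: (ler0P x) px qx => ? *; lra.
Qed.

Lemma test_tens a b c : thin_bumps a -> bumps b -> bumps c ->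
  test_function (tens a b c).
Proof.
move=> [sa [r r2 ha]] [sb [s hb]] [sc [t hc]]; split.
  by move=> k; exact: Ck_tens.
exists (cbox (- r, (- s, - t)) (r, (s, t))); split.
- exact: compact_cbox.
- by apply: inner_box_slab => //=; rewrite ltrNl opprK.
- move=> p np; rewrite /tens.
  have [h|/ltW/ha->] := leP `|p.1| r; last by rewrite !mul0r.
  have [h'|/ltW/hb->] := leP `|p.2.1| s; last by rewrite mulr0 mul0r.
  have [h''|/ltW/hc->] := leP `|p.2.2| t; last by rewrite mulr0.
  by exfalso; apply: np; rewrite /cbox/= !in_itv/= -!ler_norml.
Qed.

Lemma bumps_integrable a : bumps a ->
  lebesgue_measure.-integrable setT (EFin \o a).
Proof.
move=> [sa [r h]].
apply: (@integrable_support _ _ R lebesgue_measure setT `[- r, r]%classic) => //.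
  move=> x _ nx; apply: h; rewrite leNgt; apply/negP => xr; apply: nx.
  by rewrite /= in_itv/= -ler_norml ltW.
apply: continuous_compact_integrable; first exact: segment_compact.
by apply: continuous_subspaceT; exact: smooth_continuous.
Qed.

Definition primitive (a : R -> R) (x : R) : R :=
  \int[lebesgue_measure]_(t in `]-oo, x]) a t.

Lemma is_derive_primitive a (x : R) : bumps a ->
  is_derive x 1 (primitive a) (a x).
Proof.
move=> ba; have := @continuous_FTC1 R a -oo%O x (x + 1).
rewrite ltrDl ltr01 => /(_ erefl) h.
have [|||dF eF] := h.
- apply: integrableS (bumps_integrable ba) => //.
- by rewrite ltNyr.
- by apply: smooth_continuous; case: ba.
by split => //; rewrite -derive1E.
Qed.

Lemma smooth_primitive_bumps a : bumps a -> smooth (primitive a).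
Proof.
move=> ba; apply: (@smooth_primitive _ _ a); last by case: ba.
by move=> x; exact: is_derive_primitive.
Qed.

Lemma primitive_left a (r : R) : (forall x, r <= `|x| -> a x = 0) ->
  forall x, x <= - r -> primitive a x = 0.
Proof.
move=> h x xr; rewrite /primitive.
rewrite (@Rintegral_support _ _ R lebesgue_measure _ set0) ?Rintegral_set0//.
move=> t; rewrite /= in_itv/= => tx _; apply: h.
by have := ler_norm (- t); rewrite normrN; lra.
Qed.

Lemma primitive_right a (r : R) : (forall x, r <= `|x| -> a x = 0) ->
  forall x, r <= x -> primitive a x = \int[lebesgue_measure]_t a t.
Proof.
move=> h x xr; rewrite /primitive; apply/esym/Rintegral_support => //.
move=> t _; rewrite /= in_itv/= => /negP; rewrite -ltNge => tx; apply: h.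
by have := ler_norm t; lra.
Qed.

(** The primitive vanishes to the left of the support and equals the total integral to its right:
    zero mean is what makes it compactly supported again. *)
Lemma primitive_mean0 a : bumps a -> \int[lebesgue_measure]_t a t = 0 ->
  bumps (primitive a).
Proof.
move=> ba a0; split; first exact: smooth_primitive_bumps.
have [_ [r h]] := ba; exists `|r| => x rx.
have := ler_norm r => *.
have [x0|x0] := leP 0 x.
  rewrite (ger0_norm x0) in rx. rewrite (primitive_right h)//; lra.
by rewrite (ltr0_norm x0) in rx; rewrite (primitive_left h)//; lra.
Qed.

Lemma primitive_mean0_thin a : thin_bumps a ->
  \int[lebesgue_measure]_t a t = 0 -> thin_bumps (primitive a).
Proof.
move=> ba a0; split; first exact/smooth_primitive_bumps/thin_bumpsW.
have [_ [r r2 h]] := ba.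
(* A negative radius forces a to vanish identically, and 0 then serves as a radius. *)
have [r0|r0] := leP 0 r; last first.
  exists 0; first by lra.
  move=> x _; have [x0|x0] := leP 0 x.
    by rewrite (primitive_right h)//; lra.
  rewrite (@primitive_left a 0) ?oppr0//; last exact: ltW.
  by move=> t _; apply: h; have := normr_ge0 t; lra.
exists r => // x rx; have [x0|x0] := leP 0 x.
  by rewrite (ger0_norm x0) in rx; rewrite (primitive_right h).
by rewrite (ltr0_norm x0) in rx; rewrite (primitive_left h)//; lra.
Qed.

Lemma derive1_primitive a x : bumps a -> derive1 (primitive a) x = a x.
Proof.
by move=> /(is_derive_primitive x) [_]; rewrite derive1E.
Qed.

Lemma bumps_derive1_mean0 a : bumps a ->
  \int[lebesgue_measure]_t (derive1 a) t = 0.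
Proof.
move=> ba; have [_ [r h]] := bumps_derive1 ba; have [sa [s h']] := ba.
pose M := `|r| + `|s| + 1.
have := ler_norm r; have := ler_norm s; have := normr_ge0 r; have := normr_ge0 s => *.
rewrite (@Rintegral_support _ _ R lebesgue_measure _ `[- M, M]%classic)//; last first.
  move=> x _ nx; apply: h; rewrite leNgt; apply/negP => xr; apply: nx.
  by rewrite /= in_itv/= -ler_norml /M; lra.
rewrite /Rintegral (@continuous_FTC2 _ _ a).
- have aM : a M = 0 by apply: h'; rewrite ger0_norm /M; lra.
  have aNM : a (- M) = 0 by apply: h'; rewrite normrN ger0_norm /M; lra.
  by rewrite aM aNM sube0.
- by rewrite /M; lra.
- by apply: continuous_subspaceT; apply/smooth_continuous/smooth_derive1.
- split.
  + by move=> x _; have [] := smooth_is_derive x sa.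
  + by apply: cvg_at_right_filter; exact: smooth_continuous.
  + by apply: cvg_at_left_filter; exact: smooth_continuous.
- by move=> ? _.
Qed.

End Smooth3.

(** * Weak derivatives *)

Section WeakDerivatives.
Context {R : realType}.
Implicit Types (f g psi : pt3 R -> R) (p v : pt3 R).

Lemma measurable_slab : measurable (@slab R).
Proof.
rewrite (_ : slab = `]- 2^-1, 2^-1[%classic `*` setT).
  by apply: measurableX => //; exact: measurable_itv.
by apply/seteqP; split => p; rewrite /slab/thickness/= in_itv/=; [split|case].
Qed.
Hint Resolve measurable_slab : core.

Lemma compact_pt3_closed (K : set (pt3 R)) : compact K -> closed K.
Proof.
apply: compact_closed.
exact: (@norm_hausdorff R (R * (R * R))%type).
Qed.

Lemma compact_pt3_measurable (K : set (pt3 R)) : compact K -> measurable K.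
Proof.
move=> /compact_pt3_closed /closed_openC oK; rewrite -(setCK K).
by apply: measurableC; apply: open_pt3_measurable.
Qed.

Lemma compact_pt3_sub_cbox (K : set (pt3 R)) : compact K ->
  exists p q, K `<=` cbox p q.
Proof.
move=> /(@compact_bounded R (R * (R * R))%type) [M [_ h]].
pose N := M + 1; have {}h x : K x -> `|x| <= N.
  by move=> Kx; apply: h Kx; rewrite /N ltrDl.
exists (- N, (- N, - N)), (N, (N, N)) => x /h.
rewrite [`|x|]/Num.norm /= /Num.Def.normr/= !ge_max => /andP[h1 /andP[h2 h3]].
by rewrite /cbox/= !in_itv/= -!ler_norml.
Qed.

Lemma compact_pt3_volume (K : set (pt3 R)) : compact K ->
  (volume K < +oo)%E.
Proof.
move=> cK; have [p [q h]] := compact_pt3_sub_cbox cK.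
apply: le_lt_trans (volume_cbox p q); apply: le_measure => //; rewrite inE.
  exact: compact_pt3_measurable.
exact: measurable_cbox.
Qed.

Lemma L2loc_sqr_integrable f K : L2loc f -> compact K -> K `<=` slab ->
  volume.-integrable K (EFin \o (fun p => f p ^+ 2)).
Proof.
move=> [mf h] cK Ks; apply/integrableP; split.
  apply/measurable_EFinP; apply: measurable_funX; apply: measurable_funS mf => //.
under eq_integral => x _.
  rewrite /= ger0_norm ?sqr_ge0//; over.
exact: h.
Qed.

Lemma integrable_cst_compact K (c : R) : compact K ->
  volume.-integrable K (EFin \o cst c).
Proof.
move=> cK; apply/integrableP; split; first by apply/measurable_EFinP; exact: measurable_cst.
rewrite (@integral_cst _ _ _ volume K _ (`|c|)%:E)//; last exact: compact_pt3_measurable.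
apply: lte_mul_pinfty => //.
exact: compact_pt3_volume.
Qed.

(** Compact sets have finite volume, and |f| <= f^2 + 1. *)
Lemma L2loc_integrable f K : L2loc f -> compact K -> K `<=` slab ->
  volume.-integrable K (EFin \o f).
Proof.
move=> Lf cK Ks.
have mK := compact_pt3_measurable cK.
apply: (@le_integrable _ _ _ volume K mK _
  (fun p => (f p ^+ 2)%:E + 1%:E)%E).
- apply/measurable_EFinP; case: Lf => mf _; exact: measurable_funS mf.
- move=> p _ /=; rewrite lee_fin [leRHS]ger0_norm ?addr_ge0 ?sqr_ge0//.
  by rewrite -real_normK ?num_real//; have := sqr_ge0 (`|f p| - 1); nra.
- apply: integrableD => //; first exact: L2loc_sqr_integrable.
  exact: integrable_cst_compact.
Qed.

Lemma sub_L2loc (f h : pt3 R -> R) : measurable_fun slab f ->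
  (forall K, compact K -> K `<=` slab ->
    volume.-integrable K (EFin \o h)) ->
  (forall p, slab p -> f p ^+ 2 <= h p) -> L2loc f.
Proof.
move=> mf hK fh; split => // K cK Ks.
have mK := compact_pt3_measurable cK.
have : volume.-integrable K (EFin \o (fun p => f p ^+ 2)).
  apply: (@le_integrable _ _ _ volume K mK _ (EFin \o h)); last exact: hK.
    apply/measurable_EFinP; apply: measurable_funX.
    exact: measurable_funS mf.
  move=> p Kp /=; rewrite lee_fin ger0_norm ?sqr_ge0//.
  by rewrite (le_trans (fh _ (Ks _ Kp)))// ler_norm.
case/integrableP => _; congr (_ < _)%E; apply: eq_integral => p _ /=.
by rewrite ger0_norm ?sqr_ge0.
Qed.

Lemma L2locZD (s t : R) f g : L2loc f -> L2loc g ->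
  L2loc (fun p => s * f p + t * g p).
Proof.
move=> Lf Lg; have [mf _] := Lf; have [mg _] := Lg.
apply: (@sub_L2loc _ (fun p => 2 * s ^+ 2 * f p ^+ 2 + 2 * t ^+ 2 * g p ^+ 2)).
- by apply: measurable_funD; apply: measurable_funM => //; exact: measurable_cst.
- move=> K cK Ks; have mK := compact_pt3_measurable cK.
  have h1 := integrableZl mK (2 * s ^+ 2) (L2loc_sqr_integrable Lf cK Ks).
  have h2 := integrableZl mK (2 * t ^+ 2) (L2loc_sqr_integrable Lg cK Ks).
  by apply: eq_integrable (integrableD mK h1 h2) => //.
- move=> p _; have := sqr_ge0 (s * f p - t * g p); nra.
Qed.

Lemma L2loc_cst (c : R) : L2loc (fun=> c).
Proof.
split; first exact: measurable_cst.
move=> K cK Ks; have := integrable_cst_compact (c ^+ 2) cK.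
case/integrableP => _; congr (_ < _)%E; apply: eq_integral => p _ /=.
by rewrite ger0_norm ?sqr_ge0.
Qed.

Lemma test_continuous psi : test_function psi -> continuous psi.
Proof. by move=> [/(_ 0%N) /Ck_continuous]. Qed.

Lemma test_derive psi v : test_function psi -> test_function ('D_v psi).
Proof.
move=> [C [K [cK Ks h]]]; split.
  by move=> k; have [_ /(_ v)[]] := C k.+1.
exists K; split => // p nKp.
rewrite (@near_eq_derive _ _ _ psi (cst 0)) ?derive_cst//.
have : nbhs p (~` K).
  apply: open_nbhs_nbhs; split => //.
  by apply: closed_openC; apply: compact_pt3_closed.
by apply: filterS => q /h.
Qed.

Lemma test_bounded psi : test_function psi -> exists M, forall p, `|psi p| <= M.
Proof.
move=> tp; have [_ [K [cK Ks h]]] := tp.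
have : compact (psi @` K).
  apply: continuous_compact => //; apply: continuous_subspaceT.
  exact: test_continuous.
move=> /compact_bounded[M [_ hM]]; exists (Num.max (M + 1) 0) => p.
rewrite le_max; have [Kp|nKp] := pselect (K p).
  by apply/orP; left; apply: (hM (M + 1)); [rewrite ltrDl|exists p].
by apply/orP; right; rewrite h// normr0.
Qed.

Lemma integrable_test f psi : L2loc f -> test_function psi ->
  volume.-integrable slab (EFin \o (fun p => f p * psi p)).
Proof.
move=> Lf tp; have [_ [K [cK Ks h]]] := tp.
have mK := compact_pt3_measurable cK; have [M hM] := test_bounded tp.
apply: (@integrable_support _ _ _ volume slab K) => //.
  by move=> p _ /h ->; rewrite mulr0.
apply: (@le_integrable _ _ _ volume K mK _ (fun p => M%:E * (f p)%:E)%E).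
- apply/measurable_EFinP; apply: measurable_funM.
    by case: Lf => mf _; exact: measurable_funS mf.
  apply: measurable_funTS; apply: continuous_pt3_measurable.
  exact: test_continuous.
- move=> p _ /=; rewrite lee_fin !normrM mulrC ler_wpM2r//.
  by apply: le_trans (hM p) _; exact: ler_norm.
- by apply: integrableZl => //; exact: L2loc_integrable.
Qed.

Lemma measurable_fun_test f psi : measurable_fun slab f -> test_function psi ->
  measurable_fun slab (fun p => f p * psi p).
Proof.
move=> mf tp; apply: measurable_funM => //.
apply: measurable_funTS; apply: continuous_pt3_measurable.
exact: test_continuous.
Qed.

Lemma pairingZD (s t : R) f g psi : L2loc f -> L2loc g -> test_function psi ->
  \int[volume]_(p in slab) ((s * f p + t * g p) * psi p) =
  s * (\int[volume]_(p in slab) (f p * psi p)) +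
  t * (\int[volume]_(p in slab) (g p * psi p)).
Proof.
move=> Lf Lg tp; have If := integrable_test Lf tp; have Ig := integrable_test Lg tp.
rewrite -!RintegralZl// -RintegralD//.
- by apply: eq_Rintegral => p _; ring.
- exact: (integrableZl measurable_slab s If).
- exact: (integrableZl measurable_slab t Ig).
Qed.

Lemma pairing_ae f g psi : measurable_fun slab f -> measurable_fun slab g ->
  {ae volume, forall p, slab p -> f p = g p} -> test_function psi ->
  \int[volume]_(p in slab) (f p * psi p) =
  \int[volume]_(p in slab) (g p * psi p).
Proof.
move=> mf mg fg tp; apply: ae_eq_Rintegral => //.
- exact: measurable_fun_test.
- exact: measurable_fun_test.
- by apply: filterS fg => p h sp; rewrite h.
Qed.

(** The data that dominated convergence requires of one factor of a product; the radius r is common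
    to all n. The instances are [plateau] for open intervals and [window] for intervals closed on
    the right. *)
Definition box_approx (r : R) (A : nat -> R -> R) (E : set R) : Prop :=
  [/\ forall n, measurable_fun setT (A n),
      forall n x, `|A n x| <= 1,
      forall n x, r <= `|x| -> A n x = 0 &
      forall x, A n x @[n --> \oo] --> (\1_E x : R)].

Lemma box_approx_sub r A (E : set R) x : box_approx r A E -> E x -> `|x| <= r.
Proof.
move=> [_ _ h c] Ex; rewrite leNgt; apply/negP => rx.
have := c x; under eq_fun do rewrite (h _ _ (ltW rx)).
move=> /(cvg_unique (@norm_hausdorff _ _) (cvg_cst _)) /eqP.
by rewrite indicE mem_set//= eq_sym oner_eq0.
Qed.

(** Dominated convergence on a compact box that contains all supports, with |g| as the bound; r <
    1/2 keeps this box inside the slab. *)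
Lemma box_limit g (r s t : R) (A B C : nat -> R -> R) (E1 E2 E3 : set R) :
  L2loc g -> r < 2^-1 ->
  box_approx r A E1 -> box_approx s B E2 -> box_approx t C E3 ->
  measurable (E1 : set (measurableTypeR R)) ->
  measurable (E2 : set (measurableTypeR R)) ->
  measurable (E3 : set (measurableTypeR R)) ->
  (forall n, \int[volume]_(p in slab) (g p * tens (A n) (B n) (C n) p) = 0) ->
  \int[volume]_(p in E1 `*` (E2 `*` E3)) g p = 0.
Proof.
move=> Lg r2 hA hB hC mE1 mE2 mE3 h0.
have [mA A1 A0 cA] := hA; have [mB B1 B0 cB] := hB; have [mC C1 C0 cC] := hC.
pose D := cbox (- r, (- s, - t)) (r, (s, t)).
have mD : measurable D by exact: measurable_cbox.
have Ds : D `<=` slab by apply: inner_box_slab => //=; rewrite ltrNl opprK.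
have cD : compact D by exact: compact_cbox.
pose E := E1 `*` (E2 `*` E3).
have mE : measurable E by do !apply: measurableX.
have ED : E `<=` D.
  move=> p [/= h1 [h2 h3]]; rewrite /D/cbox/= !in_itv/= -!ler_norml.
  by split; [exact: box_approx_sub hA h1|split;
    [exact: box_approx_sub hB h2|exact: box_approx_sub hC h3]].
have mg : measurable_fun D g by case: Lg => mg _; exact: measurable_funS mg.
have mt n : measurable_fun setT (tens (A n) (B n) (C n)).
  apply: measurable_funM; first apply: measurable_funM.
  - exact: (measurableT_comp (mA n) measurable_fst).
  - apply: (measurableT_comp (mB n)).
    exact: (measurableT_comp measurable_fst measurable_snd).
  - apply: (measurableT_comp (mC n)).
    exact: (measurableT_comp measurable_snd measurable_snd).
have tensE p : \1_E p = \1_E1 p.1 * \1_E2 p.2.1 * \1_E3 p.2.2 :> R.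
  by rewrite !indicE /E !in_setX; do !case: (_ \in _); rewrite /= ?mulr0 ?mulr1.
have [|||||_ hc] := @dominated_Rintegral_cvg _ _ R volume D
    (fun n p => g p * tens (A n) (B n) (C n) p) (fun p => g p * \1_E p)
    (fun p => `|g p|) mD.
- by move=> n; apply: measurable_funM => //; exact: measurable_funTS.
- by apply: measurable_funM => //; exact: measurable_indic.
- move=> p _; apply: cvgM; first exact: cvg_cst.
  by rewrite tensE; apply: cvgM; [apply: cvgM|].
- exact: (integrable_norm (L2loc_integrable Lg cD Ds)).
- move=> n p _; rewrite normrM ler_piMr// /tens !normrM.
  by rewrite mulr_ile1// ?mulr_ge0// mulr_ile1.
have z n : \int[volume]_(p in D) (g p * tens (A n) (B n) (C n) p) = 0.
  rewrite -(h0 n); apply/esym; apply: Rintegral_support => // p _ nD.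
  rewrite /tens.
  have [k1|/ltW/A0->] := leP `|p.1| r; last by rewrite !mul0r mulr0.
  have [k2|/ltW/B0->] := leP `|p.2.1| s; last by rewrite mulr0 mul0r mulr0.
  have [k3|/ltW/C0->] := leP `|p.2.2| t; last by rewrite !mulr0.
  by exfalso; apply: nD; rewrite /D/cbox/= !in_itv/= -!ler_norml.
have {}hc : \int[volume]_(p in D) (g p * \1_E p) = 0.
  apply: (cvg_unique (@norm_hausdorff _ _) hc).
  rewrite (_ : (fun n => _) = cst 0); first exact: cvg_cst.
  by apply/funext => n; rewrite -[RHS](z n).
rewrite -hc; apply/esym.
rewrite (@Rintegral_support _ _ R volume D E)//.
  by apply: eq_Rintegral => p; rewrite inE => Ep; rewrite indicE mem_set ?mulr1.
by move=> p _ nE; rewrite indicE memNset ?mulr0.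
Qed.

Lemma box_approx_plateau (p q : R) :
  box_approx (Num.max `|p| `|q|) (plateau p q) `]p, q[%classic.
Proof.
split.
- move=> n; apply: continuous_measurable_fun; apply: smooth_continuous.
  exact: smooth_plateau.
- by move=> n x; rewrite ger0_norm ?plateau_le1 ?plateau_ge0.
- move=> n x; rewrite ge_max => /andP[px qx].
  apply: plateau_eq0; apply/negP => /andP[h1 h2].
  have := ler_norm q; have := ler_norm (- p); rewrite normrN.
  by case: (ler0P x) px qx => ? *; lra.
- exact: cvg_plateau.
Qed.

Lemma ae0_of_obox_integrals g : L2loc g ->
  (forall p q, - 2^-1 < p.1 -> q.1 < 2^-1 -> p.1 < q.1 -> p.2.1 < q.2.1 ->
    p.2.2 < q.2.2 -> \int[volume]_(x in obox p q) g x = 0) ->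
  {ae volume, forall p, slab p -> g p = 0}.
Proof.
move=> Lg h.
suff H n : {ae volume, forall p, inner_box n p -> g p = 0}.
  have : {ae volume, forall p, forall n, inner_box n p -> g p = 0}.
    exact: ae_foralln.
  by apply: filterS => p hp /inner_box_cover [n /hp].
have n0 : (0 : R) < n.+2%:R^-1 by rewrite invr_gt0.
have n2 : n.+2%:R^-1 <= 2^-1 :> R by rewrite lef_pV2 ?posrE// ler_nat.
rewrite /inner_box; move: (n.+2%:R^-1) n0 n2 => e n0 n2.
have sub : cbox (- (2^-1 - e), (- n%:R, - n%:R))
   (2^-1 - e, (n%:R, n%:R)) `<=` @slab R.
  by apply: inner_box_slab => /=; lra.
apply: ae0_of_boxes.
  have := L2loc_integrable Lg (@compact_cbox R _ _) sub.
  apply: integrableS; [exact: measurable_cbox|exact: measurable_obox|].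
  exact: obox_sub_cbox.
move=> p q pq.
have [pq1|pq1] := leP q.1 p.1.
  rewrite (_ : obox p q = set0) ?Rintegral_set0//.
  by apply/seteqP; split => // x /oboxP[]; lra.
have [pq2|pq2] := leP q.2.1 p.2.1.
  rewrite (_ : obox p q = set0) ?Rintegral_set0//.
  by apply/seteqP; split => // x /oboxP[]; lra.
have [pq3|pq3] := leP q.2.2 p.2.2.
  rewrite (_ : obox p q = set0) ?Rintegral_set0//.
  by apply/seteqP; split => // x /oboxP[]; lra.
(* Completing x by the midpoints of the other two sides gives a point of the box, so the inclusion
   of boxes restricts to their x3-sides. *)
have hin (x : R) : p.1 < x < q.1 ->
    - (2^-1 - e) < x < 2^-1 - e.
  move=> hx; have /pq /oboxP[] //: obox p q (x, ((p.2.1 + q.2.1) / 2, (p.2.2 + q.2.2) / 2)).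
  by apply/oboxP; split => //=; lra.
have hp : - (2^-1 - e) <= p.1.
  rewrite leNgt; apply/negP => lt.
  pose m := Num.min q.1 (- (2^-1 - e)).
  have pm : p.1 < m by rewrite lt_min pq1 lt.
  have mq : m <= q.1 by rewrite ge_min lexx.
  have mn : m <= - (2^-1 - e) by rewrite ge_min lexx orbT.
  have : p.1 < (p.1 + m) / 2 < q.1 by lra.
  by move=> /hin; lra.
have hq : q.1 <= 2^-1 - e.
  rewrite leNgt; apply/negP => lt.
  pose m := Num.max p.1 (2^-1 - e).
  have pm : m < q.1 by rewrite gt_max pq1 lt.
  have mq : p.1 <= m by rewrite le_max lexx.
  have mn : 2^-1 - e <= m by rewrite le_max lexx orbT.
  have : p.1 < (q.1 + m) / 2 < q.1 by lra.
  by move=> /hin; lra.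
by apply: h => //; lra.
Qed.

(** The fundamental lemma of the calculus of variations for product test functions: products of
    plateaus tend to indicators of boxes. *)
Lemma ae0_of_tests g : L2loc g ->
  (forall a b c, thin_bumps a -> bumps b -> bumps c ->
    \int[volume]_(p in slab) (g p * tens a b c p) = 0) ->
  {ae volume, forall p, slab p -> g p = 0}.
Proof.
move=> Lg h; apply: ae0_of_obox_integrals => // p q hp hq pq1 pq2 pq3.
apply: (@box_limit g (Num.max `|p.1| `|q.1|) (Num.max `|p.2.1| `|q.2.1|)
  (Num.max `|p.2.2| `|q.2.2|) (plateau p.1 q.1) (plateau p.2.1 q.2.1) (plateau p.2.2 q.2.2)) => //.
- by rewrite gt_max !ltr_norml; apply/andP; split; lra.
- exact: box_approx_plateau.
- exact: box_approx_plateau.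
- exact: box_approx_plateau.
- by move=> k; apply: h; [exact: thin_bumps_plateau|exact: bumps_plateau..].
Qed.

Lemma weak_partial_unique v f g g' : weak_partial v f g -> weak_partial v f g' ->
  {ae volume, forall p, slab p -> g p = g' p}.
Proof.
move=> [Lg h] [Lg' h'].
have : {ae volume, forall p, slab p -> 1 * g p + -1 * g' p = 0}.
  apply: ae0_of_tests; first exact: L2locZD.
  move=> a b c ta bb bc; have tp := test_tens ta bb bc.
  rewrite pairingZD// mul1r mulN1r; have := h _ tp; rewrite h'// => /oppr_inj ->.
  by rewrite subrr.
by apply: filterS => p hp /hp /eqP; rewrite mul1r mulN1r subr_eq0 => /eqP.
Qed.

Lemma weak_partialZD (s t : R) v f f' g g' : L2loc f -> L2loc f' ->
  weak_partial v f g -> weak_partial v f' g' ->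
  weak_partial v (fun p => s * f p + t * f' p) (fun p => s * g p + t * g' p).
Proof.
move=> Lf Lf' [Lg h] [Lg' h']; split; first exact: L2locZD.
move=> psi tp; rewrite !pairingZD//; last exact: test_derive.
by rewrite h// h'//; ring.
Qed.

Lemma partialP v f : (exists g, weak_partial v f g) ->
  weak_partial v f (partial v f).
Proof. by move=> h; exact: (xgetPex (fun=> 0) h). Qed.

End WeakDerivatives.
#[export] Hint Resolve measurable_slab : core.

(** * Invariance of weak derivatives *)

Section SlabIsometries.
Context {R : realType}.
Implicit Types (f g psi : pt3 R -> R) (p v : pt3 R) (T L : pt3 R -> pt3 R).

(** L and L' are the linear parts of T and T'. The inverse is carried along because functions are
    composed with T while test functions move by T'. *)
Record slab_iso T T' L L' : Prop := SlabIso {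
  iso_cancel : cancel T T';
  iso_cancel' : cancel T' T;
  iso_preserving : preserving volume T;
  iso_continuous : continuous T;
  iso_continuous' : continuous T';
  iso_affine : forall (h : R) v p, T (h *: v + p) = h *: L v + T p;
  iso_affine' : forall (h : R) v p, T' (h *: v + p) = h *: L' v + T' p;
  iso_slab : forall p, slab (T p) <-> slab p }.

Lemma iso_preimage_slab T T' L L' : slab_iso T T' L L' -> T @^-1` slab = slab.
Proof. by move=> i; apply/seteqP; split => p /=; rewrite (iso_slab i). Qed.

Lemma iso_compact T T' L L' (K : set (pt3 R)) : slab_iso T T' L L' ->
  compact K -> K `<=` slab -> compact (T' @^-1` K) /\ T' @^-1` K `<=` slab.
Proof.
move=> i cK Ks; have -> : T' @^-1` K = T @` K.
  apply/seteqP; split => [p Kp|_ [p Kp <-]]; last by rewrite /= (iso_cancel i).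
  by exists (T' p) => //; exact: (iso_cancel' i).
split.
  apply: continuous_compact => //; apply: continuous_subspaceT.
  exact: (iso_continuous i).
by move=> _ [p /Ks sp <-]; apply/(iso_slab i).
Qed.

Lemma measurable_fun_iso T T' L L' d (Y : measurableType d) (f : pt3 R -> Y) :
  slab_iso T T' L L' ->
  measurable_fun slab f -> measurable_fun slab (f \o T).
Proof.
move=> i mf; rewrite -(iso_preimage_slab i).
exact: (preserving_measurable_fun (iso_preserving i)).
Qed.

Lemma L2loc_iso T T' L L' f : slab_iso T T' L L' -> L2loc f -> L2loc (f \o T).
Proof.
move=> i [mf hf]; split; first exact: (measurable_fun_iso i).
move=> K cK Ks; have [cK' Ks'] := iso_compact i cK Ks.
have mK' := compact_pt3_measurable cK'.
have := hf _ cK' Ks'; rewrite (preserving_ge0_integral (iso_preserving i) mK').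
- rewrite (_ : T @^-1` _ = K)//; apply/seteqP.
  by split => p /=; rewrite (iso_cancel i).
- apply/measurable_EFinP; apply: measurable_funX.
  exact: measurable_funS mf.
- by move=> p _; rewrite lee_fin sqr_ge0.
Qed.

Lemma test_iso T T' L L' psi : slab_iso T T' L L' -> test_function psi ->
  test_function (psi \o T').
Proof.
move=> i [C [K [cK Ks h]]]; split.
  by move=> k; exact: (Ck_affine (iso_continuous' i) (iso_affine' i)).
have [cK' Ks'] := iso_compact i cK Ks.
by exists (T' @^-1` K); split => // p /= /h.
Qed.

Lemma ae_slab_iso T T' L L' (P : pt3 R -> Prop) : slab_iso T T' L L' ->
  {ae volume, forall p, slab p -> P p} ->
  {ae volume, forall p, slab p -> P (T p)}.
Proof.
move=> i /(preserving_ae (iso_preserving i)).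
by apply: filterS => p h /(iso_slab i).
Qed.

Lemma Rintegral_slab_iso T T' L L' f : slab_iso T T' L L' ->
  measurable_fun slab f ->
  \int[volume]_(p in slab) f p = \int[volume]_(p in slab) f (T p).
Proof.
move=> i mf; rewrite (preserving_Rintegral (iso_preserving i))//.
by rewrite (iso_preimage_slab i).
Qed.

(** Changing variables moves T from f to the test function. As v is an eigenvector of L for s,
    differentiating along v commutes with T up to the factor s. *)
Lemma weak_partial_iso T T' L L' v (s : R) f g : slab_iso T T' L L' ->
  (s = 1 \/ s = -1) -> L v = s *: v -> L2loc f ->
  weak_partial v f g -> weak_partial v (f \o T) (fun p => s * g (T p)).
Proof.
move=> i s1 Lv Lf [Lg h]; split.
  have := L2locZD s 0 (L2loc_iso i Lg) (L2loc_iso i Lg); congr L2loc.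
  by apply/funext => p /=; rewrite mul0r addr0.
move=> psi tp; have tchi := test_iso i tp.
set chi := psi \o T' in tchi.
have psiE p : psi p = chi (T p) by rewrite /chi/= (iso_cancel i).
have dchi p w : derivable chi p w.
  by have [/(_ 1%N)[_ /(_ w)[]]] := tchi.
have dpsi p : 'D_v psi p = s * 'D_v chi (T p).
  rewrite (_ : psi = chi \o T); last by apply/funext.
  rewrite (derive_affine (iso_affine i))// Lv.
  case: s1 => ->; first by rewrite scale1r mul1r.
  rewrite scaleN1r mulN1r.
  by have [_ ->] := is_derive_oppdir (dchi (T p) v).
under eq_Rintegral do rewrite dpsi /= mulrCA.
under [in RHS]eq_Rintegral do rewrite psiE -mulrA.
rewrite -(@Rintegral_slab_iso _ _ _ _ (fun p => s * (f p * 'D_v chi p)) i); last first.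
  apply: measurable_funM; first exact: measurable_cst.
  by apply: measurable_fun_test; [case: Lf|exact: test_derive].
rewrite -(@Rintegral_slab_iso _ _ _ _ (fun p => s * (g p * chi p)) i); last first.
  apply: measurable_funM; first exact: measurable_cst.
  by apply: measurable_fun_test; [case: Lg|].
rewrite !RintegralZl//; [|exact: integrable_test|].
  by rewrite h// mulrN.
by apply: integrable_test => //; exact: test_derive.
Qed.

(** Changing variables by T turns psi \o T' into psi and leaves the invariant f alone, so f cannot
    distinguish a test function from its image. *)
Lemma pairing_iso T T' L L' f psi : slab_iso T T' L L' -> L2loc f ->
  {ae volume, forall p, slab p -> f (T p) = f p} -> test_function psi ->
  \int[volume]_(p in slab) (f p * psi (T' p)) =
  \int[volume]_(p in slab) (f p * psi p).
Proof.
move=> i Lf fT tp; have tchi := test_iso i tp; have [mf _] := Lf.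
rewrite (@Rintegral_slab_iso _ _ _ _ (fun p => f p * psi (T' p)) i); last first.
  exact: (measurable_fun_test mf tchi).
under eq_Rintegral do rewrite (iso_cancel i).
exact: (@pairing_ae R (f \o T) f psi (measurable_fun_iso i mf) mf fT tp).
Qed.

Lemma continuous_pair (U V : topologicalType) (f : pt3 R -> U) (g : pt3 R -> V) :
  continuous f -> continuous g -> continuous (fun p => (f p, g p)).
Proof. by move=> cf cg p; apply: cvg_pair; [exact: cf|exact: cg]. Qed.

Lemma continuous_y1 : continuous (fun p : pt3 R => p.2.1).
Proof.
move=> p; apply: (continuous_comp (f := snd) (g := fst)); first exact: cvg_snd.
exact: cvg_fst.
Qed.

Lemma continuous_y2 : continuous (fun p : pt3 R => p.2.2).
Proof.
move=> p; apply: (continuous_comp (f := snd) (g := snd)); exact: cvg_snd.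
Qed.

Lemma iso_yshift t1 t2 :
  slab_iso (yshift t1 t2) (yshift (- t1) (- t2)) id id.
Proof.
have cs s1 s2 : continuous (@yshift R s1 s2).
  apply: continuous_pair; first by move=> p; exact: cvg_fst.
  by apply: continuous_pair => p; apply: cvgD; [exact: continuous_y1|exact: cvg_cst
    |exact: continuous_y2|exact: cvg_cst].
have aff s1 s2 h (v p : pt3 R) : yshift s1 s2 (h *: v + p) = h *: v + yshift s1 s2 p.
  by congr (_, (_, _)); rewrite /= addrA.
split.
- by move=> -[a [b c]]; congr (_, (_, _)); rewrite /= addrK.
- by move=> -[a [b c]]; congr (_, (_, _)); rewrite /= subrK.
- exact: preserving_volume_yshift.
- exact: cs.
- exact: cs.
- exact: aff.
- exact: aff.
- by [].
Qed.

Lemma iso_flip3 : slab_iso flip3 flip3 flip3 flip3.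
Proof.
have c : continuous (@flip3 R).
  apply: continuous_pair => p; last exact: cvg_snd.
  by apply: cvgN; exact: cvg_fst.
have a h (v p : pt3 R) : flip3 (h *: v + p) = h *: flip3 v + flip3 p.
  by congr (_, _); rewrite /= opprD scalerN.
have k : cancel (@flip3 R) flip3.
  by move=> -[x [y z]]; rewrite /flip3/= opprK.
split; [exact: k|exact: k|exact: preserving_volume_flip3|exact: c|exact: c|
  exact: a|exact: a|].
by move=> p; rewrite /slab/thickness/flip3/=; split; lra.
Qed.

Lemma iso_flip2 : slab_iso flip2 flip2 flip2 flip2.
Proof.
have c : continuous (@flip2 R).
  apply: continuous_pair; first by move=> p; exact: cvg_fst.
  apply: continuous_pair; first exact: continuous_y1.
  by move=> p; apply: cvgN; exact: continuous_y2.
have a h (v p : pt3 R) : flip2 (h *: v + p) = h *: flip2 v + flip2 p.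
  by congr (_, (_, _)); rewrite /= opprD scalerN.
have k : cancel (@flip2 R) flip2.
  by move=> -[x [y z]]; rewrite /flip2/= opprK.
by split; [exact: k|exact: k|exact: preserving_volume_flip2|exact: c|exact: c|
  exact: a|exact: a|].
Qed.

End SlabIsometries.

(** * Functions with vanishing weak gradient *)

Section Constancy.
Context {R : realType}.
Notation leb := (@lebesgue_measure R).
Implicit Types (f g : pt3 R -> R) (p v : pt3 R).

Lemma cvg_Rintegral_plateau (p q : R) : p < q ->
  \int[leb]_x plateau p q n x @[n --> \oo] --> q - p.
Proof.
move=> pq.
have mp n : measurable_fun (setT : set (measurableTypeR R)) (plateau p q n).
  apply: continuous_measurable_fun; apply: smooth_continuous.
  exact: smooth_plateau.
have [||||||_ +] := @dominated_Rintegral_cvg _ _ R leb `]p, q[%classic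
    (fun n => plateau p q n) (cst 1) (cst 1).
- exact: measurable_itv.
- by move=> n; exact: measurable_funTS.
- exact: measurable_cst.
- move=> x xpq; have := @cvg_plateau R p q x.
  by rewrite indicE mem_set.
- apply/integrableP; split; first by apply/measurable_EFinP; exact: measurable_cst.
  rewrite /= normr1 integral_cst//= lebesgue_measure_itv/= lte_fin pq mul1e.
  by rewrite -EFinB ltry.
- by move=> n x _; rewrite ger0_norm ?plateau_ge0 ?plateau_le1.
rewrite Rintegral_cst// mul1r /= lebesgue_measure_itv/= lte_fin pq/=.
move=> h; apply: cvg_trans h; rewrite (_ : (fun n => _) = (fun n =>
  \int[leb]_(x in `]p, q[%classic) plateau p q n x)) //.
apply/funext => n; apply: Rintegral_support => // x _ nx.
by apply: plateau_eq0; apply/negP => h; apply: nx; rewrite /= in_itv.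
Qed.

Lemma plateau_mean_gt0 (p q : R) : p < q ->
  exists n, 0 < \int[leb]_x plateau p q n x.
Proof.
move=> pq; have := cvg_Rintegral_plateau pq.
have qp : 0 < q - p by rewrite subr_gt0.
move/cvgr_gt => /(_ _ qp) [n _ h].
by exists n; apply: h => /=.
Qed.

Lemma thin_bump_mean1 : exists a : R -> R, thin_bumps a /\ \int[leb]_x a x = 1.
Proof.
have [|n] := @plateau_mean_gt0 (- 4^-1) 4^-1; first by lra.
set I := Rintegral _ _ _ => I0.
have tp : thin_bumps (plateau (- 4^-1) 4^-1 n : R -> R).
  by apply: thin_bumps_plateau; lra.
(* The summand with coefficient 0 only gives the multiple the shape of [thin_bumpsZD]. *)
exists (fun x => I^-1 * plateau (- 4^-1) 4^-1 n x + 0 * plateau (- 4^-1) 4^-1 n x).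
split; first exact: thin_bumpsZD.
under eq_Rintegral do rewrite mul0r addr0.
rewrite RintegralZl//; last exact/bumps_integrable/thin_bumpsW.
by rewrite mulVf// gt_eqF.
Qed.

Lemma tens_slab_support (a b c : R -> R) p : thin_bumps a -> ~ slab p ->
  tens a b c p = 0.
Proof.
move=> [_ [r r2 h]] np; rewrite /tens h ?mul0r// leNgt; apply/negP => hr.
by apply: np; rewrite /slab/thickness/= -ltr_norml (lt_trans hr).
Qed.

Lemma Rintegral_tens (a b c : R -> R) : thin_bumps a -> bumps b -> bumps c ->
  \int[volume]_(p in slab) tens a b c p =
  \int[leb]_x a x * \int[leb]_x b x * \int[leb]_x c x.
Proof.
move=> ta bb bc.
have ia := bumps_integrable (thin_bumpsW ta).
have ib := bumps_integrable bb; have ic := bumps_integrable bc.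
rewrite -(@Rintegral_support _ _ R volume setT)//; last first.
  by move=> p _; exact: tens_slab_support.
have ibc := integrable_prod_tensor ib ic.
have := @Rintegral_prod_tensor _ _ _ _ R (@lebesgue_measure R) (@area R)
  a (fun y => b y.1 * c y.2) ia ibc.
rewrite (Rintegral_prod_tensor ib ic) mulrA => <-.
by apply: eq_Rintegral => p _; rewrite /tens mulrA.
Qed.

Lemma pairing_linear g (F1 F2 F : pt3 R -> R) (s t : R) : L2loc g ->
  test_function F1 -> test_function F2 ->
  (forall p, F p = s * F1 p + t * F2 p) ->
  \int[volume]_(p in slab) (g p * F p) =
  s * \int[volume]_(p in slab) (g p * F1 p) +
  t * \int[volume]_(p in slab) (g p * F2 p).
Proof.
move=> Lg t1 t2 FE.
have I1 := integrable_test Lg t1; have I2 := integrable_test Lg t2.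
rewrite -!RintegralZl// -RintegralD//.
- by apply: eq_Rintegral => p _; rewrite FE; ring.
- exact: (integrableZl measurable_slab s I1).
- exact: (integrableZl measurable_slab t I2).
Qed.

(** In each variable a bump is its mean times the normalised bump a0 plus the derivative of a bump,
    and g annihilates the derivative. The pairing of g thus depends only on the product of the three
    means, as for a constant. *)
Lemma constant_of_flat g : L2loc g ->
  (forall a b c, thin_bumps a -> bumps b -> bumps c ->
    [/\ \int[volume]_(p in slab) (g p * tens (derive1 a) b c p) = 0,
        \int[volume]_(p in slab) (g p * tens a (derive1 b) c p) = 0 &
        \int[volume]_(p in slab) (g p * tens a b (derive1 c) p) = 0]) ->
  exists k : R, {ae volume, forall p, slab p -> g p = k}.
Proof.
move=> Lg flat.
have [a0 [ta0 m0]] := thin_bump_mean1; have ba0 := thin_bumpsW ta0.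
pose I a b c := \int[volume]_(p in slab) (g p * tens a b c p).
pose m (a : R -> R) := \int[leb]_x a x.
have mZD s t a b : bumps a -> bumps b -> m (fun x => s * a x + t * b x) = s * m a + t * m b.
  move=> ba bb; have ia := bumps_integrable ba; have ib := bumps_integrable bb.
  rewrite /m -!RintegralZl// -RintegralD//.
  - exact: (integrableZl measurableT s ia).
  - exact: (integrableZl measurableT t ib).
(* The mean-zero remainder of a, whose primitive is again a bump. *)
pose res a x := 1 * a x + (- m a) * a0 x.
have mres a : bumps a -> m (res a) = 0.
  by move=> ba; rewrite mZD// {3}/m m0; ring.
have dres a : bumps a -> derive1 (primitive (res a)) = res a.
  by move=> ba; apply/funext => x; apply: derive1_primitive; exact: bumpsZD.
have Ia a b c : thin_bumps a -> bumps b -> bumps c -> I a b c = m a * I a0 b c.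
  move=> ta bb bc; have tr : thin_bumps (res a) by exact: thin_bumpsZD.
  have ba := thin_bumpsW ta; have br := thin_bumpsW tr.
  have [] := flat (primitive (res a)) b c => //.
    by apply: primitive_mean0_thin => //; exact: mres.
  rewrite dres// => + _ _.
  rewrite (@pairing_linear g (tens a b c) (tens a0 b c) _ 1 (- m a)) //;
    [|exact: test_tens|exact: test_tens|by move=> p; rewrite /tens /res; ring].
  by rewrite -/(I _ _ _) -/(I _ _ _) mul1r mulNr => /eqP; rewrite subr_eq0 => /eqP.
have Ib a b c : thin_bumps a -> bumps b -> bumps c -> I a b c = m b * I a a0 c.
  move=> ta bb bc; have br : bumps (res b) by exact: bumpsZD.
  have [] := flat a (primitive (res b)) c => //.
    by apply: primitive_mean0 => //; exact: mres.
  rewrite dres// => _ + _.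
  rewrite (@pairing_linear g (tens a b c) (tens a a0 c) _ 1 (- m b)) //;
    [|exact: test_tens|exact: test_tens|by move=> p; rewrite /tens /res; ring].
  by rewrite -/(I _ _ _) -/(I _ _ _) mul1r mulNr => /eqP; rewrite subr_eq0 => /eqP.
have Ic a b c : thin_bumps a -> bumps b -> bumps c -> I a b c = m c * I a b a0.
  move=> ta bb bc; have br : bumps (res c) by exact: bumpsZD.
  have [] := flat a b (primitive (res c)) => //.
    by apply: primitive_mean0 => //; exact: mres.
  rewrite dres// => _ _.
  rewrite (@pairing_linear g (tens a b c) (tens a b a0) _ 1 (- m c)) //;
    [|exact: test_tens|exact: test_tens|by move=> p; rewrite /tens /res; ring].
  by rewrite -/(I _ _ _) -/(I _ _ _) mul1r mulNr => /eqP; rewrite subr_eq0 => /eqP.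
(* All means of a0 being 1, testing with a0 in each variable reads off the constant. *)
pose k := I a0 a0 a0; exists k.
have Lk := L2loc_cst k.
have : {ae volume, forall p, slab p -> 1 * g p + -1 * k = 0}.
  apply: ae0_of_tests; first exact: (L2locZD 1 (-1) Lg Lk).
  move=> a b c ta bb bc; have tp := test_tens ta bb bc.
  rewrite (@pairingZD _ 1 (-1) g (fun=> k))// -/(I _ _ _) Ia// Ib// Ic// -/k.
  rewrite RintegralZl//; last first.
    have := integrable_test (L2loc_cst 1) tp.
    by apply: eq_integrable => // p _ /=; rewrite mul1r.
  by rewrite Rintegral_tens// -!/(m _); ring.
by apply: filterS => p hp /hp /eqP; rewrite mul1r mulN1r subr_eq0 => /eqP.
Qed.

End Constancy.

(** * Coordinate planes as null sets *)

Section NullCoordinates.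
Context {R : realType}.
Notation leb := (@lebesgue_measure R).

Lemma ae_lebesgue_neq (c : R) : {ae leb, forall x, x != c}.
Proof.
exists [set c]; split; first exact: measurable_set1.
  by rewrite lebesgue_measure_set1.
by move=> x /negP; rewrite negbK => /eqP.
Qed.

Lemma ae_area_fst (P : R -> Prop) : {ae leb, forall x, P x} ->
  {ae (@area R), forall y, P y.1}.
Proof.
move=> [N [mN N0 PN]]; exists (N `*` setT); split.
- exact: measurableX.
- by rewrite /area product_measure1E//= [lebesgue_measure N]N0 mul0e.
- by move=> y /= /PN.
Qed.

Lemma ae_area_snd (P : R -> Prop) : {ae leb, forall x, P x} ->
  {ae (@area R), forall y, P y.2}.
Proof.
move=> [N [mN N0 PN]]; exists (setT `*` N); split.
- exact: measurableX.
- by rewrite /area product_measure1E//= [lebesgue_measure N]N0 mule0.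
- by move=> y /= /PN.
Qed.

Lemma ae_volume_y (P : R * R -> Prop) : {ae (@area R), forall y, P y} ->
  {ae (@volume R), forall p, P p.2}.
Proof.
move=> [N [mN N0 PN]]; exists (setT `*` N); split.
- exact: measurableX.
- by rewrite /volume product_measure1E//= [area N]N0 mule0.
- by move=> y /= /PN.
Qed.

Lemma ae_volume_y1_neq (c : R) : {ae (@volume R), forall p, p.2.1 != c}.
Proof. exact: (ae_volume_y (ae_area_fst (ae_lebesgue_neq c))). Qed.

Lemma ae_volume_y2_neq (c : R) : {ae (@volume R), forall p, p.2.2 != c}.
Proof. exact: (ae_volume_y (ae_area_snd (ae_lebesgue_neq c))). Qed.

Lemma integral_ae_set (f : pt3 R -> \bar R) (D E : set (pt3 R)) :
  measurable D -> measurable E -> measurable_fun D f -> measurable_fun E f ->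
  {ae volume, forall p, D p <-> E p} ->
  (\int[volume]_(p in D) f p = \int[volume]_(p in E) f p)%E.
Proof.
move=> mD mE mfD mfE DE; rewrite integral_mkcond [RHS]integral_mkcond.
apply: ae_eq_integral => //.
- by apply/(measurable_restrictT _ mD).
- by apply/(measurable_restrictT _ mE).
- apply: filterS DE => p DEp _; rewrite !patchE.
  by congr (if _ then _ else _); apply/idP/idP; rewrite !inE => /DEp.
Qed.

Lemma Rintegral_ae_set (f : pt3 R -> R) (D E : set (pt3 R)) :
  measurable D -> measurable E -> measurable_fun D f -> measurable_fun E f ->
  {ae volume, forall p, D p <-> E p} ->
  \int[volume]_(p in D) f p = \int[volume]_(p in E) f p.
Proof.
move=> mD mE mfD mfE DE; congr fine.
by apply: integral_ae_set => //; exact/measurable_EFinP.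
Qed.

End NullCoordinates.

(** * Smooth steps and windows *)

Section Steps.
Context {R : realType}.
Notation leb := (@lebesgue_measure R).
Implicit Types (f g : pt3 R -> R).

Definition smooth_step (F : R -> R) : Prop :=
  [/\ smooth F, forall x, 0 <= F x <= 1, forall x, x <= 0 -> F x = 0 &
      forall x, 1 <= x -> F x = 1].

(** The normalised primitive of a plateau over ]0, 1[. *)
Lemma smooth_step_exists : exists F, smooth_step F.
Proof.
have [n] := @plateau_mean_gt0 R 0 1 ltr01.
set a := plateau 0 1 n; set I := Rintegral _ _ _ => I0.
have ba : bumps a by exact: bumps_plateau.
have ia := bumps_integrable ba.
have left0 x : x <= 0 -> primitive a x = 0.
  move=> x0; rewrite /primitive.
  rewrite (@Rintegral_support _ _ R leb _ set0) ?Rintegral_set0// => t.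
  by rewrite /= in_itv/= => tx _; apply: plateau_eq0; apply/negP; lra.
have right1 x : 1 <= x -> primitive a x = I.
  move=> x1; apply/esym/Rintegral_support => // t _.
  rewrite /= in_itv/= => /negP; rewrite -ltNge => tx.
  by apply: plateau_eq0; apply/negP; lra.
have ge0 x : 0 <= primitive a x.
  by apply: Rintegral_ge0 => t _; exact: plateau_ge0.
have le1 x : primitive a x <= I.
  rewrite /primitive Rintegral_mkcond; apply: le_Rintegral => //.
    rewrite -restrict_EFin.
    have mx : measurable (`]-oo, x]%classic : set (measurableTypeR R)) by exact: measurable_itv.
    apply: (iffLR (integrable_mkcond _ mx)).
 exact: (integrableS measurableT mx (@subsetT _ _) ia).
  by move=> t _; rewrite patchE; case: ifP => // _; exact: plateau_ge0.
exists (fun x => I^-1 * primitive a x); split.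
- by apply: smoothZ; exact: smooth_primitive_bumps.
- move=> x; rewrite mulr_ge0 ?invr_ge0 ?(ltW I0)//=.
  by rewrite mulrC ler_pdivrMr// mul1r.
- by move=> x /left0 ->; rewrite mulr0.
- by move=> x /right1 ->; rewrite mulVf// gt_eqF.
Qed.

Context (F : R -> R) (sF : smooth_step F).

Definition step_at (n : nat) (p x : R) : R := F (n.+1%:R * (x - p)).

(** A steep step at p minus its translate by t. Its derivative is a bump minus the translate of this
    bump, invisible to functions of period t, whereas the window tends to the indicator of ]p, p +
    t]. *)
Definition window (n : nat) (p t x : R) : R :=
  step_at n p x - step_at n p (x - t).

Lemma smooth_step_at n p : smooth (step_at n p).
Proof.
have [s _ _ _] := sF; have := smooth_affine n.+1%:R (- (n.+1%:R * p)) s.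
by rewrite /step_at; under eq_fun do rewrite -mulrN -mulrDr.
Qed.

Lemma step_at_left n p x : x <= p -> step_at n p x = 0.
Proof.
move=> xp; have [_ _ F0 _] := sF; apply: F0.
by rewrite mulr_ge0_le0// subr_le0.
Qed.

Lemma step_at_right n p x : p + n.+1%:R^-1 <= x -> step_at n p x = 1.
Proof.
move=> xp; have [_ _ _ F1] := sF; apply: F1.
by rewrite -ler_pdivrMl// mulr1 lerBrDl.
Qed.

Lemma step_at_right1 n p x : p + 1 <= x -> step_at n p x = 1.
Proof.
move=> xp; apply: step_at_right; apply: le_trans xp; rewrite lerD2l.
by rewrite invf_le1// ler1n.
Qed.

Lemma bumps_derive1_step n p : bumps (derive1 (step_at n p)).
Proof.
split; first exact/smooth_derive1/smooth_step_at.
exists (`|p| + 2) => x px; rewrite derive1E.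
have := ler_norm p; have := ler_norm (- p); rewrite normrN => h1 h2.
have [x0|x0] := leP 0 x.
  rewrite (ger0_norm x0) in px.
  rewrite (@near_eq_derive R R R _ (cst 1)) ?derive_cst//.
  near=> z; rewrite step_at_right1//=.
  have : p + 1 < z by near: z; apply: lt_nbhsr; lra.
  exact: ltW.
rewrite (ltr0_norm x0) in px.
rewrite (@near_eq_derive R R R _ (cst 0)) ?derive_cst//.
near=> z; rewrite step_at_left//=.
have : z < p by near: z; apply: lt_nbhsl; lra.
exact: ltW.
Unshelve. all: by end_near. Qed.

Lemma smooth_window n p t : smooth (window n p t).
Proof.
apply: (@smoothD _ (step_at n p) (fun x => - step_at n p (x - t))).
  exact: smooth_step_at.
have := smoothZ (-1) (smooth_affine 1 (- t) (smooth_step_at n p)).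
by under eq_fun do rewrite mul1r mulN1r.
Qed.

Lemma window_eq0 n p t x : 0 <= t -> `|p| + t + 1 <= `|x| -> window n p t x = 0.
Proof.
move=> t0; have := ler_norm p; have := ler_norm (- p); rewrite normrN => h1 h2.
rewrite /window; have [x0|x0] := leP 0 x.
  by rewrite (ger0_norm x0) => h; rewrite !step_at_right1 ?subrr//; lra.
by rewrite (ltr0_norm x0) => h; rewrite !step_at_left ?subrr//; lra.
Qed.

Lemma bumps_window n p t : 0 <= t -> bumps (window n p t).
Proof.
move=> t0; split; first exact: smooth_window.
by exists (`|p| + t + 1) => x; exact: window_eq0.
Qed.

Lemma derive1_window n p t :
  derive1 (window n p t) =
  fun x => 1 * derive1 (step_at n p) x + -1 * derive1 (step_at n p) (x - t).
Proof.
apply/funext => x.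
have d1 := smooth_is_derive x (smooth_step_at n p).
have d2 := smooth_is_derive (x - t) (smooth_step_at n p).
have dl : is_derive x 1 (fun x : R => x - t) 1.
  by apply: is_derive_eq; rewrite subr0.
have d3 := @is_derive1_comp _ (step_at n p) (fun x : R => x - t) x _ _ d2 dl.
have [_] := is_deriveB d1 d3; rewrite derive1E mulr1 mul1r mulN1r.
rewrite [(derive1 (window _ _ _)) _]derive1E; exact.
Qed.

(** The limiting ray excludes p because F vanishes at 0; hence windows converge to intervals closed
    on the right. *)
Lemma cvg_step_at p x : step_at n p x @[n --> \oo] --> (\1_`]p, +oo[%classic x : R).
Proof.
rewrite indicE; have [xp|px] := leP x p.
  under eq_fun do rewrite step_at_left//.
  rewrite memNset; first exact: cvg_cst.
  by rewrite /= in_itv/= andbT; apply/negP; rewrite -leNgt.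
rewrite mem_set; last by rewrite /= in_itv/= px.
have e0 : 0 < x - p by rewrite subr_gt0.
apply: cvg_near_cst; near=> n; apply: step_at_right.
rewrite -lerBrDl ltW//.
by near: n; exact: (near_infty_natSinv_lt (PosNum e0)).
Unshelve. all: by end_near. Qed.

Lemma box_approx_window p t : 0 <= t ->
  box_approx (`|p| + t + 1) (fun n => window n p t) `]p, p + t]%classic.
Proof.
move=> t0; split.
- move=> n; apply: continuous_measurable_fun; apply: smooth_continuous.
  exact: smooth_window.
- move=> n x; have [_ F01 _ _] := sF; rewrite ler_norml.
  have := F01 (n.+1%:R * (x - p)); have := F01 (n.+1%:R * (x - t - p)).
  by rewrite /window /step_at; lra.
- by move=> n x; exact: window_eq0.
- move=> x; rewrite (_ : \1__ x = \1_`]p, +oo[%classic x - \1_`]p, +oo[%classic (x - t)).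
    by apply: cvgB; exact: cvg_step_at.
  rewrite !indicE; have [px|px] := boolP (p < x); last first.
    rewrite -leNgt in px.
    rewrite memNset; last by rewrite /= in_itv/= ltNge px.
    rewrite memNset; last by rewrite /= in_itv/= ltNge px.
    rewrite memNset ?subr0//= in_itv/= andbT; apply/negP.
    by rewrite -leNgt; lra.
  rewrite [in RHS]mem_set; last by rewrite /= in_itv/= px.
  have [xt|xt] := leP x (p + t).
    rewrite mem_set; last by rewrite /= in_itv/= px.
    rewrite memNset ?subr0//= in_itv/= andbT; apply/negP.
    by rewrite -leNgt lerBlDr.
  rewrite memNset; last by rewrite /= in_itv/= px/=; apply/negP; rewrite -ltNge.
  by rewrite mem_set ?subrr//= in_itv/= andbT ltrBrDr.
Qed.

End Steps.

(** * Weak derivatives of translation-invariant functions *)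

Section Shifts.
Context {R : realType}.
Implicit Types (f g : pt3 R -> R).

(** Integration by parts puts the derivative on the window, where it is a bump minus its translate
    by t; by invariance of f both terms pair equally with f. *)
Lemma shift_pairing_y2 F f g (t : R) a b n p : smooth_step F -> 0 <= t ->
  L2loc f -> weak_partial dir_y2 f g ->
  {ae volume, forall p, slab p -> f (yshift 0 t p) = f p} ->
  thin_bumps a -> bumps b ->
  \int[volume]_(x in slab) (g x * tens a b (window F n p t) x) = 0.
Proof.
move=> sF t0 Lf [Lg wg] ft ta bb.
have bw := bumps_window sF n p t0; have bd := bumps_derive1_step sF n p.
have tp := test_tens ta bb bw; have td := test_tens ta bb bd.
have i := iso_yshift (0 : R) t; have ti := test_iso i td.
have := wg _ tp.
have E x : 'D_dir_y2 (tens a b (window F n p t)) x = tens a b (derive1 (window F n p t)) x.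
  by apply: derive_tens_y2; [case: ta|case: bb|case: bw].
under eq_Rintegral do rewrite E.
rewrite (derive1_window sF) (@pairing_linear R f (tens a b (derive1 (step_at F n p)))
  (tens a b (derive1 (step_at F n p)) \o yshift (- 0) (- t)) _ 1 (-1))//; last first.
  by move=> x; rewrite /tens /= oppr0 addr0; ring.
rewrite (pairing_iso i)// mul1r mulN1r subrr => /esym/eqP.
by rewrite oppr_eq0 => /eqP.
Qed.

Lemma shift_pairing_y1 F f g (t : R) a c n p : smooth_step F -> 0 <= t ->
  L2loc f -> weak_partial dir_y1 f g ->
  {ae volume, forall p, slab p -> f (yshift t 0 p) = f p} ->
  thin_bumps a -> bumps c ->
  \int[volume]_(x in slab) (g x * tens a (window F n p t) c x) = 0.
Proof.
move=> sF t0 Lf [Lg wg] ft ta bc.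
have bw := bumps_window sF n p t0; have bd := bumps_derive1_step sF n p.
have tp := test_tens ta bw bc; have td := test_tens ta bd bc.
have i := iso_yshift t (0 : R); have ti := test_iso i td.
have := wg _ tp.
have E x : 'D_dir_y1 (tens a (window F n p t) c) x = tens a (derive1 (window F n p t)) c x.
  by apply: derive_tens_y1; [case: ta|case: bw|case: bc].
under eq_Rintegral do rewrite E.
rewrite (derive1_window sF) (@pairing_linear R f (tens a (derive1 (step_at F n p)) c)
  (tens a (derive1 (step_at F n p)) c \o yshift (- t) (- 0)) _ 1 (-1))//; last first.
  by move=> x; rewrite /tens /= oppr0 addr0; ring.
rewrite (pairing_iso i)// mul1r mulN1r subrr => /esym/eqP.
by rewrite oppr_eq0 => /eqP.
Qed.

(** Each box has some length t in y2, and invariance under this very t gives g zero integral over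
    it. Invariance under all t > 0 thus reaches all boxes. *)
Lemma partial_y2_eq0 f g : L2loc f -> weak_partial dir_y2 f g ->
  (forall t, 0 < t ->
    {ae volume, forall p, slab p -> f (yshift 0 t p) = f p}) ->
  {ae volume, forall p, slab p -> g p = 0}.
Proof.
move=> Lf wg ft; have [Lg _] := wg; have [F sF] := @smooth_step_exists R.
apply: ae0_of_obox_integrals => // p q hp hq pq1 pq2 pq3.
have qp : 0 < q.2.2 - p.2.2 by rewrite subr_gt0.
(* Windows tend to the interval closed on the right; E differs from the open box by part of a null
   plane. *)
pose E : set (pt3 R) := `]p.1, q.1[%classic `*` (`]p.2.1, q.2.1[%classic `*` `]p.2.2, q.2.2]%classic).
have mE : measurable (E : set (pt3 R)) by do !apply: measurableX; exact: measurable_itv.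
have [mg _] := Lg.
have slabE : E `<=` slab.
  by move=> x [/=]; rewrite in_itv/= => h _; rewrite /slab/thickness/=; lra.
have mgO : measurable_fun (obox p q) g.
  apply: measurable_funS mg => //; apply: subset_trans (@obox_sub_cbox _ _ _) _.
  exact: inner_box_slab.
have mgE : measurable_fun E g by exact: measurable_funS mg.
have OE : {ae (@volume R), forall x : pt3 R, obox p q x <-> E x}.
  apply: (@filterS _ _ (ae_filter_ringOfSetsType (@volume R)) _ _ _ (@ae_volume_y2_neq R q.2.2)) => x xq.
  rewrite oboxP /E/= !in_itv/=; split => [[? ? /andP[? h]]|[? [? /andP[? h]]]].
    by split=> //; split => //; apply/andP; split => //; exact: ltW.
  by split => //; apply/andP; split => //; rewrite lt_neqAle xq.
rewrite (Rintegral_ae_set (@measurable_obox R p q) mE mgO mgE OE).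
have := @box_limit R g (Num.max `|p.1| `|q.1|) (Num.max `|p.2.1| `|q.2.1|)
  (`|p.2.2| + (q.2.2 - p.2.2) + 1) (plateau p.1 q.1) (plateau p.2.1 q.2.1)
  (fun n => window F n p.2.2 (q.2.2 - p.2.2))
  `]p.1, q.1[%classic `]p.2.1, q.2.1[%classic `]p.2.2, q.2.2]%classic Lg.
apply => //.
- by rewrite gt_max !ltr_norml; apply/andP; split; lra.
- exact: box_approx_plateau.
- exact: box_approx_plateau.
- have := box_approx_window sF p.2.2 (ltW qp).
  by rewrite (_ : p.2.2 + (q.2.2 - p.2.2) = q.2.2)//; ring.
- move=> n; apply: (shift_pairing_y2 _ _ sF (ltW qp) Lf wg); first exact: ft.
    exact: thin_bumps_plateau.
  exact: bumps_plateau.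
Qed.

Lemma constant_on_box g (k : R) (E : set (pt3 R)) : measurable E -> E `<=` slab ->
  measurable_fun slab g -> {ae volume, forall p, slab p -> g p = k} ->
  \int[volume]_(p in E) g p = k * fine (volume E).
Proof.
move=> mE sE mg gk; rewrite -(Rintegral_cst volume mE k).
apply: ae_eq_Rintegral => //; first exact: measurable_funS mg.
by apply: filterS gk => p h /sE.
Qed.

(** Periodicity gives zero integral only over boxes of length 1 in y2, but one box of positive
    volume determines a constant. *)
Lemma constant_partial_y2 f g (k : R) : L2loc f -> weak_partial dir_y2 f g ->
  {ae volume, forall p, slab p -> f (yshift 0 1 p) = f p} ->
  {ae volume, forall p, slab p -> g p = k} -> k = 0.
Proof.
move=> Lf wg ft gk; have [Lg _] := wg; have [F sF] := @smooth_step_exists R.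
(* A box of one full period in y2; the bound 1/4 merely keeps it away from the faces of the slab. *)
pose E := `](- 4^-1 : R), 4^-1[%classic `*` (`](0:R), 1[%classic `*` `](0:R), 0+1]%classic).
have mE : measurable (E : set (pt3 R)) by do !apply: measurableX; exact: measurable_itv.
have [mg _] := Lg.
have slabE : E `<=` slab.
  by move=> x [/=]; rewrite in_itv/= => h _; rewrite /slab/thickness/=; lra.
have := constant_on_box mE slabE mg gk.
have -> : \int[volume]_(p in E) g p = 0; last first.
  rewrite /volume product_measure1E//; last by apply: measurableX; exact: measurable_itv.
  rewrite [X in (_ * X)%E](_ : _ = area (`](0:R), 1[%classic `*` `](0:R), 0+1]%classic))//.
  rewrite /area product_measure1E// /= !lebesgue_measure_itv/= !lte_fin add0r ltr01.
  rewrite (_ : - 4^-1 < 4^-1 :> R); last by lra.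
  rewrite /= => /esym/eqP; rewrite mulf_eq0 => /orP[/eqP//|/eqP]; lra.
apply: (@box_limit R g (Num.max `|- 4^-1| `|4^-1|) (Num.max `|0| `|1|)
  (`|0| + 1 + 1) (plateau (- 4^-1) 4^-1) (plateau 0 1)
  (fun n => window F n 0 1)
  `](- 4^-1), 4^-1[%classic `]0, 1[%classic `]0, 0 + 1]%classic Lg) => //.
- by rewrite gt_max !ltr_norml; apply/andP; split; lra.
- exact: box_approx_plateau.
- exact: box_approx_plateau.
- exact: (box_approx_window sF).
- move=> n; apply: (shift_pairing_y2 _ _ sF ler01 Lf wg ft).
    by apply: thin_bumps_plateau; lra.
  exact: bumps_plateau.
Qed.

Lemma constant_partial_y1 f g (k : R) : L2loc f -> weak_partial dir_y1 f g ->
  {ae volume, forall p, slab p -> f (yshift 1 0 p) = f p} ->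
  {ae volume, forall p, slab p -> g p = k} -> k = 0.
Proof.
move=> Lf wg ft gk; have [Lg _] := wg; have [F sF] := @smooth_step_exists R.
pose E := `](- 4^-1 : R), 4^-1[%classic `*` (`](0:R), 0+1]%classic `*` `](0:R), 1[%classic).
have mE : measurable (E : set (pt3 R)) by do !apply: measurableX; exact: measurable_itv.
have [mg _] := Lg.
have slabE : E `<=` slab.
  by move=> x [/=]; rewrite in_itv/= => h _; rewrite /slab/thickness/=; lra.
have := constant_on_box mE slabE mg gk.
have -> : \int[volume]_(p in E) g p = 0; last first.
  rewrite /volume product_measure1E//; last by apply: measurableX; exact: measurable_itv.
  rewrite [X in (_ * X)%E](_ : _ = area (`](0:R), 0 + 1]%classic `*` `](0:R), 1[%classic))//.
  rewrite /area product_measure1E// /= !lebesgue_measure_itv/= !lte_fin add0r ltr01.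
  rewrite (_ : - 4^-1 < 4^-1 :> R); last by lra.
  rewrite /= => /esym/eqP; rewrite mulf_eq0 => /orP[/eqP//|/eqP]; lra.
apply: (@box_limit R g (Num.max `|- 4^-1| `|4^-1|) (`|0| + 1 + 1) (Num.max `|0| `|1|)
  (plateau (- 4^-1) 4^-1) (fun n => window F n 0 1) (plateau 0 1)
  `](- 4^-1), 4^-1[%classic `]0, 0 + 1]%classic `]0, 1[%classic Lg) => //.
- by rewrite gt_max !ltr_norml; apply/andP; split; lra.
- exact: box_approx_plateau.
- exact: (box_approx_window sF).
- exact: box_approx_plateau.
- move=> n; apply: (shift_pairing_y1 _ _ sF ler01 Lf wg ft).
    by apply: thin_bumps_plateau; lra.
  exact: bumps_plateau.
Qed.

End Shifts.

Section AlmostEverywhere.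
Context {R : realType}.

Lemma ae_volumeS (P Q : pt3 R -> Prop) : (forall p, P p -> Q p) ->
  {ae volume, forall p, P p} -> {ae volume, forall p, Q p}.
Proof. exact: (@filterS _ _ (ae_filter_ringOfSetsType (@volume R))). Qed.

Lemma ae_volumeI (P Q : pt3 R -> Prop) : {ae volume, forall p, P p} ->
  {ae volume, forall p, Q p} -> {ae volume, forall p, P p /\ Q p}.
Proof. exact: (@filterI _ _ (ae_filter_ringOfSetsType (@volume R))). Qed.

Lemma ae_volume_ord n (P : 'I_n -> pt3 R -> Prop) :
  (forall i, {ae volume, forall p, P i p}) ->
  {ae volume, forall p, forall i, P i p}.
Proof.
exact: (@filter_forall _ _ _ _ (ae_filter_ringOfSetsType (@volume R))).
Qed.

Lemma ae_volume_countable (I : countType) (P : I -> pt3 R -> Prop) :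
  (forall i, {ae volume, forall p, P i p}) ->
  {ae volume, forall p, forall i, P i p}.
Proof.
move=> h; have : {ae volume, forall p, forall n : nat,
    if unpickle n is Some i then P i p else True}.
  apply: ae_foralln => n; case: (unpickle n) => [i|]; first exact: h.
  exact: aeW.
by apply: ae_volumeS => p hp i; have := hp (pickle i); rewrite pickleK.
Qed.

Lemma ae_volume_yshift (t1 t2 : R) (P : pt3 R -> Prop) :
  {ae volume, forall p, slab p -> P p} ->
  {ae volume, forall p, slab p -> P (yshift t1 t2 p)}.
Proof. exact: (ae_slab_iso (iso_yshift t1 t2)). Qed.

End AlmostEverywhere.

(** * Integrals over the periodicity cell *)

Section Cell.
Context {R : realType}.
Implicit Types (p : pt3 R).

Lemma cell_slab : @cell R `<=` slab.
Proof. by move=> p []. Qed.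

Lemma measurable_cell : measurable (@cell R).
Proof.
rewrite (_ : cell = `]- 2^-1, 2^-1[%classic `*`
   (`[- 2^-1, 2^-1[%classic `*` `[- 2^-1, 2^-1[%classic)).
  by do !apply: measurableX; exact: measurable_itv.
apply/seteqP; split => p; rewrite /cell/thickness/half_open_cell/= !in_itv/=.
  by case.
by case=> ? [].
Qed.
Hint Resolve measurable_cell : core.

Lemma volume_cell : (volume (@cell R) < +oo)%E.
Proof.
apply: le_lt_trans (volume_cbox (- 2^-1, (- 2^-1, - 2^-1)) (2^-1, (2^-1, 2^-1))).
apply: le_measure => //; rewrite ?inE//; first exact: measurable_cbox.
move=> p [] /andP[h1 h2] /andP[h3 h4] /andP[h5 h6].
by rewrite /cbox/= !in_itv/=; split; [|split]; apply/andP; split => //; exact: ltW.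
Qed.

(** T may move the cell; only integrals of functions of period 1 in y2 have to be preserved. This
    covers translations in y2, which wrap around the cell. *)
Definition cell_invariant (T : pt3 R -> pt3 R) : Prop :=
  forall f : pt3 R -> \bar R, measurable_fun slab f ->
    {ae volume, forall p, slab p -> f (translate 0 1 p) = f p} ->
    (\int[volume]_(p in cell) f p = \int[volume]_(p in cell) f (T p))%E.

Lemma cell_invariant_ae (T T' L L' : pt3 R -> pt3 R) : slab_iso T T' L L' ->
  {ae volume, forall p, (T @^-1` cell) p <-> cell p} -> cell_invariant T.
Proof.
move=> i h f mf _; have mT := iso_preserving i.
rewrite (preserving_integral mT measurable_cell (measurable_funS measurable_slab cell_slab mf)).
apply: integral_ae_set => //.
- exact: (preserving_measurable_preimage mT).
- apply: measurable_funS (preserving_measurable_fun mT measurable_slab mf).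
    exact: (preserving_measurable_preimage mT).
  by move=> p; exact: cell_slab.
- have := preserving_measurable_fun mT measurable_slab mf.
  rewrite (iso_preimage_slab i) => mfT.
  exact: (measurable_funS measurable_slab cell_slab mfT).
Qed.

Lemma cell_invariant_flip3 : cell_invariant flip3.
Proof.
apply: (cell_invariant_ae iso_flip3); apply: aeW => p /=.
by rewrite /cell/thickness/half_open_cell/=; split => -[h1 h2 h3]; split; lra.
Qed.

(** The half-open cell is not symmetric in y2, but its image differs from it only within the null
    planes y2 = -1/2 and y2 = 1/2. *)
Lemma cell_invariant_flip2 : cell_invariant flip2.
Proof.
apply: (cell_invariant_ae iso_flip2).
apply: ae_volumeS (ae_volumeI (ae_volume_y2_neq (- 2^-1)) (ae_volume_y2_neq 2^-1)).
move=> p [/eqP n1 /eqP n2] /=.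
rewrite /cell/thickness/half_open_cell/=; split => -[h1 h2 /andP[h3 h4]]; split => //.
  by apply/andP; split; [|rewrite lt_neqAle; apply/andP; split; [apply/eqP|]]; lra.
apply/andP; split; first by lra.
rewrite lt_neqAle; apply/andP; split; last by lra.
by apply/eqP => h; apply: n1; lra.
Qed.

Lemma measurable_y2_set (c : R) : measurable [set p : pt3 R | p.2.2 < c].
Proof.
rewrite (_ : mkset _ = setT `*` (setT `*` `]-oo, c[%classic)).
  by do !apply: measurableX => //; exact: measurable_itv.
apply/seteqP; split => p /=; rewrite in_itv/=; first by [].
by case=> ? [].
Qed.

(** The cell is cut at y2 = -1/2 + t for f and at 1/2 - t for the shifted f. The upper piece of the
    former matches the lower piece of the latter by the shift t; the remaining pieces match by the
    shift t - 1 followed by periodicity. *)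
Lemma cell_invariant_yshift_ge0 (t : R) (f : pt3 R -> \bar R) : 0 <= t <= 1 ->
  (forall p, 0 <= f p)%E -> measurable_fun slab f ->
  {ae volume, forall p, slab p -> f (translate 0 1 p) = f p} ->
  (\int[volume]_(p in cell) f p = \int[volume]_(p in cell) f (yshift 0%R t p))%E.
Proof.
move=> t01 f0 mf per.
pose C c : set (pt3 R) := [set p | p.2.2 < c].
have mC c : measurable (C c) by exact: measurable_y2_set.
have split_cell (g : pt3 R -> \bar R) c : (forall p, 0 <= g p)%E ->
    measurable_fun slab g ->
    (\int[volume]_(p in cell) g p = \int[volume]_(p in cell `&` C c) g p
      + \int[volume]_(p in cell `&` ~` C c) g p)%E.
  move=> g0 mg; rewrite -[in LHS](setIT cell) -(setUv (C c)) setIUr.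
  rewrite ge0_integral_setU//.
  - exact: measurableI.
  - by apply: measurableI => //; exact: measurableC.
  - rewrite -setIUr setUv setIT.
    exact: (measurable_funS measurable_slab cell_slab mg).
  - by apply/disj_setPS => x [[_ ?] []].
have mfs (u : R) (D : set (pt3 R)) : D `<=` slab -> measurable_fun D (f \o yshift 0 u).
  move=> Ds; apply: (measurable_funS measurable_slab Ds).
  exact: (measurable_fun_iso (iso_yshift 0 u) mf).
have mI1 c : measurable (cell `&` C c) by exact: measurableI.
have mI2 c : measurable (cell `&` ~` C c).
  by apply: measurableI => //; exact: measurableC.
have f0' p : (0 <= (f \o yshift 0%R t) p)%E by exact: f0.
rewrite (split_cell f (- 2^-1 + t) f0 mf).
rewrite (split_cell (f \o yshift 0 t) (2^-1 - t) f0' (mfs t slab (@subset_refl _ slab))).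
rewrite [RHS]addeC; congr (_ + _)%E.
  have pS := preserving_volume_yshift (0 : R) (t - 1).
  rewrite (preserving_integral pS (mI1 _)); last first.
    by apply: measurable_funS mf => // p [/cell_slab].
  rewrite (_ : _ @^-1` _ = cell `&` ~` C (2^-1 - t)); last first.
    apply/seteqP; split => p; rewrite /cell/thickness/half_open_cell/C/yshift/= addr0.
      move=> [[h1 h2 h3] h4]; split; last by apply/negP; rewrite -leNgt; lra.
      by split => //; lra.
    move=> [[h1 h2 h3]] /negP; rewrite -leNgt => h4.
    by split; [split|] => //; lra.
  apply: ae_eq_integral => //.
  - by apply: mfs => p [/cell_slab].
  - by apply: mfs => p [/cell_slab].
  - apply: ae_volumeS (ae_volume_yshift 0 (t - 1) per) => p h [/cell_slab/h <- _].
    by congr f; rewrite /translate/yshift/= !addr0 mulr1z; congr (_, (_, _)); ring.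
have pS := preserving_volume_yshift (0 : R) t.
rewrite (preserving_integral pS (mI2 _)); last first.
  by apply: measurable_funS mf => // p [/cell_slab].
rewrite (_ : _ @^-1` _ = cell `&` C (2^-1 - t))//.
apply/seteqP; split => p; rewrite /cell/thickness/half_open_cell/C/yshift/= addr0.
  move=> [[h1 h2 h3]] /negP; rewrite -leNgt => h4.
  by split; [split|] => //; lra.
move=> [[h1 h2 h3] h4]; split; last by apply/negP; rewrite -leNgt; lra.
by split => //; lra.
Qed.

Lemma cell_invariant_yshift (t : R) : 0 <= t <= 1 -> cell_invariant (yshift 0 t).
Proof.
move=> t01 f mf per; rewrite integralE [RHS]integralE.
rewrite (cell_invariant_yshift_ge0 t01 (fun p => funepos_ge0 f p))//; first last.
- by apply: ae_volumeS per => p h sp; rewrite !funeposE h.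
- exact: measurable_funepos.
rewrite (cell_invariant_yshift_ge0 t01 (fun p => funeneg_ge0 f p))//; first last.
- by apply: ae_volumeS per => p h sp; rewrite !funenegE h.
- exact: measurable_funeneg.
by congr (_ - _)%E; apply: eq_integral => p _; rewrite ?funeposE ?funenegE.
Qed.

Lemma cell_invariant_Rintegral (T : pt3 R -> pt3 R) (f : pt3 R -> R) :
  cell_invariant T -> measurable_fun slab f ->
  {ae volume, forall p, slab p -> f (translate 0 1 p) = f p} ->
  \int[volume]_(p in cell) f p = \int[volume]_(p in cell) f (T p).
Proof.
move=> iT mf per; congr fine; apply: (iT (EFin \o f)).
  exact/measurable_EFinP.
by apply: ae_volumeS per => p h /h /= ->.
Qed.

Lemma slab_translate_cell (p : pt3 R) : slab p ->
  exists k1 k2 : int, cell (translate k1 k2 p).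
Proof.
move=> sp; have red (x : R) : exists k : int, half_open_cell (x + k%:~R).
  exists (- Num.floor (x + 2^-1)).
  have := floor_le (x + 2^-1); have := floorD1_gt (x + 2^-1).
  rewrite /half_open_cell/= mulrNz intrD; move: (_%:~R) => k h1 h2.
  by rewrite mulr1z in h1; apply/andP; split; lra.
have [k1 h1] := red p.2.1; have [k2 h2] := red p.2.2.
by exists k1, k2; split.
Qed.

End Cell.
#[export] Hint Resolve measurable_cell : core.

(** * Periodic fields with square-integrable gradient *)

Section Gradients.
Context {R : realType}.
Implicit Types (f g : pt3 R -> R) (phi : pt3 R -> 'cV[R]_3) (W : pt3 R -> 'M[R]_3).

Definition dirs (j : 'I_3) : pt3 R := nth 0 [:: dir_y1; dir_y2; dir_x3] j.

Definition scl (gamma : R) (j : 'I_3) : R := nth 0 [:: 1; 1; gamma^-1] j.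

Lemma ord3P (P : 'I_3 -> Prop) : P i1 -> P i2 -> P i3 -> forall i, P i.
Proof.
move=> h1 h2 h3 [[|[|[|//]]] hi].
- by rewrite (_ : Ordinal hi = i1)//; exact: val_inj.
- by rewrite (_ : Ordinal hi = i2)//; exact: val_inj.
- by rewrite (_ : Ordinal hi = i3)//; exact: val_inj.
Qed.

Lemma nablaE gamma phi p i j :
  nabla gamma phi p i j = scl gamma j * partial (dirs j) (component i phi) p.
Proof.
by rewrite mxE; elim/ord3P: j; rewrite /scl /dirs /= ?mul1r.
Qed.

Lemma scl_neq0 gamma j : 0 < gamma -> scl gamma j != 0.
Proof.
by move=> g0; elim/ord3P: j; rewrite /scl /= ?oner_eq0// invr_eq0 gt_eqF.
Qed.

(** W is any representative of the scaled gradient. Sums and pullbacks then have exact gradients, to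
    be compared with [nabla] only at the end and almost everywhere. *)
Definition has_grad (gamma : R) phi W : Prop :=
  (forall i, L2loc (component i phi)) /\
  forall i j, exists g, weak_partial (dirs j) (component i phi) g /\
    forall p, W p i j = scl gamma j * g p.

Lemma dirsP (j : 'I_3) : dirs j = dir_y1 \/ dirs j = dir_y2 \/ dirs j = dir_x3.
Proof. by elim/ord3P: j; [left|right; left|right; right]. Qed.

Lemma has_grad_nabla gamma phi : H1gamma gamma phi ->
  has_grad gamma phi (nabla gamma phi).
Proof.
move=> [h _ _]; split; first by move=> i; case: (h i).
move=> i j; exists (partial (dirs j) (component i phi)); split.
  by apply: partialP; have [_] := h i; apply; exact: dirsP.
by move=> p; exact: nablaE.
Qed.

Lemma has_grad_unique gamma phi W W' : has_grad gamma phi W ->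
  has_grad gamma phi W' ->
  {ae volume, forall p, slab p -> W p = W' p}.
Proof.
move=> [_ h] [_ h'].
suff H : {ae volume, forall p, forall i j, slab p -> W p i j = W' p i j}.
  by apply: ae_volumeS H => p hp sp; apply/matrixP => i j; exact: hp.
apply: ae_volume_ord => i; apply: ae_volume_ord => j.
have [g [wg gE]] := h i j; have [g' [wg' gE']] := h' i j.
apply: ae_volumeS (weak_partial_unique wg wg') => p hp sp.
by rewrite gE gE' hp.
Qed.

Lemma nabla_ae gamma phi W : H1gamma gamma phi -> has_grad gamma phi W ->
  {ae volume, forall p, slab p -> nabla gamma phi p = W p}.
Proof. by move=> /has_grad_nabla; exact: has_grad_unique. Qed.

Lemma has_grad_measurable gamma phi W i j : has_grad gamma phi W ->
  measurable_fun slab (fun p => W p i j).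
Proof.
move=> [_ /(_ i j) [g [[[mg _] _] gE]]].
rewrite (_ : (fun p => _) = (fun p => scl gamma j * g p)); last exact/funext.
by apply: measurable_funM => //; exact: measurable_cst.
Qed.

Lemma has_gradZD gamma (s t : R) phi phi' W W' : has_grad gamma phi W ->
  has_grad gamma phi' W' ->
  has_grad gamma (fun p => s *: phi p + t *: phi' p)
    (fun p => s *: W p + t *: W' p).
Proof.
move=> [L h] [L' h'].
have cE i : component i (fun p => s *: phi p + t *: phi' p) =
    fun p => s * component i phi p + t * component i phi' p.
  by apply/funext => p; rewrite /component !mxE.
split; first by move=> i; rewrite cE; exact: L2locZD.
move=> i j; have [g [wg gE]] := h i j; have [g' [wg' gE']] := h' i j.
exists (fun p => s * g p + t * g' p); split.
  by rewrite cE; exact: weak_partialZD.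
by move=> p; rewrite !mxE gE gE'; ring.
Qed.

Definition signs (e : 'I_3 -> R) : Prop := forall i, e i = 1 \/ e i = -1.

Lemma has_grad_iso gamma (T T' L L' : pt3 R -> pt3 R) (eta s : 'I_3 -> R) phi W :
  slab_iso T T' L L' -> signs s -> (forall j, L (dirs j) = s j *: dirs j) ->
  has_grad gamma phi W ->
  has_grad gamma (fun p => \col_i (eta i * phi (T p) i 0))
    (fun p => \matrix_(i, j) (eta i * s j * W (T p) i j)).
Proof.
move=> iT ss Ls [L0 h].
have cE i : component i (fun p => \col_i (eta i * phi (T p) i 0)) =
    fun p => eta i * (component i phi \o T) p + 0 * (component i phi \o T) p.
  by apply/funext => p; rewrite /component !mxE /= mul0r addr0.
have LT i := L2loc_iso iT (L0 i).
split; first by move=> i; rewrite cE; exact: L2locZD.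
move=> i j; have [g [wg gE]] := h i j.
have wT := weak_partial_iso iT (ss j) (Ls j) (L0 i) wg.
exists (fun p => eta i * (s j * g (T p)) + 0 * (s j * g (T p))); split.
  by rewrite cE; exact: weak_partialZD.
by move=> p; rewrite !mxE gE; ring.
Qed.

Lemma weak_partial_aeL v f f' g : L2loc f -> L2loc f' ->
  {ae volume, forall p, slab p -> f p = f' p} ->
  weak_partial v f g -> weak_partial v f' g.
Proof.
move=> [mf _] [mf' _] ff' [Lg h]; split => // psi tp.
by rewrite -(pairing_ae mf mf' ff' (test_derive v tp)) h.
Qed.

Lemma translateE (k1 k2 : int) :
  @translate R k1 k2 = yshift k1%:~R k2%:~R.
Proof. by []. Qed.

Lemma component_translate gamma phi (k1 k2 : int) i : H1gamma gamma phi ->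
  {ae volume, forall p, slab p ->
    component i phi (yshift k1%:~R k2%:~R p) = component i phi p}.
Proof.
move=> [_ /(_ k1 k2) per _]; apply: ae_volumeS per => p h sp.
by rewrite /component -translateE h.
Qed.

(** Periodicity is imposed on phi alone; a translate of W is a gradient of the translated field, and
    uniqueness transfers the period to W. *)
Lemma grad_translate gamma phi W (k1 k2 : int) : H1gamma gamma phi ->
  has_grad gamma phi W ->
  {ae volume, forall p, slab p -> W (translate k1 k2 p) = W p}.
Proof.
move=> Hphi [L h].
suff H : {ae volume, forall p, forall i j, slab p -> W (translate k1 k2 p) i j = W p i j}.
  by apply: ae_volumeS H => p hp sp; apply/matrixP => i j; exact: hp.
apply: ae_volume_ord => i; apply: ae_volume_ord => j.
have [g [wg gE]] := h i j.
have iT := iso_yshift (k1%:~R : R) k2%:~R.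
have wT := weak_partial_iso iT (or_introl erefl) (esym (scale1r _)) (L i) wg.
have wT' := weak_partial_aeL (L2loc_iso iT (L i)) (L i)
  (component_translate k1 k2 i Hphi) wT.
apply: ae_volumeS (weak_partial_unique wT' wg) => p hp sp.
by rewrite !gE -(hp sp) mul1r.
Qed.

(** Measurability is asked on the whole slab, so that it survives composition with isometries that
    move the cell. *)
Definition L2cell f : Prop :=
  measurable_fun slab f /\
  volume.-integrable cell (EFin \o (fun p => f p ^+ 2)).

Lemma measurable_fun_cell d (Y : measurableType d) (f : pt3 R -> Y) :
  measurable_fun slab f -> measurable_fun cell f.
Proof. exact: (measurable_funS measurable_slab cell_slab). Qed.

Lemma integrable_cell_ge0 f : measurable_fun slab f -> (forall p, 0 <= f p) ->
  (\int[volume]_(p in cell) (f p)%:E < +oo)%E <->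
  volume.-integrable cell (EFin \o f).
Proof.
move=> mf f0; split => [h|/integrableP[_]].
  apply/integrableP; split; first by apply/measurable_EFinP; exact: measurable_fun_cell.
  move: h; congr (_ < _)%E; apply: eq_integral => p _ /=.
  by rewrite ger0_norm.
congr (_ < _)%E; apply: eq_integral => p _ /=.
by rewrite ger0_norm.
Qed.

Lemma le_integrable_cell f g : measurable_fun slab f ->
  volume.-integrable cell (EFin \o g) ->
  (forall p, cell p -> 0 <= f p <= g p) ->
  volume.-integrable cell (EFin \o f).
Proof.
move=> mf ig fg.
apply: (@le_integrable _ _ _ volume cell measurable_cell _ (EFin \o g)) => //.
  by apply/measurable_EFinP; exact: measurable_fun_cell.
move=> p cp; have /andP[h1 h2] := fg p cp.
by rewrite /= lee_fin ger0_norm// (le_trans h2)// ler_norm.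
Qed.

Lemma integrable_cellZD (s t : R) f g :
  volume.-integrable cell (EFin \o f) -> volume.-integrable cell (EFin \o g) ->
  volume.-integrable cell (EFin \o (fun p => s * f p + t * g p)).
Proof.
move=> If Ig; have h1 := integrableZl measurable_cell s If.
have h2 := integrableZl measurable_cell t Ig.
by apply: eq_integrable (integrableD measurable_cell h1 h2) => // p _ /=; rewrite EFinD !EFinM.
Qed.

Lemma Rintegral_cellZD (s t : R) f g :
  volume.-integrable cell (EFin \o f) -> volume.-integrable cell (EFin \o g) ->
  \int[volume]_(p in cell) (s * f p + t * g p) =
  s * (\int[volume]_(p in cell) f p) + t * (\int[volume]_(p in cell) g p).
Proof.
move=> If Ig; rewrite -!RintegralZl// -RintegralD//.
- exact: (integrableZl measurable_cell s If).
- exact: (integrableZl measurable_cell t Ig).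
Qed.

Lemma L2cellZD (s t : R) f g : L2cell f -> L2cell g ->
  L2cell (fun p => s * f p + t * g p).
Proof.
move=> [mf If] [mg Ig]; have m : measurable_fun slab (fun p => s * f p + t * g p).
  by apply: measurable_funD; apply: measurable_funM => //; exact: measurable_cst.
split => //; apply: (le_integrable_cell _
    (integrable_cellZD (2 * s ^+ 2) (2 * t ^+ 2) If Ig)).
  exact: measurable_funX.
move=> p _; rewrite sqr_ge0/=.
by have := sqr_ge0 (s * f p - t * g p); nra.
Qed.

Lemma L2cell_cst (c : R) : L2cell (fun=> c).
Proof.
split; first exact: measurable_cst.
apply/integrable_cell_ge0; first exact: measurable_cst.
  by move=> _; exact: sqr_ge0.
rewrite (@integral_cst _ _ _ volume _ _ (c ^+ 2)%:E)//.
by apply: lte_mul_pinfty => //; [rewrite lee_fin sqr_ge0|exact: volume_cell].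
Qed.

Lemma sqnormE m n (A : 'M[R]_(m, n)) : sqnorm A = \sum_i \sum_j A i j ^+ 2.
Proof.
rewrite /sqnorm /frobenius /mxtrace exchange_big/=; apply: eq_bigr => j _.
by rewrite mxE; apply: eq_bigr => i _; rewrite mxE expr2.
Qed.

Lemma sqnorm_ge0 m n (A : 'M[R]_(m, n)) : 0 <= sqnorm A.
Proof. by rewrite sqnormE; do 2 apply: sumr_ge0 => ? _; exact: sqr_ge0. Qed.

Lemma sqnorm_entry m n (A : 'M[R]_(m, n)) i j : A i j ^+ 2 <= sqnorm A.
Proof.
rewrite sqnormE (bigD1 i)//= (bigD1 j)//= -addrA lerDl addr_ge0//.
  by apply: sumr_ge0 => ? _; exact: sqr_ge0.
by do 2 apply: sumr_ge0 => ? _; exact: sqr_ge0.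
Qed.

Lemma measurable_sqnorm m n (A : pt3 R -> 'M[R]_(m, n)) :
  (forall i j, measurable_fun slab (fun p => A p i j)) ->
  measurable_fun slab (fun p => sqnorm (A p)).
Proof.
move=> h; under eq_fun do rewrite sqnormE.
apply: measurable_sum => i; apply: measurable_sum => j.
exact: measurable_funX.
Qed.

Lemma integrable_sqnorm m n (A : pt3 R -> 'M[R]_(m, n)) :
  (forall i j, L2cell (fun p => A p i j)) ->
  volume.-integrable cell (EFin \o (fun p => sqnorm (A p))).
Proof.
move=> h.
have : volume.-integrable cell (fun p => \sum_(i <- index_enum 'I_m)
    \sum_(j <- index_enum 'I_n) ((A p i j) ^+ 2)%:E)%E.
  apply: integrable_sum => // i _; apply: integrable_sum => // j _.
  by case: (h i j).
apply: eq_integrable => // p _; rewrite /= sqnormE -sumEFin.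
by apply: eq_bigr => i _; rewrite sumEFin.
Qed.

Lemma measurable_component gamma phi i : H1gamma gamma phi ->
  measurable_fun slab (component i phi).
Proof. by move=> /has_grad_nabla [/(_ i)[]]. Qed.

Lemma H1gamma_L2cell gamma phi : H1gamma gamma phi ->
  (forall i, L2cell (component i phi)) /\
  (forall i j, L2cell (fun p => nabla gamma phi p i j)).
Proof.
move=> H; have Hg := has_grad_nabla H.
have mphi : measurable_fun slab (fun p => sqnorm (phi p)).
  apply: measurable_sqnorm => i j; rewrite (ord1 j).
  exact: (measurable_component i H).
have mn : measurable_fun slab (fun p => sqnorm (nabla gamma phi p)).
  by apply: measurable_sqnorm => i j; exact: (has_grad_measurable i j Hg).
have [_ _ fin] := H.
have I : volume.-integrable cell (EFin \o (fun p => sqnorm (phi p) + sqnorm (nabla gamma phi p))).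
  apply/integrable_cell_ge0 => //; first exact: measurable_funD.
  by move=> p; rewrite addr_ge0 ?sqnorm_ge0.
split => [i|i j]; split.
- exact: (measurable_component i H).
- apply: (le_integrable_cell _ I).
    apply: measurable_funX; exact: (measurable_component i H).
  move=> p _; rewrite sqr_ge0/= -[leLHS]addr0 lerD ?sqnorm_ge0//.
  exact: sqnorm_entry.
- exact: (has_grad_measurable i j Hg).
- apply: (le_integrable_cell _ I).
    apply: measurable_funX; exact: (has_grad_measurable i j Hg).
  move=> p _; rewrite sqr_ge0/= -[leLHS]add0r lerD ?sqnorm_ge0//.
  exact: sqnorm_entry.
Qed.

(** Membership is checked on a convenient gradient W: the integrals of W and of [nabla] agree by
    uniqueness. *)
Lemma H1gamma_intro gamma phi W : has_grad gamma phi W ->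
  (forall k1 k2 : int,
    {ae volume, forall p, slab p -> phi (translate k1 k2 p) = phi p}) ->
  (forall i, L2cell (component i phi)) ->
  (forall i j, L2cell (fun p => W p i j)) -> H1gamma gamma phi.
Proof.
move=> hg per Lc LW; have [L h] := hg.
have ex i j : exists g, weak_partial (dirs j) (component i phi) g.
  by have [g [wg _]] := h i j; exists g.
split => //.
  move=> i; split => // v [->|[->|->]].
  - exact: (ex i i1).
  - exact: (ex i i2).
  - exact: (ex i i3).
have hn : has_grad gamma phi (nabla gamma phi).
  split => // i j; exists (partial (dirs j) (component i phi)); split.
    exact: partialP.
  by move=> p; exact: nablaE.
have Lc' (i : 'I_3) (j : 'I_1) : L2cell (fun p => phi p i j).
  by rewrite (ord1 j); exact: Lc.
have I := integrable_cellZD 1 1 (integrable_sqnorm Lc') (integrable_sqnorm LW).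
have mphi : measurable_fun slab (fun p => sqnorm (phi p)).
  by apply: measurable_sqnorm => i j; case: (Lc' i j).
have mn : measurable_fun slab (fun p => sqnorm (nabla gamma phi p)).
  by apply: measurable_sqnorm => i j; exact: (has_grad_measurable i j hn).
have mW : measurable_fun slab (fun p => sqnorm (W p)).
  by apply: measurable_sqnorm => i j; exact: (has_grad_measurable i j hg).
have := iffRL (integrable_cell_ge0 _ _) I.
rewrite (ae_eq_integral (fun p => (sqnorm (phi p) + sqnorm (nabla gamma phi p))%:E))//.
- apply.
    by apply: measurable_funD; apply: measurable_funM => //; exact: measurable_cst.
  by move=> p; rewrite !mul1r addr_ge0 ?sqnorm_ge0.
- apply/measurable_EFinP; apply: measurable_fun_cell.
  by apply: measurable_funD; apply: measurable_funM => //; exact: measurable_cst.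
- by apply/measurable_EFinP; apply: measurable_fun_cell; exact: measurable_funD.
- apply: ae_volumeS (has_grad_unique hn hg) => p hp cp.
  by rewrite (hp (cell_slab cp)) !mul1r.
Qed.

Lemma H1gammaZD gamma (s t : R) phi phi' : H1gamma gamma phi ->
  H1gamma gamma phi' -> H1gamma gamma (fun p => s *: phi p + t *: phi' p).
Proof.
move=> H H'; have [Lc LW] := H1gamma_L2cell H; have [Lc' LW'] := H1gamma_L2cell H'.
apply: (H1gamma_intro (has_gradZD s t (has_grad_nabla H) (has_grad_nabla H'))).
- move=> k1 k2; have [_ /(_ k1 k2) per _] := H; have [_ /(_ k1 k2) per' _] := H'.
  by apply: ae_volumeS (ae_volumeI per per') => p [h h'] sp; rewrite h// h'.
- move=> i; have := L2cellZD s t (Lc i) (Lc' i); congr L2cell.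
  by apply/funext => p; rewrite /component !mxE.
- move=> i j; have := L2cellZD s t (LW i j) (LW' i j); congr L2cell.
  by apply/funext => p; rewrite !mxE.
Qed.

Lemma weak_partial0 (v : pt3 R) : weak_partial v (fun=> 0 : R) (fun=> 0 : R).
Proof.
split; first exact: L2loc_cst.
by move=> psi _; under eq_Rintegral do rewrite mul0r;
  under [in RHS]eq_Rintegral do rewrite mul0r; rewrite Rintegral_cst// mul0r oppr0.
Qed.

Lemma H1gamma0 (gamma : R) : H1gamma gamma (fun=> 0).
Proof.
have hg : has_grad gamma (fun=> 0) (fun=> 0).
  have cE i : component i (fun=> 0 : 'cV[R]_3) = fun=> 0 :> R.
    by apply/funext => p; rewrite /component mxE.
  split => [i|i j]; rewrite cE; first exact: L2loc_cst.
  exists (fun=> 0); split; first exact: (weak_partial0 _).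
  by move=> p; rewrite mxE mulr0.
apply: (H1gamma_intro hg).
- by move=> k1 k2; exact: aeW.
- move=> i; rewrite (_ : component i _ = fun=> 0); first exact: L2cell_cst.
  by apply/funext => p; rewrite /component mxE.
- move=> i j; rewrite (_ : (fun p => _) = fun=> 0); first exact: L2cell_cst.
  by apply/funext => p; rewrite mxE.
Qed.

End Gradients.

(** * Infinitesimal rigid motions *)

Section Rigidity.
Context {R : realType}.
Implicit Types (f g : pt3 R -> R) (w : pt3 R -> 'cV[R]_3).

(** A null set cannot contain a box of positive volume. It allows identities between constants to be
    read at a single point. *)
Lemma ae_slab_exists (P : pt3 R -> Prop) :
  {ae volume, forall p, slab p -> P p} -> exists p, slab p /\ P p.
Proof.
move=> [N [mN N0 PN]]; apply: contrapT => nex.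
have sub : obox (- 4^-1, (0, 0)) (4^-1, (1, 1)) `<=` N.
  move=> p /oboxP[/= h _ _]; apply: PN => /= hp; apply: nex; exists p.
  have sp : slab p by rewrite /slab/thickness/=; lra.
  by split => //; exact: hp.
have : (volume (obox ((- 4^-1)%R, (0%R, 0%R)) (4^-1%R : R, (1%R, 1%R))) <= volume N)%E.
  by apply: le_measure => //; rewrite inE//; exact: measurable_obox.
rewrite (_ : volume N = 0%E)// volume_obox /=; [|lra|lra|lra].
by rewrite lee_fin; lra.
Qed.

(* A triple of functions of one variable, in the order x3, y1, y2, standing for
   their tensor product. *)
Let triple := ((R -> R) * (R -> R) * (R -> R))%type.

Definition tensor3 (t : triple) := tens t.1.1 t.1.2 t.2.

Definition dtriple (j : 'I_3) (t : triple) : triple :=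
  nth t [:: (t.1.1, derive1 t.1.2, t.2); (t.1.1, t.1.2, derive1 t.2);
            (derive1 t.1.1, t.1.2, t.2)] j.

Definition test_triple (t : triple) : Prop :=
  [/\ thin_bumps t.1.1, bumps t.1.2 & bumps t.2].

Lemma test_dtriple j t : test_triple t -> test_triple (dtriple j t).
Proof.
move=> [h1 h2 h3]; elim/ord3P: j; split => //=.
- exact: bumps_derive1.
- exact: bumps_derive1.
- exact: thin_bumps_derive1.
Qed.

(** Derivatives in distinct variables act on distinct factors, so symmetry of second derivatives
    holds by computation. *)
Lemma dtripleC i j t : dtriple i (dtriple j t) = dtriple j (dtriple i t).
Proof. by elim/ord3P: i; elim/ord3P: j. Qed.

Lemma test_tensor3 t : test_triple t -> test_function (tensor3 t).
Proof. by move=> [h1 h2 h3]; exact: test_tens. Qed.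

Lemma derive_tensor3 j t p : test_triple t ->
  'D_(dirs j) (tensor3 t) p = tensor3 (dtriple j t) p.
Proof.
move=> [[s1 _] [s2 _] [s3 _]]; elim/ord3P: j.
- exact: derive_tens_y1.
- exact: derive_tens_y2.
- exact: derive_tens_x3.
Qed.

Lemma pairing_partial j f g t : weak_partial (dirs j) f g -> test_triple t ->
  \int[volume]_(p in slab) (g p * tensor3 t p) =
  - \int[volume]_(p in slab) (f p * tensor3 (dtriple j t) p).
Proof.
move=> [_ h] gt; have := h _ (test_tensor3 gt).
under eq_Rintegral do rewrite derive_tensor3//.
by move=> ->; rewrite opprK.
Qed.

Lemma Rintegral_dtriple j t : test_triple t ->
  \int[volume]_(p in slab) tensor3 (dtriple j t) p = 0.
Proof.
move=> gt; have [h1 h2 h3] := test_dtriple j gt; rewrite /tensor3 Rintegral_tens//.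
case: gt {h1 h2 h3} => h1 h2 h3; elim/ord3P: j => /=.
- by rewrite (bumps_derive1_mean0 h2) mulr0 mul0r.
- by rewrite (bumps_derive1_mean0 h3) mulr0.
- by rewrite (bumps_derive1_mean0 (thin_bumpsW h1)) !mul0r.
Qed.

Lemma constant_of_flat3 g : L2loc g ->
  (forall j t, test_triple t -> \int[volume]_(p in slab) (g p * tensor3 (dtriple j t) p) = 0) ->
  exists k : R, {ae volume, forall p, slab p -> g p = k}.
Proof.
move=> Lg h; apply: constant_of_flat => // a b c ha hb hc.
have gt : test_triple (a, b, c) by split.
by split; [exact: (h i3 _ gt)|exact: (h i1 _ gt)|exact: (h i2 _ gt)].
Qed.

(** Countably many integer translates of the cell cover the slab, and a countable union of null sets
    is null. *)
Lemma cell_ae_slab (P : pt3 R -> Prop) :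
  {ae volume, forall p, cell p -> P p} ->
  (forall k1 k2 : int,
    {ae volume, forall p, slab p -> P (translate k1 k2 p) -> P p}) ->
  {ae volume, forall p, slab p -> P p}.
Proof.
move=> hc hper.
have h1 : {ae volume, forall p, forall k : int * int,
    slab p -> P (translate k.1 k.2 p) -> P p}.
  by apply: ae_volume_countable => -[k1 k2]; exact: hper.
have h2 : {ae volume, forall p, forall k : int * int,
    cell (translate k.1 k.2 p) -> P (translate k.1 k.2 p)}.
  apply: ae_volume_countable => -[k1 k2].
  exact: (preserving_ae (preserving_volume_yshift (k1%:~R : R) k2%:~R) hc).
apply: ae_volumeS (ae_volumeI h1 h2) => p [hp1 hp2] sp.
have [k1 [k2 ck]] := slab_translate_cell sp.
by apply: (hp1 (k1, k2)) => //; exact: (hp2 (k1, k2)).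
Qed.

Lemma embed_entry (N : 'M[R]_2) (i j : 'I_2) :
  embed N (lshift 1 i) (lshift 1 j) = N i j.
Proof. exact: (@block_mxEul R 2 1 2 1 N 0 0 0 i j). Qed.

Lemma embed_3 (N : 'M[R]_2) (i : 'I_3) : embed N i i3 = 0 /\ embed N i3 i = 0.
Proof.
have -> : i3 = rshift 2 (0 : 'I_1) by exact: val_inj.
have := splitP (i : 'I_(2 + 1)) => -[j ij|j ij].
  have -> : i = lshift 1 j by exact: val_inj.
  have := @block_mxEur R 2 1 2 1 N 0 0 0 j 0; rewrite [RHS in _ = RHS -> _]mxE => h1.
  have := @block_mxEdl R 2 1 2 1 N 0 0 0 0 j; rewrite [RHS in _ = RHS -> _]mxE => h2.
  by split.
have -> : i = rshift 2 j by exact: val_inj.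
have := @block_mxEdr R 2 1 2 1 N 0 0 0 0 j; rewrite [RHS in _ = RHS -> _]mxE => h1.
have := @block_mxEdr R 2 1 2 1 N 0 0 0 j 0; rewrite [RHS in _ = RHS -> _]mxE => h2.
by split.
Qed.

Lemma symE (A : 'M[R]_3) i j : sym A i j = 2^-1 * (A i j + A j i).
Proof. by rewrite /sym mxE mxE [A^T _ _]mxE. Qed.

(** N is kept as an unknown in-plane strain: a periodic field has no constant in-plane gradient that
    could compensate it. *)
Lemma rigid_motion gamma (N : 'M[R]_2) w : 0 < gamma -> N^T = N ->
  H1gamma gamma w ->
  {ae volume, forall p, cell p -> embed N + sym (nabla gamma w p) = 0} ->
  N = 0 /\ exists k : 'cV[R]_3, {ae volume, forall p, slab p -> w p = k}.
Proof.
move=> g0 NT Hw hcell; set W := nabla gamma w in hcell *.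
have hg : has_grad gamma w W := has_grad_nabla Hw.
have hs : {ae volume, forall p, slab p -> embed N + sym (W p) = 0}.
  apply: cell_ae_slab hcell _ => k1 k2.
  by apply: ae_volumeS (grad_translate k1 k2 Hw hg) => p h sp; rewrite h.
have [Lw hW] := hg.
have /choice [g' hg'] : forall ij : 'I_3 * 'I_3, exists g : pt3 R -> R,
    weak_partial (dirs ij.2) (component ij.1 w) g /\
    forall p, W p ij.1 ij.2 = scl gamma ij.2 * g p.
  by move=> [i j]; exact: (hW i j).
pose g i j := g' (i, j).
have wg i j : weak_partial (dirs j) (component i w) (g i j) by have [] := hg' (i, j).
have WE i j p : W p i j = scl gamma j * g i j p by have [] := hg' (i, j).
have Lg i j : L2loc (g i j) by have [] := wg i j.
(* The distributional second derivative of the k-th component in the directions i and j, tested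
   against t; the two integrations by parts cancel signs. *)
pose T k i j t := \int[volume]_(p in slab) (component k w p * tensor3 (dtriple i (dtriple j t)) p).
have TC k i j t : T k i j t = T k j i t by rewrite /T dtripleC.
have gT k j i t : test_triple t ->
    \int[volume]_(p in slab) (g k j p * tensor3 (dtriple i t) p) = - T k j i t.
  by move=> gt; rewrite (pairing_partial (wg k j))//; exact: test_dtriple.
(* The (k, j) entry of the strain equation says that a combination of first derivatives is the
   constant -2 N; its derivative in direction i is zero. *)
have symT k j i t : test_triple t ->
    scl gamma j * T k j i t + scl gamma k * T j k i t = 0.
  move=> gt; have gd := test_dtriple i gt; have tp := test_tensor3 gd.
  have := pairingZD (scl gamma j) (scl gamma k) (Lg k j) (Lg j k) tp.
  rewrite !gT// !mulrN -opprD => /esym/eqP; rewrite eqr_oppLR => /eqP ->.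
  apply/eqP; rewrite oppr_eq0; apply/eqP.
  have Lc := L2loc_cst (- (2 * embed N k j)).
  have LZ := L2locZD (scl gamma j) (scl gamma k) (Lg k j) (Lg j k).
  rewrite (@pairing_ae R _ (fun=> - (2 * embed N k j)) _ LZ.1 Lc.1 _ tp).
    rewrite RintegralZl//; first by rewrite Rintegral_dtriple// mulr0.
    have := integrable_test (L2loc_cst 1) tp.
    by apply: eq_integrable => // p _ /=; rewrite mul1r.
  apply: ae_volumeS hs => p hp /hp /matrixP /(_ k j).
  by rewrite mxE symE [RHS]mxE !WE; lra.
(* The weights restore the powers of 1/gamma, so that [tau] is symmetric in its last two indices and
   antisymmetric in its first two. *)
pose tau k i j t := scl gamma i * scl gamma j * T k i j t.
have tau0 k i j t : test_triple t -> tau k i j t = 0.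
  move=> gt.
  have tC a b c : tau a b c t = tau a c b t.
    by rewrite /tau TC [scl gamma b * _]mulrC.
  have tS a b c : tau a b c t = - tau b a c t.
    apply/eqP; rewrite -addr_eq0 /tau; apply/eqP.
    by rewrite -![_ * scl gamma c]mulrC -!mulrA -mulrDr symT// mulr0.
  (* Alternating the two swaps three times each returns to the initial order of indices with the
     sign (-1)^3. *)
  have : tau k i j t = - tau k i j t.
    rewrite {1}tS {1}tC {1}tS {1}tC {1}tS {1}tC.
    by rewrite !opprK.
  lra.
have T0 k i j t : test_triple t -> T k i j t = 0.
  move=> gt; have /eqP := tau0 k i j t gt; rewrite /tau !mulf_eq0.
  by rewrite !(negbTE (scl_neq0 _ g0))/= => /eqP.
have /choice [c' hc'] : forall ij : 'I_3 * 'I_3, exists c : R,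
    {ae volume, forall p, slab p -> g ij.1 ij.2 p = c}.
  move=> [k j]; apply: constant_of_flat3 => // i t gt.
  by rewrite gT// T0// oppr0.
pose c i j := c' (i, j).
have gc i j : {ae volume, forall p, slab p -> g i j p = c i j} := hc' (i, j).
have cy1 i : c i i1 = 0.
  apply: (constant_partial_y1 (Lw i) (wg i i1) _ (gc i i1)).
  exact: (@component_translate _ gamma w 1 0 i Hw).
have cy2 i : c i i2 = 0.
  apply: (constant_partial_y2 (Lw i) (wg i i2) _ (gc i i2)).
  exact: (@component_translate _ gamma w 0 1 i Hw).
have gcall : {ae volume, forall p, forall i j, slab p -> g i j p = c i j}.
  by apply: ae_volume_ord => i; apply: ae_volume_ord => j; exact: gc.
have alg i j : 2 * embed N i j + scl gamma j * c i j + scl gamma i * c j i = 0.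
  have [p [sp [h1 h2]]] := ae_slab_exists
    (ae_volumeS (fun p (h : _ /\ _) sp => conj (h.1 sp) (fun i j => h.2 i j sp))
      (ae_volumeI hs gcall)).
  have := h1 => /matrixP /(_ i j); rewrite mxE symE [RHS]mxE !WE !h2.
  lra.
have N0 : N = 0.
  apply/matrixP => i j; rewrite -embed_entry [RHS]mxE.
  have z (k : 'I_3) (l : 'I_2) : c k (lshift 1 l) = 0.
    case: l => -[|[|//]] hl.
    - by rewrite -(cy1 k); congr (c k _); exact: val_inj.
    - by rewrite -(cy2 k); congr (c k _); exact: val_inj.
  by have := alg (lshift 1 i) (lshift 1 j); rewrite !z !mulr0 !addr0; lra.
(* In the third column [embed N] vanishes: for i = 1, 2 the entry is tied to the vanishing c 3 i,
   and for i = 3 to itself. *)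
have c0 i j : c i j = 0.
  have s0 := scl_neq0 i3 g0.
  elim/ord3P: j; [exact: cy1|exact: cy2|].
  have := alg i i3; have [-> _] := embed_3 N i; rewrite mulr0 add0r.
  elim/ord3P: i.
  - by rewrite cy1 mulr0 addr0 => /eqP; rewrite mulf_eq0 (negbTE s0) => /eqP.
  - by rewrite cy2 mulr0 addr0 => /eqP; rewrite mulf_eq0 (negbTE s0) => /eqP.
  - move=> h; have /eqP : scl gamma i3 * c i3 i3 = 0 by lra.
    by rewrite mulf_eq0 (negbTE s0) => /eqP.
split => //.
have /choice [k hk] : forall i, exists k : R, {ae volume, forall p, slab p ->
    component i w p = k}.
  move=> i; apply: (constant_of_flat3 (Lw i)) => j t gt.
  have := pairing_partial (wg i j) gt => /esym/eqP; rewrite eqr_oppLR => /eqP ->.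
  have L0 := L2loc_cst (0 : R); have tp := test_tensor3 gt.
  rewrite (@pairing_ae R _ (fun=> 0) _ (Lg i j).1 L0.1 _ tp).
    by under eq_Rintegral do rewrite mul0r; rewrite Rintegral_cst// mul0r oppr0.
  by apply: ae_volumeS (gc i j) => p h /h ->.
exists (\col_i k i).
apply: ae_volumeS (ae_volume_ord hk) => p hp sp.
by apply/colP => i; rewrite mxE -(hp i sp).
Qed.

End Rigidity.

(** * The isotropic energy *)

Section IsotropicForms.
Context {R : realType}.
Implicit Types (A B : 'M[R]_3).

Definition isotropic_form (l m : R) A : R :=
  l * (\tr A) ^+ 2 + 2 * m * sqnorm (sym A).

Lemma symD A B : sym (A + B) = sym A + sym B.
Proof. by apply/matrixP => i j; rewrite symE [RHS]mxE !symE !mxE; ring. Qed.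

Lemma symZ (c : R) A : sym (c *: A) = c *: sym A.
Proof. by apply/matrixP => i j; rewrite symE [RHS]mxE !symE !mxE; ring. Qed.

Lemma symB A B : sym (A - B) = sym A - sym B.
Proof. by rewrite -scaleN1r symD symZ scaleN1r. Qed.

Lemma sym_id A : A^T = A -> sym A = A.
Proof.
move=> AT; apply/matrixP => i j; rewrite symE.
have -> : A j i = A i j by rewrite -{1}AT mxE.
lra.
Qed.

Lemma sqnormZ (c : R) A : sqnorm (c *: A) = c ^+ 2 * sqnorm A.
Proof.
rewrite !sqnormE mulr_sumr; apply: eq_bigr => i _.
by rewrite mulr_sumr; apply: eq_bigr => j _; rewrite mxE exprMn.
Qed.

Lemma sqnorm_parallelogram A B :
  sqnorm (A + B) + sqnorm (A - B) = 2 * sqnorm A + 2 * sqnorm B.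
Proof.
rewrite !sqnormE -big_split/= !mulr_sumr -big_split/=; apply: eq_bigr => i _.
rewrite -big_split/= !mulr_sumr -big_split/=; apply: eq_bigr => j _.
by rewrite !mxE; ring.
Qed.

Lemma isotropic_formZ l m (c : R) A :
  isotropic_form l m (c *: A) = c ^+ 2 * isotropic_form l m A.
Proof. by rewrite /isotropic_form symZ sqnormZ mxtraceZ; ring. Qed.

Lemma isotropic_form_parallelogram l m A B :
  isotropic_form l m (A + B) + isotropic_form l m (A - B) =
  2 * isotropic_form l m A + 2 * isotropic_form l m B.
Proof.
have := sqnorm_parallelogram (sym A) (sym B).
rewrite /isotropic_form symD symB mxtraceD linearB/= => h.
have -> : sqnorm (sym A + sym B) =
  2 * sqnorm (sym A) + 2 * sqnorm (sym B) - sqnorm (sym A - sym B) by rewrite -h; ring.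
ring.
Qed.

(** Conjugation by the diagonal matrix with entries e. *)
Definition sign_conj (e : 'I_3 -> R) A : 'M[R]_3 := \matrix_(i, j) (e i * e j * A i j).

Lemma isotropic_form_sign_conj l m (e : 'I_3 -> R) A : signs e ->
  isotropic_form l m (sign_conj e A) = isotropic_form l m A.
Proof.
move=> se; have e2 i : e i * e i = 1 by case: (se i) => ->; ring.
rewrite /isotropic_form; congr (_ * _ ^+ 2 + _ * _).
  by rewrite /mxtrace; apply: eq_bigr => i _; rewrite /sign_conj mxE e2 mul1r.
rewrite !sqnormE; apply: eq_bigr => i _; apply: eq_bigr => j _.
have eij : (e i * e j) ^+ 2 = 1 by rewrite exprMn !expr2 !e2 mulr1.
rewrite !symE /sign_conj !mxE.
have -> : 2^-1 * (e i * e j * A i j + e j * e i * A j i) =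
  e i * e j * (2^-1 * (A i j + A j i)) by ring.
by rewrite exprMn eij mul1r.
Qed.

Lemma embedD (N M : 'M[R]_2) : embed (N + M) = embed N + embed M.
Proof. by rewrite /embed (@add_block_mx _ 2 1 2 1) !addr0. Qed.

Lemma embedZ (c : R) (N : 'M[R]_2) : embed (c *: N) = c *: embed N.
Proof. by rewrite /embed (@scale_block_mx _ 2 1 2 1) !scaler0. Qed.

Lemma embedT (N : 'M[R]_2) : (embed N)^T = embed N^T.
Proof. by rewrite /embed (@tr_block_mx _ 2 1 2 1) !trmx0. Qed.

Lemma symT A : (sym A)^T = sym A.
Proof. by apply/matrixP => i j; rewrite mxE !symE addrC. Qed.

End IsotropicForms.

Section Energy.
Context {R : realType}.
Context (gamma alpha beta : R) (Q : pt3 R -> 'M[R]_3 -> R) (lambda mu : R -> R -> R).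
Context (gamma_gt0 : 0 < gamma) (alpha_gt0 : 0 < alpha).
Context (Qborel : borel_on_slab Q).
Context (Qbounds : {ae volume, forall p, slab p -> quadratic_class alpha beta (Q p)}).
Context (QE : forall (x3 y1 y2 : R) (G : 'M[R]_3), thickness x3 ->
       Q (x3, (y1, y2)) G =
         lambda x3 y1 * (\tr G) ^+ 2 + 2 * mu x3 y1 * sqnorm (sym G)).
Implicit Types (S : pt3 R -> 'M[R]_3) (G M : 'M[R]_2) (phi : pt3 R -> 'cV[R]_3).

Definition lam_at (p : pt3 R) : R := lambda p.1 p.2.1.
Definition mu_at (p : pt3 R) : R := mu p.1 p.2.1.

Lemma Q_isotropic p A : slab p -> Q p A = isotropic_form (lam_at p) (mu_at p) A.
Proof. by case: p => x3 [y1 y2] sp; exact: QE. Qed.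

(** The hypothesis concerns Borel sets in points and matrices jointly. Sets whose section at A is
    measurable form a sigma-algebra, and it contains the open sets because p |-> (p, A) is
    continuous. *)
Lemma measurable_Q A : measurable_fun slab (fun p => Q p A).
Proof.
move=> _ B mB.
pose H := [set Z : set (pt3 R * 'M[R]_3) | measurable [set p : pt3 R | Z (p, A)]].
have sH : sigma_algebra setT H.
  split.
  - by rewrite /H/=; exact: measurable0.
  - move=> Z HZ; rewrite /H/=.
    rewrite (_ : mkset _ = ~` [set p | Z (p, A)]); first exact: measurableC.
    by apply/seteqP; split => p /=; [case|].
  - move=> F HF; rewrite /H/=.
    rewrite (_ : mkset _ = \bigcup_n [set p | F n (p, A)]).
      exact: bigcupT_measurable.
    by apply/seteqP; split.
have sub : [set U : set (pt3 R * 'M[R]_3) | open U] `<=` H.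
  move=> U oU; change (measurable [set p : pt3 R | U (p, A)]).
  apply: open_pt3_measurable.
  have c : continuous (fun p : pt3 R => (p, A)).
    by apply: continuous_pair => p; [exact: cvg_id|exact: cvg_cst].
  exact: (open_comp _ oU).
exact: (smallest_sub sH sub (Qborel mB)).
Qed.

Lemma measurable_mu : measurable_fun slab mu_at.
Proof.
(* This matrix has zero trace and squared norm 2, so Q takes the value 4 mu at it. *)
pose A : 'M[R]_3 := delta_mx i1 i2 + delta_mx i2 i1.
have mQ := measurable_Q A.
have : measurable_fun slab (fun p => 4^-1 * Q p A).
  by apply: measurable_funM => //; exact: measurable_cst.
apply: eq_measurable_fun => p; rewrite inE => sp.
rewrite Q_isotropic// /isotropic_form sqnormE /mxtrace !big_ord_recl !big_ord0.
rewrite !symE !mxE /=; lra.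
Qed.

Lemma measurable_lam : measurable_fun slab lam_at.
Proof.
(* Q takes the value lambda + 2 mu at this matrix. *)
pose A : 'M[R]_3 := delta_mx i1 i1.
have mQ := measurable_Q A.
have : measurable_fun slab (fun p => Q p A - 2 * mu_at p).
  apply: measurable_funB => //; apply: measurable_funM; first exact: measurable_cst.
  exact: measurable_mu.
apply: eq_measurable_fun => p; rewrite inE => sp.
rewrite Q_isotropic// /isotropic_form sqnormE /mxtrace !big_ord_recl !big_ord0.
rewrite !symE !mxE /=; lra.
Qed.

Lemma measurable_energy S : (forall i j, measurable_fun slab (fun p => S p i j)) ->
  measurable_fun slab (fun p => Q p (S p)).
Proof.
move=> mS.
have m1 : measurable_fun slab (fun p => \tr (S p)).
  by apply: measurable_sum => i.
have m2 : measurable_fun slab (fun p => sqnorm (sym (S p))).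
  apply: measurable_sqnorm => i j; under eq_fun do rewrite symE.
  apply: measurable_funM; first exact: measurable_cst.
  exact: measurable_funD.
have : measurable_fun slab (fun p => isotropic_form (lam_at p) (mu_at p) (S p)).
  apply: measurable_funD; apply: measurable_funM => //.
  - exact: measurable_lam.
  - exact: measurable_funX.
  - by apply: measurable_funM; [exact: measurable_cst|exact: measurable_mu].
by apply: eq_measurable_fun => p; rewrite inE => sp; rewrite Q_isotropic.
Qed.

Lemma Q_bounds : {ae volume, forall p, slab p -> forall A,
  alpha * sqnorm (sym A) <= Q p A <= beta * sqnorm (sym A)}.
Proof. by apply: ae_volumeS Qbounds => p h /h[]. Qed.

Definition energy S : R := \int[volume]_(p in cell) Q p (S p).

Definition L2field S : Prop := forall i j, L2cell (fun p => S p i j).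

Lemma L2fieldZD (s t : R) S S' : L2field S -> L2field S' ->
  L2field (fun p => s *: S p + t *: S' p).
Proof.
move=> LS LS' i j; have := L2cellZD s t (LS i j) (LS' i j); congr L2cell.
by apply/funext => p; rewrite !mxE.
Qed.

Lemma L2field_sym S : L2field S -> L2field (fun p => sym (S p)).
Proof.
move=> LS i j; have := L2cellZD 2^-1 2^-1 (LS i j) (LS j i); congr L2cell.
by apply/funext => p; rewrite symE mulrDr.
Qed.

Lemma L2field_measurable S i j : L2field S -> measurable_fun slab (fun p => S p i j).
Proof. by move=> /(_ i j)[]. Qed.

Lemma integrable_energy S : L2field S ->
  volume.-integrable cell (EFin \o (fun p => Q p (S p))).
Proof.
move=> LS; have mQ := measurable_energy (fun i j => L2field_measurable i j LS).
have I := integrable_sqnorm (L2field_sym LS).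
have /integrableP[mg] := integrableZl measurable_cell beta I.
set b := integral _ _ _ => fin.
apply/integrableP; split.
  by apply/measurable_EFinP; exact: measurable_fun_cell.
apply: le_lt_trans fin; apply: ae_ge0_le_integral => //.
- apply: measurableT_comp => //; apply/measurable_EFinP; exact: measurable_fun_cell.
- exact: measurableT_comp.
- apply: ae_volumeS Q_bounds => p h /cell_slab/h {}h.
  rewrite /= lee_fin; have /andP[h1 h2] := h (S p).
  rewrite ger0_norm; first by apply: le_trans h2 _; exact: ler_norm.
  by apply: le_trans h1; rewrite mulr_ge0 ?sqnorm_ge0// ltW.
Qed.

Lemma energy_ae S S' : (forall i j, measurable_fun slab (fun p => S p i j)) ->
  (forall i j, measurable_fun slab (fun p => S' p i j)) ->
  {ae volume, forall p, cell p -> S p = S' p} -> energy S = energy S'.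
Proof.
move=> mS mS' h; apply: ae_eq_Rintegral => //.
- by apply: measurable_fun_cell; exact: measurable_energy.
- by apply: measurable_fun_cell; exact: measurable_energy.
- by apply: ae_volumeS h => p hp /hp ->.
Qed.

Lemma energy_ge0 S : L2field S -> 0 <= energy S.
Proof.
move=> LS; have mQ := measurable_energy (fun i j => L2field_measurable i j LS).
(* The lower bound holds only almost everywhere, so the integrand is replaced by its absolute value,
   which is nonnegative at every point. *)
rewrite /energy (@ae_eq_Rintegral _ _ R volume cell _ (fun p => `|Q p (S p)|))//.
- by apply: Rintegral_ge0 => p _.
- exact: measurable_fun_cell.
- by apply: measurableT_comp => //; exact: measurable_fun_cell.
- apply: ae_volumeS Q_bounds => p h /cell_slab/h {}h; rewrite ger0_norm//.
  have /andP[h1 _] := h (S p).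
  by apply: le_trans h1; rewrite mulr_ge0 ?sqnorm_ge0// ltW.
Qed.

Lemma energyZ (c : R) S : L2field S -> energy (fun p => c *: S p) = c ^+ 2 * energy S.
Proof.
move=> LS; rewrite -RintegralZl//; last exact: integrable_energy.
apply: eq_Rintegral => p; rewrite inE => /cell_slab sp.
by rewrite !Q_isotropic// isotropic_formZ.
Qed.

Lemma energy_parallelogram S S' : L2field S -> L2field S' ->
  energy (fun p => S p + S' p) + energy (fun p => S p - S' p) =
  2 * energy S + 2 * energy S'.
Proof.
move=> LS LS'.
have LD : L2field (fun p => S p + S' p).
  have := L2fieldZD 1 1 LS LS'; congr L2field.
  by apply/funext => p; rewrite !scale1r.
have LB : L2field (fun p => S p - S' p).
  have := L2fieldZD 1 (-1) LS LS'; congr L2field.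
  by apply/funext => p; rewrite scale1r scaleN1r.
have := Rintegral_cellZD 1 1 (integrable_energy LD) (integrable_energy LB).
have := Rintegral_cellZD 2 2 (integrable_energy LS) (integrable_energy LS').
rewrite -!/(energy _) !mul1r => <- <-.
apply: eq_Rintegral => p; rewrite inE => /cell_slab sp.
by rewrite !Q_isotropic// !mul1r isotropic_form_parallelogram.
Qed.

(** Pythagoras for the bilinear form of the energy; integrability of the three energies allows the
    tensor integral to be split. *)
Lemma energy_tensor S S' : L2field S -> L2field S' ->
  \int[volume]_(p in cell) tensor (Q p) (S p) (S' p) = 0 ->
  energy (fun p => S p + S' p) = energy S + energy S'.
Proof.
move=> LS LS'.
have LD : L2field (fun p => S p + S' p).
  have := L2fieldZD 1 1 LS LS'; congr L2field.
  by apply/funext => p; rewrite !scale1r.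
have I := integrable_cellZD 1 1 (integrable_energy LS) (integrable_energy LS').
have := Rintegral_cellZD 2^-1 (- 2^-1) (integrable_energy LD) I.
rewrite (Rintegral_cellZD 1 1 (integrable_energy LS) (integrable_energy LS')).
rewrite -!/(energy _) => h.
have -> : \int[volume]_(p in cell) tensor (Q p) (S p) (S' p) =
  2^-1 * energy (fun p => S p + S' p) + - 2^-1 * (1 * energy S + 1 * energy S').
  by rewrite -h; apply: eq_Rintegral => p _; rewrite /tensor; ring.
lra.
Qed.

(** Coercivity controls the symmetric part alone, hence the conclusion about [sym (S p)]. *)
Lemma energy_eq0 S : L2field S -> energy S = 0 ->
  {ae volume, forall p, cell p -> sym (S p) = 0}.
Proof.
move=> LS E0; have mQ := measurable_energy (fun i j => L2field_measurable i j LS).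
have I := integrable_energy LS.
have mc : measurable_fun cell (fun p => (Q p (S p))%:E).
  by apply/measurable_EFinP; exact: measurable_fun_cell.
have h : (\int[volume]_(p in cell) `|(Q p (S p))%:E| = 0)%E.
  rewrite (ae_eq_integral (fun p => (Q p (S p))%:E))//.
  - rewrite -[LHS]fineK; last exact: integrable_fin_num.
    by rewrite -/(Rintegral _ _ _) -/(energy S) E0.
  - exact: measurableT_comp.
  - apply: ae_volumeS Q_bounds => p hp /cell_slab/hp {}hp.
    rewrite /= ger0_norm//; have /andP[h1 _] := hp (S p).
    by apply: le_trans h1; rewrite mulr_ge0 ?sqnorm_ge0// ltW.
have {}h := (iffLR (ae_eq_integral_abs volume measurable_cell mc)) h.
apply: ae_volumeS (ae_volumeI Q_bounds h) => p [hb hz] cp.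
have /andP[h1 _] := hb (cell_slab cp) (S p).
have [Q0] := hz cp; rewrite Q0 in h1.
have n0 : sqnorm (sym (S p)) <= 0 by rewrite -(pmulr_rle0 _ alpha_gt0).
apply/matrixP => i j; rewrite [RHS]mxE; apply/eqP; rewrite -sqrf_eq0 eq_le sqr_ge0 andbT.
exact: le_trans (sqnorm_entry _ _ _) n0.
Qed.

Lemma L2cell_x3 : L2cell (fun p : pt3 R => p.1).
Proof.
have m1 : measurable_fun slab (fun p : pt3 R => p.1).
  by apply: measurable_funTS; exact: measurable_fst.
split => //.
have [_ I] := L2cell_cst (1 : R).
apply: (le_integrable_cell _ I); first exact: measurable_funX.
by move=> p [/andP[h1 h2] _ _]; rewrite sqr_ge0/=; nra.
Qed.

Lemma L2field_strain G M phi : H1gamma gamma phi -> L2field (strain gamma G M phi).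
Proof.
move=> H i j; have [_ LW] := H1gamma_L2cell H.
have h1 := L2cellZD (embed G i j) (embed M i j) L2cell_x3 (L2cell_cst 1).
have := L2cellZD 1 1 h1 (L2field_sym LW i j); congr L2cell.
apply/funext => p; rewrite /strain embedD embedZ.
rewrite [RHS]mxE [X in _ = X + _]mxE [X in _ = X + _ + _]mxE; ring.
Qed.

Lemma strainZD (s t : R) G G' M M' phi phi' : H1gamma gamma phi -> H1gamma gamma phi' ->
  {ae volume, forall p, slab p ->
    strain gamma (s *: G + t *: G') (s *: M + t *: M') (fun p => s *: phi p + t *: phi' p) p
    = s *: strain gamma G M phi p + t *: strain gamma G' M' phi' p}.
Proof.
move=> H H'.
have hg := has_gradZD s t (has_grad_nabla H) (has_grad_nabla H').
apply: ae_volumeS (nabla_ae (H1gammaZD s t H H') hg) => p hp sp.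
rewrite /strain (hp sp) symD !symZ !embedD !embedZ !embedD !embedZ.
move: (embed G) (embed G') (embed M) (embed M') (sym _) (sym _) => a b c d e f.
by apply/matrixP => i j; rewrite !mxE; ring.
Qed.

Lemma energy_strainZD (s t : R) G G' M M' phi phi' :
  H1gamma gamma phi -> H1gamma gamma phi' ->
  energy (strain gamma (s *: G + t *: G') (s *: M + t *: M')
    (fun p => s *: phi p + t *: phi' p)) =
  energy (fun p => s *: strain gamma G M phi p + t *: strain gamma G' M' phi' p).
Proof.
move=> H H'; apply: energy_ae.
- by move=> i j; apply: L2field_measurable; apply: L2field_strain; exact: H1gammaZD.
- by move=> i j; apply: L2field_measurable; apply: L2fieldZD; exact: L2field_strain.
- by apply: ae_volumeS (strainZD s t G G' M M' H H') => p h /cell_slab/h.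
Qed.

Lemma energy_strainD G G' M M' phi phi' :
  H1gamma gamma phi -> H1gamma gamma phi' ->
  energy (strain gamma (G + G') (M + M') (fun p => phi p + phi' p)) =
  energy (fun p => strain gamma G M phi p + strain gamma G' M' phi' p).
Proof.
move=> H H'; have := energy_strainZD 1 1 G G' M M' H H'.
have E3 (f f' : pt3 R -> 'M[R]_3) : (fun p => 1 *: f p + 1 *: f' p) = (fun p => f p + f' p).
  by apply/funext => p; rewrite !scale1r.
have E1 (f f' : pt3 R -> 'cV[R]_3) : (fun p => 1 *: f p + 1 *: f' p) = (fun p => f p + f' p).
  by apply/funext => p; rewrite !scale1r.
by rewrite (E3 (strain gamma G M phi) (strain gamma G' M' phi')) (E1 phi phi') !scale1r.
Qed.

Lemma L2cell_integrable (f : pt3 R -> R) : L2cell f ->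
  volume.-integrable cell (EFin \o f).
Proof.
move=> [mf If]; have [_ I1] := L2cell_cst (1 : R).
have I := integrable_cellZD 1 1 If I1.
apply: (@le_integrable _ _ _ volume cell measurable_cell _
  (EFin \o (fun p => 1 * f p ^+ 2 + 1 * 1 ^+ 2))) => //.
  by apply/measurable_EFinP; exact: measurable_fun_cell.
move=> p _; rewrite /= lee_fin !mul1r expr1n [leRHS]ger0_norm ?addr_ge0 ?sqr_ge0//.
by rewrite -real_normK ?num_real//; have := sqr_ge0 (`|f p| - 1); nra.
Qed.

Lemma volume_cell_gt0 : 0 < fine (volume (@cell R)).
Proof.
have fin : volume (@cell R) \is a fin_num by rewrite ge0_fin_numE ?volume_cell.
rewrite -lte_fin fineK//.
apply: (@lt_le_trans _ _ (volume (obox ((- 4^-1)%R, (0%R, 0%R)) (4^-1%R : R, (4^-1%R, 4^-1%R))))).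
  by rewrite volume_obox /=; [rewrite lte_fin; nra|lra|lra|lra].
apply: le_measure; rewrite ?inE//; first exact: measurable_obox.
by move=> p /oboxP[/= h1 h2 h3]; rewrite /cell/thickness/half_open_cell/=; split; lra.
Qed.

(** The difference of the two pairs is a variation allowed in the Euler-Lagrange equation of the
    first, so energies add and the difference has energy zero. Of phi' only the energy enters, which
    suits pulled-back fields. *)
Lemma corrector_unique G M phi M' phi' : corrector gamma Q G M phi ->
  M'^T = M' -> H1gamma gamma phi' ->
  (forall i, \int[volume]_(p in cell) component i phi' p = 0) ->
  energy (strain gamma G M' phi') = energy (strain gamma G M phi) ->
  M' = M /\ {ae volume, forall p, slab p -> phi' p = phi p}.
Proof.
move=> [MT H mean EL] MT' H' mean' EE.
pose w p := 1 *: phi' p + -1 *: phi p.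
pose N := M' - M.
have Hw : H1gamma gamma w by exact: H1gammaZD.
have NT : N^T = N by rewrite /N linearB/= MT MT'.
pose S := strain gamma G M phi.
pose D p := embed N + sym (nabla gamma w p).
have LS : L2field S by exact: L2field_strain.
have DE : D = strain gamma 0 N w.
  by apply/funext => p; rewrite /D /strain scaler0 add0r.
have LD : L2field D by rewrite DE; exact: L2field_strain.
have hT := energy_tensor LS LD (EL N w NT Hw).
have hS : energy (fun p => S p + D p) = energy (strain gamma G M' phi').
  have := energy_strainD G 0 M N H Hw; rewrite -DE -/S => <-.
  have EM : M + N = M' by rewrite /N addrC subrK.
  have Ephi : (fun p => phi p + w p) = phi'.
    by apply/funext => p; rewrite /w scale1r scaleN1r addrC subrK.
  exact: (f_equal3 (fun a b c => energy (strain gamma a b c)) (addr0 G) EM Ephi).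
have D0 : energy D = 0.
  by apply: (addrI (energy S)); rewrite addr0; exact: etrans (esym hT) (etrans hS EE).
have h : {ae volume, forall p, cell p -> embed N + sym (nabla gamma w p) = 0}.
  have DT p : (D p)^T = D p.
    have eN := embedT N; rewrite NT in eN; have eS := symT (nabla gamma w p).
    rewrite /D; move: (sym _) eS (embed N) eN => F eF E eE.
    by rewrite linearD/= eE eF.
  by apply: ae_volumeS (energy_eq0 LD D0) => p hp /hp <-; exact: esym (sym_id (DT p)).
have [N0 [k hk]] := rigid_motion gamma_gt0 NT Hw h.
split; first by apply/eqP; rewrite -subr_eq0; apply/eqP.
have Ic := L2cell_integrable.
(* Both fields have zero mean over the cell, hence so has their constant difference. *)
have k0 : k = 0.
  apply/colP => i; rewrite [RHS]mxE.
  have [Lc _] := H1gamma_L2cell H; have [Lc' _] := H1gamma_L2cell H'.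
  have [Lw _] := H1gamma_L2cell Hw.
  have : \int[volume]_(p in cell) component i w p = 0.
    have := Rintegral_cellZD 1 (-1) (Ic _ (Lc' i)) (Ic _ (Lc i)).
    rewrite mean mean' !mulr0 addr0 => <-; apply: eq_Rintegral => p _.
    by rewrite /component /w; move: (phi' p) (phi p) => a b; rewrite !mxE.
  have wk : \int[volume]_(p in cell) component i w p = \int[volume]_(p in @cell R) k i 0.
    apply: ae_eq_Rintegral; [exact: measurable_cell|..|].
    - by apply: measurable_fun_cell; case: (Lw i).
    - exact: measurable_cst.
    - by apply: ae_volumeS hk => p hp /cell_slab/hp; rewrite /component => ->.
  rewrite wk (Rintegral_cst volume measurable_cell) => /eqP.
  by rewrite mulf_eq0 (gt_eqF volume_cell_gt0) orbF => /eqP.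
apply: ae_volumeS hk => p hp /hp; rewrite k0 /w scale1r scaleN1r => /eqP.
by rewrite subr_eq0 => /eqP.
Qed.

End Energy.

(** * Symmetries of the slab *)

Section Symmetries.
Context {R : realType}.
Implicit Types (T L : pt3 R -> pt3 R) (e s eta : 'I_3 -> R) (c : R).

(* Acting on fields by [p |-> eta (phi (T p))], with [eta] and the derivative [L]
   of [T] diagonal, multiplies the strain by [c] and conjugates it by [e]. *)
Record slab_symmetry T T' L L' eta s e c : Prop := SlabSymmetry {
  sym_iso : slab_iso T T' L L';
  sym_cell : cell_invariant T;
  sym_dirs : forall j, L (dirs j) = s j *: dirs j;
  sym_s : signs s;
  sym_e : signs e;
  sym_c : c ^+ 2 = 1;
  sym_compat : forall i j, eta i * s j = c * (e i * e j);
  sym_translate : forall k1 k2 : int, exists l1 l2 : int,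
    forall p, T (translate k1 k2 p) = translate l1 l2 (T p) }.

Definition signed_pullback T eta (phi : pt3 R -> 'cV[R]_3) (p : pt3 R) : 'cV[R]_3 :=
  \col_i (eta i * phi (T p) i 0).

Lemma sym_sign_conj e (A : 'M[R]_3) : sym (sign_conj e A) = sign_conj e (sym A).
Proof.
by apply/matrixP => i j; rewrite symE /sign_conj [RHS]mxE symE !mxE; ring.
Qed.

Lemma sign_conjD e (A B : 'M[R]_3) :
  sign_conj e (A + B) = sign_conj e A + sign_conj e B.
Proof. by apply/matrixP => i j; rewrite /sign_conj !mxE mulrDr. Qed.

Section Pullback.
Context (gamma : R) (T T' L L' : pt3 R -> pt3 R) (eta s e : 'I_3 -> R) (c : R).
Context (S : slab_symmetry T T' L L' eta s e c).
Implicit Types (phi : pt3 R -> 'cV[R]_3) (f : pt3 R -> R) (G M : 'M[R]_2).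

Lemma L2cell_pullback f (a : R) : L2cell f ->
  {ae volume, forall p, slab p -> f (translate 0 1 p) = f p} ->
  L2cell (fun p => a * f (T p)).
Proof.
move=> [mf If] per.
have mfT : measurable_fun slab (f \o T) by exact: (measurable_fun_iso (sym_iso S)).
suff LT : L2cell (f \o T).
  have := L2cellZD a 0 LT LT; congr L2cell.
  by apply/funext => p /=; rewrite mul0r addr0.
split => //; apply/integrable_cell_ge0; first exact: measurable_funX.
  by move=> p; exact: sqr_ge0.
have mf2 : measurable_fun slab (fun p => f p ^+ 2) by exact: measurable_funX.
have := iffRL (integrable_cell_ge0 mf2 (fun p => sqr_ge0 (f p))) If.
have iT : cell_invariant T := sym_cell S.
have mE : measurable_fun slab (fun p => (f p ^+ 2)%:E) by exact/measurable_EFinP.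
have pE : {ae volume, forall p, slab p -> (f (translate 0 1 p) ^+ 2)%:E = (f p ^+ 2)%:E}.
  by apply: ae_volumeS per => p h /h ->.
by rewrite (iT _ mE pE).
Qed.

Lemma has_grad_pullback phi W : has_grad gamma phi W ->
  has_grad gamma (signed_pullback T eta phi) (fun p => c *: sign_conj e (W (T p))).
Proof.
move=> h; have := has_grad_iso eta (sym_iso S) (sym_s S) (sym_dirs S) h.
congr (has_grad _ _ _); apply/funext => p; apply/matrixP => i j.
by rewrite /sign_conj !mxE (sym_compat S); ring.
Qed.

Lemma H1gamma_pullback phi : H1gamma gamma phi -> H1gamma gamma (signed_pullback T eta phi).
Proof.
move=> H; have hg := has_grad_nabla H; have [Lc LW] := H1gamma_L2cell H.
apply: (H1gamma_intro (has_grad_pullback hg)).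
- move=> k1 k2; have [l1 [l2 TE]] := sym_translate S k1 k2.
  have [_ /(_ l1 l2) per _] := H.
  apply: ae_volumeS (ae_slab_iso (sym_iso S) per) => p h sp.
  by apply/colP => i; rewrite !mxE TE h.
- move=> i; rewrite (_ : component i _ = fun p => eta i * component i phi (T p)).
    apply: L2cell_pullback => //.
    have [_ /(_ 0 1) per _] := H.
    by apply: ae_volumeS per => p h sp; rewrite /component h.
  by apply/funext => p; rewrite /component mxE.
- move=> i j; rewrite (_ : (fun p => _) =
     fun p => c * (e i * e j) * nabla gamma phi (T p) i j).
    apply: (@L2cell_pullback (fun p => nabla gamma phi p i j)) => //.
    by apply: ae_volumeS (grad_translate 0 1 H hg) => p h sp; rewrite h.
  by apply/funext => p; rewrite /sign_conj; move: (nabla _ _ _) => A; rewrite !mxE mulrA.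
Qed.

Lemma strain_pullback G M G' M' phi : H1gamma gamma phi ->
  (forall p : pt3 R, embed ((p.1 : R) *: G' + M') =
    c *: sign_conj e (embed (((T p).1 : R) *: G + M))) ->
  {ae volume, forall p, slab p ->
    strain gamma G' M' (signed_pullback T eta phi) p =
    c *: sign_conj e (strain gamma G M phi (T p))}.
Proof.
move=> H GM; have hg := has_grad_nabla H.
apply: ae_volumeS (nabla_ae (H1gamma_pullback H) (has_grad_pullback hg)) => p h sp.
rewrite /strain GM h// symZ sym_sign_conj -scalerDr.
by congr (_ *: _); rewrite sign_conjD.
Qed.

Lemma mean_pullback phi i : H1gamma gamma phi ->
  \int[volume]_(p in cell) component i phi p = 0 ->
  \int[volume]_(p in cell) component i (signed_pullback T eta phi) p = 0.
Proof.
move=> H m0; have [Lc _] := H1gamma_L2cell H.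
have per : {ae volume, forall p, slab p ->
    component i phi (translate 0 1 p) = component i phi p}.
  have [_ /(_ 0 1) per _] := H.
  by apply: ae_volumeS per => p h sp; rewrite /component h.
have LT := L2cell_pullback 1 (Lc i) per.
have := m0; rewrite (cell_invariant_Rintegral (sym_cell S))//; last by case: (Lc i).
move=> z; rewrite -[RHS](mulr0 (eta i)) -[in RHS]z -RintegralZl//.
  by apply: eq_Rintegral => p _; rewrite /component mxE.
have := L2cell_integrable LT; apply: eq_integrable => // p _.
by rewrite /= mul1r.
Qed.

End Pullback.

Section PullbackEnergy.
Context (gamma alpha beta : R) (Q : pt3 R -> 'M[R]_3 -> R) (lambda mu : R -> R -> R).
Context (Qborel : borel_on_slab Q).
Context (QE : forall (x3 y1 y2 : R) (G : 'M[R]_3), thickness x3 ->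
       Q (x3, (y1, y2)) G =
         lambda x3 y1 * (\tr G) ^+ 2 + 2 * mu x3 y1 * sqnorm (sym G)).
Context (T T' L L' : pt3 R -> pt3 R) (eta s e : 'I_3 -> R) (c : R).
Context (S : slab_symmetry T T' L L' eta s e c).
Context (coef : {ae volume, forall p, cell p ->
  lam_at lambda (T p) = lam_at lambda p /\ mu_at mu (T p) = mu_at mu p}).
Implicit Types (phi : pt3 R -> 'cV[R]_3) (G M : 'M[R]_2).

Lemma energy_pullback G M G' M' phi : H1gamma gamma phi ->
  (forall p : pt3 R, embed ((p.1 : R) *: G' + M') =
    c *: sign_conj e (embed (((T p).1 : R) *: G + M))) ->
  energy Q (strain gamma G' M' (signed_pullback T eta phi)) =
  energy Q (strain gamma G M phi).
Proof.
move=> H GM; have H' := H1gamma_pullback S H.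
have mS (G0 M0 : 'M[R]_2) phi0 : H1gamma gamma phi0 ->
    measurable_fun slab (fun p => Q p (strain gamma G0 M0 phi0 p)).
  move=> H0; apply: (measurable_energy Qborel QE) => i j.
  exact: (L2field_measurable i j (L2field_strain G0 M0 H0)).
(* The integrand has period 1 in y2 since the coefficients do not depend on y2 and the gradient is
   periodic. *)
have per : {ae volume, forall p, slab p ->
    Q (translate 0 1 p) (strain gamma G M phi (translate 0 1 p)) =
    Q p (strain gamma G M phi p)}.
  apply: ae_volumeS (grad_translate 0 1 H (has_grad_nabla H)) => p h sp.
  rewrite (Q_isotropic QE)// (Q_isotropic QE)//.
  rewrite (_ : strain gamma G M phi (translate 0 1 p) = strain gamma G M phi p).
    by rewrite /lam_at /mu_at /= addr0.
  by rewrite /strain h.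
rewrite /energy [RHS](cell_invariant_Rintegral (sym_cell S))//; last exact: mS.
apply: ae_eq_Rintegral => //.
- by apply: measurable_fun_cell; exact: mS.
- apply: measurable_fun_cell.
  exact: (measurable_fun_iso (sym_iso S) (mS G M phi H)).
- apply: ae_volumeS (ae_volumeI coef (strain_pullback S H GM)) => p [hc hs] cp.
  have sp := cell_slab cp; have [l1 m1] := hc cp.
  have sT : slab (T p) by apply/(iso_slab (sym_iso S)).
  rewrite hs// (Q_isotropic QE)// (Q_isotropic QE _ sT) l1 m1.
  by rewrite isotropic_formZ (sym_c S) mul1r (isotropic_form_sign_conj _ _ _ (sym_e S)).
Qed.

End PullbackEnergy.

Definition diag3 (a b c : R) (i : 'I_3) : R := nth 0 [:: a; b; c] i.

Lemma signs_diag3 (a b c : R) : a = 1 \/ a = -1 -> b = 1 \/ b = -1 -> c = 1 \/ c = -1 ->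
  signs (diag3 a b c).
Proof. by move=> ? ? ?; exact: ord3P. Qed.

Lemma translate_yshift t1 t2 (k1 k2 : int) (p : pt3 R) :
  yshift t1 t2 (translate k1 k2 p) = translate k1 k2 (yshift t1 t2 p).
Proof. by congr (_, (_, _)); rewrite /= addrAC. Qed.

Lemma symmetry_yshift (t : R) : 0 <= t <= 1 ->
  slab_symmetry (yshift 0 t) (yshift (- 0) (- t)) id id
    (diag3 1 1 1) (diag3 1 1 1) (diag3 1 1 1) 1.
Proof.
move=> t01; have sg : signs (diag3 1 1 1) by apply: signs_diag3; left.
split.
- exact: iso_yshift.
- exact: cell_invariant_yshift.
- by elim/ord3P; rewrite /diag3/= scale1r.
- exact: sg.
- exact: sg.
- by rewrite expr1n.
- by elim/ord3P; elim/ord3P; rewrite /diag3/= !mul1r.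
- by move=> k1 k2; exists k1, k2 => p; exact: translate_yshift.
Qed.

Lemma translate_flip2 (k1 k2 : int) (p : pt3 R) :
  flip2 (translate k1 k2 p) = translate k1 (- k2) (flip2 p).
Proof. by congr (_, (_, _)); rewrite /= opprD mulrNz. Qed.

(** The natural reflection would reverse the third component and send x3 G to -x3 G. The overall
    sign c = -1 restores x3 G and reverses M instead, whence the signs (-1, -1, 1) on components. *)
Lemma symmetry_flip3 :
  slab_symmetry flip3 flip3 flip3 flip3
    (diag3 (-1) (-1) 1) (diag3 1 1 (-1)) (diag3 1 1 (-1)) (-1).
Proof.
split.
- exact: iso_flip3.
- exact: cell_invariant_flip3.
- elim/ord3P; rewrite /diag3/=.
  + by rewrite scale1r /dirs/=; congr (_, _); rewrite /= oppr0.
  + by rewrite scale1r /dirs/=; congr (_, _); rewrite /= oppr0.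
  + by rewrite scaleN1r /dirs/=; congr (_, (_, _)); rewrite /= oppr0.
- by apply: signs_diag3; [left|left|right].
- by apply: signs_diag3; [left|left|right].
- by rewrite sqrrN expr1n.
- by elim/ord3P; elim/ord3P; rewrite /diag3/=; ring.
- by move=> k1 k2; exists k1, k2.
Qed.

(** Reversing y2 reverses the second component relative to the others; c is an overall sign that a
    quadratic energy does not see. *)
Lemma symmetry_flip2 (c : R) : c = 1 \/ c = -1 ->
  slab_symmetry flip2 flip2 flip2 flip2
    (diag3 c (- c) c) (diag3 1 (-1) 1) (diag3 1 (-1) 1) c.
Proof.
move=> c1; split.
- exact: iso_flip2.
- exact: cell_invariant_flip2.
- elim/ord3P; rewrite /diag3/=.
  + by rewrite scale1r /dirs/=; congr (_, (_, _)); rewrite /= oppr0.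
  + by rewrite scaleN1r /dirs/=; congr (_, (_, _)); rewrite /= oppr0.
  + by rewrite scale1r /dirs/=; congr (_, (_, _)); rewrite /= oppr0.
- by apply: signs_diag3; [left|right|left].
- by apply: signs_diag3; [left|right|left].
- by case: c1 => ->; rewrite ?sqrrN expr1n.
- by elim/ord3P; elim/ord3P; rewrite /diag3/=; ring.
- by move=> k1 k2; exists k1, (- k2) => p; exact: translate_flip2.
Qed.

Lemma area_null (Z : set (measurableTypeR R)) : measurable Z ->
  lebesgue_measure Z = 0%E -> area (Z `*` setT) = 0%E.
Proof.
by move=> mZ Z0; rewrite /area product_measure1E//= [lebesgue_measure Z]Z0 mul0e.
Qed.

(** The null set of bad y1 may depend on x3, and nothing makes these sets fit together measurably.
    The bad set is instead cut out by measurable functions; each of its sections is null, hence so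
    is the set. *)
Lemma ae_flip3_even (cf : R -> R -> R) : even_coefficient cf ->
  measurable_fun slab (fun p : pt3 R => cf p.1 p.2.1) ->
  {ae (@volume R), forall p, cell p -> cf (flip3 p).1 (flip3 p).2.1 = cf p.1 p.2.1}.
Proof.
move=> ev mc; pose f (p : pt3 R) := cf p.1 p.2.1.
have mcT : measurable_fun slab (f \o flip3) by exact: (measurable_fun_iso iso_flip3 mc).
(* The plane y1 = -1/2 belongs to the half-open cell, but evenness is assumed only for y1 in the
   open interval. *)
pose C : set (pt3 R) := [set p | p.2.1 != - 2^-1] `&` cell.
pose N : set (pt3 R) := C `&` [set p | f (flip3 p) - f p != 0].
have mC : measurable C.
  apply: measurableI => //.
  rewrite (_ : mkset _ = setT `*` (~` [set - 2^-1] `*` setT)); last first.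
    apply/seteqP; split => p /=; first by move/eqP.
    by move=> [_ [+ _]] => /eqP.
  by apply: measurableX => //; apply: measurableX => //; apply: measurableC; exact: measurable_set1.
have mN : measurable N.
  have mD : measurable_fun C (fun p => f (flip3 p) - f p).
    apply: measurable_funB.
      by apply: (measurable_funS measurable_slab _ mcT) => p [_ /cell_slab].
    by apply: (measurable_funS measurable_slab _ mc) => p [_ /cell_slab].
  rewrite (_ : N = C `&` (fun p => f (flip3 p) - f p) @^-1` (~` [set 0])).
    by apply: mD => //; apply: measurableC; exact: measurable_set1.
  by apply/seteqP; split => p [Cp h]; split => //=; exact/eqP.
have N0 : volume N = 0%E.
  rewrite /volume /product_measure1 integral0_eq// => x _ /=.
  have [tx|ntx] := pselect (thickness x); last first.
    rewrite (_ : xsection N x = set0) ?measure0//.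
    apply/seteqP; split => // y; rewrite /xsection/= inE => -[[_ [tx _ _]] _].
    by apply: ntx.
  have [Z [mZ Z0 hZ]] := ev x tx.
  apply: (@subset_measure0 _ _ R area _ (Z `*` setT)).
  - exact: measurable_xsection.
  - exact: measurableX.
  - move=> y; rewrite /xsection/= inE => -[[/eqP n1 [_ /andP[h1 h2] _]] /eqP h]; split => //.
    apply: hZ => /= hy; apply: h; apply/eqP; rewrite subr_eq0; apply/eqP.
    have ty : thickness y.1.
      apply/andP; split => //; rewrite lt_neqAle h1 andbT eq_sym; exact/eqP.
    by have [e1 _] := hy ty; rewrite /f /flip3/= -e1.
  - exact: area_null.
have nN : {ae (@volume R), forall p, ~ N p}.
  by exists N; split => // p /= /contrapT.
apply: ae_volumeS (ae_volumeI nN (ae_volume_y1_neq (- 2^-1))) => p [hN hp] cp.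
apply/eqP; rewrite -subr_eq0; apply/negP => /negP h.
by apply: hN; split.
Qed.

End Symmetries.

(** * The homogenized form *)

Section QuadraticForms.
Context {R : realType}.

(** Cauchy's functional equation: h = g - id g(1) is additive and vanishes on integers, so n |h x|
    equals |h| at the fractional part of n x. This is bounded in n, so h x = 0. *)
Lemma additive_bounded_linear (g : R -> R) (C : R) :
  (forall x y, g (x + y) = g x + g y) -> (forall x, `|x| <= 1 -> `|g x| <= C) ->
  forall x, g x = x * g 1.
Proof.
move=> gD gC x.
have g0 : g 0 = 0 by apply: (addrI (g 0)); rewrite -gD !addr0.
have gN y : g (- y) = - g y by apply/eqP; rewrite -addr_eq0 -gD addNr g0.
have gn y n : g (n%:R * y) = n%:R * g y.
  elim: n => [|n IH]; first by rewrite !mul0r.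
  by rewrite -natr1 !mulrDl gD IH !mul1r.
have gz y (k : int) : g (k%:~R * y) = k%:~R * g y.
  by case: k => n; rewrite ?NegzE ?mulrNz ?mulNr ?gN -?pmulrn gn.
pose h y := g y - y * g 1.
have hC n : n%:R * `|h x| <= 2 * C.
  pose k := Num.floor (n%:R * x).
  have := floor_le (n%:R * x); have := floorD1_gt (n%:R * x).
  rewrite -/k intrD mulr1z => k1 k2.
  have -> : n%:R * `|h x| = `|h (n%:R * x - k%:~R)|.
    rewrite -[X in X * _ = _]normr_nat -normrM; congr (`|_|).
    rewrite /h gD gN gn; have := gz 1 k; rewrite mulr1 => ->; ring.
  have b1 : `|n%:R * x - k%:~R| <= 1 by rewrite ler_norml; lra.
  rewrite /h; apply: le_trans (ler_normB _ _) _; rewrite normrM.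
  have := gC _ b1; have := gC 1; rewrite normr1 => /(_ (lexx _)) h1 h2.
  have := normr_ge0 (g 1); nra.
have [h0|h0] := eqVneq (h x) 0; first by apply/eqP; rewrite -subr_eq0; exact/eqP.
exfalso; have hp : 0 < `|h x| by rewrite normr_gt0.
have := hC (Num.truncn (2 * C / `|h x|)).+1.
have := truncnS_gt (2 * C / `|h x|).
by rewrite ltr_pdivrMr// => k1 k2; have := lt_le_trans k1 k2; rewrite ltxx.
Qed.

(* Jordan-von Neumann; homogeneity and positivity replace continuity. *)
Lemma parallelogram_orthotropic (q : R -> R -> R -> R) :
  (forall a b c, 0 <= q a b c) ->
  (forall t a b c, q (t * a) (t * b) (t * c) = t ^+ 2 * q a b c) ->
  (forall a b c a' b' c', q (a + a') (b + b') (c + c') + q (a - a') (b - b') (c - c')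
    = 2 * q a b c + 2 * q a' b' c') ->
  (forall a b c, q a b (- c) = q a b c) ->
  exists q1 q2 q12 q3, forall a b c,
    q a b c = a ^+ 2 * q1 + a * b * q12 + b ^+ 2 * q2 + c ^+ 2 * q3.
Proof.
move=> q_ge0 qZ qP qN.
pose q1 := q 1 0 0; pose q2 := q 0 1 0; pose q3 := q 0 0 1.
have q1E a : q a 0 0 = a ^+ 2 * q1 by have := qZ a 1 0 0; rewrite mulr1 !mulr0.
have q2E b : q 0 b 0 = b ^+ 2 * q2 by have := qZ b 0 1 0; rewrite mulr1 !mulr0.
have q3E c : q 0 0 c = c ^+ 2 * q3 by have := qZ c 0 0 1; rewrite mulr1 !mulr0.
(* The parallelogram on (a, b, 0) and (0, 0, c), with evenness in c, decouples the third
   coordinate. *)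
have split3 a b c : q a b c = q a b 0 + c ^+ 2 * q3.
  have := qP a b 0 0 0 c; rewrite !addr0 !subr0 add0r sub0r qN q3E; lra.
(* The mixed term, to be shown bilinear. *)
pose f a b := q a b 0 - a ^+ 2 * q1 - b ^+ 2 * q2.
have par a b : q a b 0 + q a (- b) 0 = 2 * (a ^+ 2 * q1) + 2 * (b ^+ 2 * q2).
  have := qP a 0 0 0 b 0; rewrite !addr0 !subr0 add0r sub0r q1E q2E; lra.
have fZ t a b : f (t * a) (t * b) = t ^+ 2 * f a b.
  rewrite /f; have := qZ t a b 0; rewrite mulr0 => ->; ring.
have f0 b : f 0 b = 0 by rewrite /f q2E; ring.
(* Both vectors get second coordinate b / 2, so that their difference lies on the first axis, where
   q is known. *)
have fhalf a a' b : f (a + a') b = 2 * f a (b / 2) + 2 * f a' (b / 2).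
  have := qP a (b / 2) 0 a' (b / 2) 0; rewrite !addr0 !subr0 subrr -splitr q1E.
  rewrite /f => h; have -> : q (a + a') b 0 = 2 * q a (b / 2) 0 + 2 * q a' (b / 2) 0
    - (a - a') ^+ 2 * q1 by rewrite -h addrK.
  by field.
have fD b a a' : f (a + a') b = f a b + f a' b.
  have f2 x : f x b = 2 * f x (b / 2).
    by have := fhalf x 0 b; rewrite addr0 f0 mulr0 addr0.
  by rewrite fhalf -!f2.
(* Nonnegativity of q at (a, b) and at (a, -b), whose values have a known sum, bounds f from both
   sides. *)
have fb a b : `|a| <= 1 -> `|f a b| <= q1 + b ^+ 2 * q2.
  move=> a1; have h1 := q_ge0 a b 0; have h2 := q_ge0 a (- b) 0; have := par a b.
  have q1p : 0 <= q1 by exact: q_ge0.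
  have a2 : a ^+ 2 <= 1 by rewrite -real_normK ?num_real// expr_le1.
  have h3 : a ^+ 2 * q1 <= q1 by rewrite ler_piMl.
  by rewrite ler_norml /f => h; apply/andP; split; lra.
have fl a b : f a b = a * f 1 b.
  by apply: (@additive_bounded_linear (fun a => f a b) _ (fD b)) => x; exact: fb.
(* Only linearity in the first argument is known so far; homogeneity of degree 2 with factor b
   exchanges the two arguments. *)
have f1 b : f 1 b = b * f 1 1.
  have [->|b0] := eqVneq b 0; first by rewrite mul0r /f q1E; ring.
  have := fZ b b^-1 1; rewrite mulfV// mulr1 => ->.
  by rewrite fl; field.
exists q1, q2, (f 1 1), q3 => a b c; rewrite split3.
have -> : q a b 0 = f a b + a ^+ 2 * q1 + b ^+ 2 * q2 by rewrite /f; ring.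
by rewrite fl f1; ring.
Qed.

End QuadraticForms.

Section Homogenized.
Context {R : realType}.
Context (gamma alpha beta : R) (Q : pt3 R -> 'M[R]_3 -> R) (lambda mu : R -> R -> R).
Context (alpha_gt0 : 0 < alpha).
Context (Qborel : borel_on_slab Q).
Context (Qbounds : {ae volume, forall p, slab p -> quadratic_class alpha beta (Q p)}).
Context (QE : forall (x3 y1 y2 : R) (G : 'M[R]_3), thickness x3 ->
       Q (x3, (y1, y2)) G =
         lambda x3 y1 * (\tr G) ^+ 2 + 2 * mu x3 y1 * sqnorm (sym G)).
Implicit Types (phi : pt3 R -> 'cV[R]_3) (G M : 'M[R]_2).

Let E G M phi : R := energy Q (strain gamma G M phi).

Let X G := [set x : R | exists M phi, [/\ M^T = M, H1gamma gamma phi & x = E G M phi]].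

Lemma energy_strain_ge0 G M phi : H1gamma gamma phi -> 0 <= E G M phi.
Proof.
move=> H; apply: (energy_ge0 alpha_gt0 Qborel Qbounds QE).
exact: L2field_strain.
Qed.

Lemma QhomE G : Qhom gamma Q G = inf (X G).
Proof. by []. Qed.

Lemma X_lbound G : lbound (X G) 0.
Proof. by move=> _ [M [phi [_ H ->]]]; exact: energy_strain_ge0. Qed.

Lemma X_nonempty G : X G !=set0.
Proof.
exists (E G 0 (fun=> 0)), 0, (fun=> 0); split => //; first exact: trmx0.
exact: H1gamma0.
Qed.

Lemma Qhom_le G M phi : M^T = M -> H1gamma gamma phi ->
  Qhom gamma Q G <= E G M phi.
Proof.
move=> MT H; rewrite QhomE; apply: ge_inf; first by exists 0; exact: X_lbound.
by exists M, phi.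
Qed.

Lemma Qhom_ge0 G : 0 <= Qhom gamma Q G.
Proof. by rewrite QhomE; apply: lb_le_inf; [exact: X_nonempty|exact: X_lbound]. Qed.

Lemma Qhom_adherent G (eps : R) : 0 < eps -> exists M phi,
  [/\ M^T = M, H1gamma gamma phi & E G M phi < Qhom gamma Q G + eps].
Proof.
move=> e0; have hi : has_inf (X G).
  by split; [exact: X_nonempty|exists 0; exact: X_lbound].
have [_ [M [phi [MT H ->]]] h] := inf_adherent e0 hi.
by exists M, phi.
Qed.

Lemma trmxZD (s t : R) M M' : M^T = M -> M'^T = M' ->
  (s *: M + t *: M')^T = s *: M + t *: M'.
Proof. by move=> h h'; rewrite linearD/= !linearZ/= h h'. Qed.

Lemma arith_parallelogram (a b c d x y z w eps : R) :
  a < x + eps / 4 -> b < y + eps / 4 -> c + d = 2 * a + 2 * b ->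
  z <= c -> w <= d -> z + w <= 2 * x + 2 * y + eps.
Proof. by move=> *; lra. Qed.

Lemma arith_halve (a b x y : R) :
  2 ^+ 2 * x + 2 ^+ 2 * y <= 2 * a + 2 * b -> 2 * x + 2 * y <= a + b.
Proof. by move=> *; lra. Qed.

(** Sums and differences of near-minimizers for G and G' compete for G + G' and G - G', with total
    energy given by the parallelogram identity. No minimizer has to exist. *)
Lemma Qhom_parallelogram_le G G' :
  Qhom gamma Q (G + G') + Qhom gamma Q (G - G') <=
  2 * Qhom gamma Q G + 2 * Qhom gamma Q G'.
Proof.
apply/ler_addgt0Pr => eps e0.
have e4 : 0 < eps / 4 by rewrite divr_gt0.
have [M [phi [MT H h]]] := Qhom_adherent G e4.
have [M' [phi' [MT' H' h']]] := Qhom_adherent G' e4.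
have LS := L2field_strain G M H; have LS' := L2field_strain G' M' H'.
have par := energy_parallelogram alpha_gt0 Qborel Qbounds QE LS LS'.
have l1 : Qhom gamma Q (G + G') <=
    energy Q (fun p => strain gamma G M phi p + strain gamma G' M' phi' p).
  rewrite -(energy_strainD Qborel QE G G' M M' H H'); apply: Qhom_le.
    by rewrite linearD/= MT MT'.
  have := H1gammaZD 1 1 H H'; congr H1gamma.
  by apply/funext => p; rewrite !scale1r.
have l2 : Qhom gamma Q (G - G') <=
    energy Q (fun p => strain gamma G M phi p - strain gamma G' M' phi' p).
  have := energy_strainZD Qborel QE 1 (-1) G G' M M' H H'.
  have E3 (f f' : pt3 R -> 'M[R]_3) : (fun p => 1 *: f p + -1 *: f' p) = (fun p => f p - f' p).
    by apply/funext => p; rewrite scale1r scaleN1r.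
  rewrite (E3 (strain gamma G M phi) (strain gamma G' M' phi')) => <-.
  have -> : G - G' = 1 *: G + -1 *: G' by rewrite scale1r scaleN1r.
  apply: Qhom_le; first exact: trmxZD.
  exact: H1gammaZD.
exact: (arith_parallelogram h h' par l1 l2).
Qed.

Lemma Qhom_scale_le (t : R) G : Qhom gamma Q (t *: G) <= t ^+ 2 * Qhom gamma Q G.
Proof.
apply/ler_addgt0Pr => eps e0.
(* This tolerance keeps t^2 d below eps even for t = 0. *)
pose d := eps / (t ^+ 2 + 1).
have t1 : 0 < t ^+ 2 + 1 by rewrite ltr_wpDl ?sqr_ge0.
have d0 : 0 < d by rewrite divr_gt0.
have [M [phi [MT H h]]] := Qhom_adherent G d0.
have LS := L2field_strain G M H.
have hE : energy Q (fun p => t *: strain gamma G M phi p) = t ^+ 2 * E G M phi.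
  exact: (energyZ alpha_gt0 Qborel Qbounds QE).
have l : Qhom gamma Q (t *: G) <= energy Q (fun p => t *: strain gamma G M phi p).
  (* Scaling is obtained as a linear combination whose second term has coefficient 0. *)
  have := energy_strainZD Qborel QE t 0 G 0 M 0 H H.
  have E3 (f f' : pt3 R -> 'M[R]_3) : (fun p => t *: f p + 0 *: f' p) = (fun p => t *: f p).
    by apply/funext => p; rewrite scale0r addr0.
  rewrite (E3 (strain gamma G M phi) (strain gamma 0 0 phi)) => <-.
  have {1}-> : t *: G = t *: G + 0 *: 0 by rewrite scale0r addr0.
  apply: Qhom_le; first by apply: trmxZD => //; exact: trmx0.
  exact: H1gammaZD.
apply: le_trans l _; rewrite hE.
have h2 : t ^+ 2 * E G M phi <= t ^+ 2 * (Qhom gamma Q G + d).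
  by rewrite ler_wpM2l ?sqr_ge0// ltW.
apply: le_trans h2 _; rewrite mulrDr lerD2l.
by rewrite /d mulrCA ler_piMr ?(ltW e0)// ler_pdivrMr// mul1r lerDl.
Qed.

Lemma Qhom_scale (t : R) G : Qhom gamma Q (t *: G) = t ^+ 2 * Qhom gamma Q G.
Proof.
apply/eqP; rewrite eq_le Qhom_scale_le/=.
have [->|t0] := eqVneq t 0; first by rewrite expr0n/= mul0r Qhom_ge0.
have := Qhom_scale_le t^-1 (t *: G); rewrite scalerA mulVf// scale1r => h.
have t2 : 0 < t ^+ 2 by rewrite exprn_even_gt0.
rewrite -ler_pdivlMl// -exprVn; exact: h.
Qed.

(** The reverse inequality is the first one applied to G + G' and G - G', whose sum and difference
    are 2 G and 2 G', divided by 2 after using homogeneity. *)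
Lemma Qhom_parallelogram G G' :
  Qhom gamma Q (G + G') + Qhom gamma Q (G - G') =
  2 * Qhom gamma Q G + 2 * Qhom gamma Q G'.
Proof.
apply/eqP; rewrite eq_le Qhom_parallelogram_le/=.
have := Qhom_parallelogram_le (G + G') (G - G').
have -> : G + G' + (G - G') = 2 *: G by apply/matrixP => i j; rewrite !mxE; ring.
have -> : G + G' - (G - G') = 2 *: G' by apply/matrixP => i j; rewrite !mxE; ring.
by rewrite (Qhom_scale 2 G) (Qhom_scale 2 G'); exact: arith_halve.
Qed.

(** The in-plane trace of the reflection y2 -> -y2, conjugation by diag(1, -1): it fixes G1 and G2
    and reverses G3. *)
Definition conj2 G : 'M[R]_2 :=
  \matrix_(i < 2, j < 2) (diag3 1 (-1) 1 (lshift 1 i) * diag3 1 (-1) 1 (lshift 1 j) * G i j).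

Lemma sign_conj_embed (e : 'I_3 -> R) G :
  sign_conj e (embed G) =
  embed (\matrix_(i < 2, j < 2) (e (lshift 1 i) * e (lshift 1 j) * G i j)).
Proof.
apply/matrixP => i j; rewrite mxE.
have := splitP (i : 'I_(2 + 1)) => -[i' ii|i' ii]; last first.
  have -> : i = i3 by apply: val_inj; rewrite /= ii (ord1 i').
  by rewrite (embed_3 G j).2 (embed_3 _ j).2 mulr0.
have := splitP (j : 'I_(2 + 1)) => -[j' jj|j' jj]; last first.
  have -> : j = i3 by apply: val_inj; rewrite /= jj (ord1 j').
  by rewrite (embed_3 G i).1 (embed_3 _ i).1 mulr0.
have -> : i = lshift 1 i' by exact: val_inj.
have -> : j = lshift 1 j' by exact: val_inj.
by rewrite !embed_entry mxE.
Qed.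

Lemma conj2T M : M^T = M -> (conj2 M)^T = conj2 M.
Proof.
move=> MT; apply/matrixP => i j; rewrite !mxE.
by rewrite -{1}MT mxE [X in X * _]mulrC.
Qed.

Lemma conj2K G : conj2 (conj2 G) = G.
Proof.
apply/matrixP => i j; rewrite !mxE.
have d2 k : diag3 1 (-1) 1 k * diag3 1 (-1) 1 k = 1 :> R.
  by elim/ord3P: k; rewrite /diag3/=; ring.
by rewrite mulrA mulrACA !d2 !mul1r.
Qed.

Lemma Qhom_conj2_le G : Qhom gamma Q (conj2 G) <= Qhom gamma Q G.
Proof.
apply/ler_addgt0Pr => eps e0; have [M [phi [MT H h]]] := Qhom_adherent G e0.
have S := @symmetry_flip2 R 1 (or_introl erefl).
apply: le_trans (Qhom_le (conj2 G) (conj2T MT) (H1gamma_pullback S H)) _.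
apply: ltW; apply: le_lt_trans h; rewrite le_eqVlt; apply/orP; left; apply/eqP.
apply: (energy_pullback Qborel QE S) => //.
  by apply: aeW => p _; split.
move=> p; rewrite scale1r sign_conj_embed; congr embed.
by apply/matrixP => i j; rewrite /flip2/= !mxE; ring.
Qed.

Lemma Qhom_conj2 G : Qhom gamma Q (conj2 G) = Qhom gamma Q G.
Proof.
apply: le_anti; apply/andP; split; first exact: Qhom_conj2_le.
by have := Qhom_conj2_le (conj2 G); rewrite (conj2K G).
Qed.

Lemma conj2_basis (a b c : R) :
  conj2 (a *: G1 + b *: G2 + c *: G3) = a *: G1 + b *: G2 + (- c) *: G3.
Proof.
apply/matrixP => i j; rewrite !mxE.
case: i => -[|[|//]] hi; case: j => -[|[|//]] hj; rewrite /diag3/=; ring.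
Qed.

Lemma Qhom_orthotropic : orthotropic (Qhom gamma Q).
Proof.
pose q (a b c : R) := Qhom gamma Q (a *: G1 + b *: G2 + c *: G3).
have [||||q1 [q2 [q12 [q3 h]]]] := @parallelogram_orthotropic R q.
- by move=> a b c; exact: Qhom_ge0.
- by move=> t a b c; rewrite /q -!scalerA -!scalerDr Qhom_scale.
- move=> a b c a' b' c'; rewrite /q.
  have -> : (a + a') *: G1 + (b + b') *: G2 + (c + c') *: G3 =
      (a *: G1 + b *: G2 + c *: G3) + (a' *: G1 + b' *: G2 + c' *: G3).
    by move: G1 G2 G3 => A B C; apply/matrixP => i j; rewrite !mxE; ring.
  have -> : (a - a') *: G1 + (b - b') *: G2 + (c - c') *: G3 =
      (a *: G1 + b *: G2 + c *: G3) - (a' *: G1 + b' *: G2 + c' *: G3).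
    by move: G1 G2 G3 => A B C; apply/matrixP => i j; rewrite !mxE; ring.
  exact: Qhom_parallelogram.
- by move=> a b c; rewrite /q -conj2_basis; exact: Qhom_conj2.
by exists q1, q2, q12, q3 => G g1 g2 g3 ->; rewrite -h.
Qed.

End Homogenized.

(** * Symmetries of the correctors *)

Section Correctors.
Context {R : realType}.
Context (gamma alpha beta : R) (Q : pt3 R -> 'M[R]_3 -> R) (lambda mu : R -> R -> R).
Context (gamma_gt0 : 0 < gamma) (alpha_gt0 : 0 < alpha).
Context (Qborel : borel_on_slab Q).
Context (Qbounds : {ae volume, forall p, slab p -> quadratic_class alpha beta (Q p)}).
Context (QE : forall (x3 y1 y2 : R) (G : 'M[R]_3), thickness x3 ->
       Q (x3, (y1, y2)) G =
         lambda x3 y1 * (\tr G) ^+ 2 + 2 * mu x3 y1 * sqnorm (sym G)).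
Context (lambda_even : even_coefficient lambda) (mu_even : even_coefficient mu).
Implicit Types (phi : pt3 R -> 'cV[R]_3) (G M : 'M[R]_2).

Let unique := corrector_unique gamma_gt0 alpha_gt0 Qborel Qbounds QE.

Lemma corrector_pullback (T T' L L' : pt3 R -> pt3 R) eta s e c G M M' phi :
  slab_symmetry T T' L L' eta s e c ->
  {ae (@volume R), forall p, cell p ->
    lam_at lambda (T p) = lam_at lambda p /\ mu_at mu (T p) = mu_at mu p} ->
  (forall p : pt3 R, embed ((p.1 : R) *: G + M') =
    c *: sign_conj e (embed (((T p).1 : R) *: G + M))) ->
  M'^T = M' -> corrector gamma Q G M phi ->
  M' = M /\ {ae volume, forall p, slab p -> signed_pullback T eta phi p = phi p}.
Proof.
move=> S coef GM MT cor; have [_ H mean _] := cor.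
apply: (unique cor MT (H1gamma_pullback S H)).
  by move=> i; exact: (mean_pullback S H (mean i)).
exact: (energy_pullback Qborel QE S coef H GM).
Qed.

Lemma embed_diag3 G : sign_conj (diag3 1 1 (-1)) (embed G) = embed G.
Proof.
rewrite sign_conj_embed; congr embed; apply/matrixP => i j; rewrite mxE.
by case: i => -[|[|//]] hi; case: j => -[|[|//]] hj; rewrite /diag3/= !mul1r.
Qed.

Lemma sign_conj1 (A : 'M[R]_3) : sign_conj (diag3 1 1 1) A = A.
Proof.
apply/matrixP => i j; rewrite mxE.
by elim/ord3P: i; elim/ord3P: j; rewrite /diag3/= !mul1r.
Qed.

Lemma corrector_membrane_eq0 G M phi : corrector gamma Q G M phi -> M = 0.
Proof.
move=> cor; have [MT _ _ _] := cor.
have coef : {ae (@volume R), forall p, cell p ->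
    lam_at lambda (flip3 p) = lam_at lambda p /\ mu_at mu (flip3 p) = mu_at mu p}.
  have h1 := ae_flip3_even lambda_even (measurable_lam Qborel QE).
  have h2 := ae_flip3_even mu_even (measurable_mu Qborel QE).
  by apply: ae_volumeS (ae_volumeI h1 h2) => p [k1 k2] cp; split; [exact: k1|exact: k2].
(* The pullback sends x3 G + M to x3 G - M, so uniqueness compares -M with M. *)
have [||MN _] := @corrector_pullback _ _ _ _ _ _ _ _ G M (- M) phi (@symmetry_flip3 R) coef _ _ cor.
- move=> p; rewrite embed_diag3 scaleN1r -scaleN1r -embedZ scaleN1r.
  by rewrite /flip3/= opprD scaleNr opprK.
- by rewrite linearN/= MT.
- apply/matrixP => i j; rewrite [RHS]mxE.
  have := congr1 (fun A : 'M[R]_2 => A i j) MN; rewrite mxE; lra.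
Qed.

Lemma corrector_yshift G M phi (t : R) i : corrector gamma Q G M phi -> 0 < t ->
  {ae volume, forall p, slab p ->
    component i phi (yshift 0 t p) = component i phi p}.
Proof.
move=> cor t0; have [MT H _ _] := cor.
(* Shifts wrap around the cell only for amounts in [0, 1]; the integer part of t is left to
   periodicity. *)
pose k := Num.floor t; pose u := t - k%:~R.
have k1 := floor_le t; have := floorD1_gt t; rewrite -/k intrD mulr1z => k2.
have u01 : 0 <= u <= 1 by rewrite -/k in k1; rewrite /u; apply/andP; split; lra.
have coef : {ae (@volume R), forall p, cell p ->
    lam_at lambda (yshift 0 u p) = lam_at lambda p /\
    mu_at mu (yshift 0 u p) = mu_at mu p}.
  by apply: aeW => p _; rewrite /lam_at /mu_at /yshift/= addr0.
have [|_ hu] := corrector_pullback (symmetry_yshift u01) coef _ MT cor.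
  by move=> p; rewrite sign_conj1 scale1r.
have hk := component_translate 0 k i H.
have hku := ae_volume_yshift 0 u hk.
apply: ae_volumeS (ae_volumeI hu hku) => p [h1 h2] sp.
have -> : yshift 0 t p = yshift 0%:~R k%:~R (yshift 0 u p).
  by rewrite /yshift/= !addr0 -addrA /u subrK.
rewrite h2//; have := congr1 (fun v : 'cV[R]_3 => v i 0) (h1 sp).
by rewrite mxE /component => <-; elim/ord3P: i {h1 h2 hk hku}; rewrite /diag3/= mul1r.
Qed.

Lemma corrector_partial_y2 G M phi i : corrector gamma Q G M phi ->
  {ae volume, forall p, slab p -> partial dir_y2 (component i phi) p = 0}.
Proof.
move=> cor; have [_ H _ _] := cor; have [hl _ _] := H.
have [Li hi] := hl i.
have w := partialP (hi dir_y2 (or_intror (or_introl erefl))).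
by apply: (partial_y2_eq0 Li w) => t t0; exact: (corrector_yshift i cor t0).
Qed.

Lemma iso_id : slab_iso (@id (pt3 R)) id id id.
Proof.
split; [by []|by []|exact: preserving_id|by move=> p; exact: cvg_id|
  by move=> p; exact: cvg_id|by []|by []|by []].
Qed.

(* With no derivative in the direction y2, flipping signs of components does not
   need to be accompanied by the reflection of y2. *)
Lemma corrector_signs G M phi (c : R) : c = 1 \/ c = -1 ->
  (forall x : R, embed (x *: G) = c *: sign_conj (diag3 1 (-1) 1) (embed (x *: G))) ->
  corrector gamma Q G M phi ->
  {ae volume, forall p, slab p -> forall i,
    diag3 c (- c) c i * component i phi p = component i phi p}.
Proof.
move=> c1 Gc cor; have M0 := corrector_membrane_eq0 cor.
have [MT H mean _] := cor; have hg := has_grad_nabla H.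
have [Lc LW] := H1gamma_L2cell H.
pose eta := diag3 c (- c) c; pose psi := signed_pullback id eta phi.
pose s1 (j : 'I_3) : R := 1.
have ss : signs s1 by move=> j; left.
have Ls j : id (dirs j) = s1 j *: dirs j by rewrite scale1r.
have hpsi := has_grad_iso eta iso_id ss Ls hg.
have cE i : component i psi = fun p => eta i * component i phi p + 0 * component i phi p.
  by apply/funext => p; rewrite /component mxE mul0r addr0.
have Hpsi : H1gamma gamma psi.
  apply: (H1gamma_intro hpsi).
  - move=> k1 k2; have [_ /(_ k1 k2) per _] := H.
    by apply: ae_volumeS per => p h sp; rewrite /psi /signed_pullback h.
  - by move=> i; rewrite -/psi cE; exact: L2cellZD.
  - move=> i j; have := L2cellZD (eta i) 0 (LW i j) (LW i j); congr L2cell.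
    apply/funext => p; move: (nabla _ _ _) => A.
    by rewrite [RHS]mxE /s1 mulr1 mul0r addr0.
have mpsi i : \int[volume]_(p in cell) component i psi p = 0.
  rewrite cE Rintegral_cellZD ?mean ?mulr0 ?addr0//; exact: L2cell_integrable.
have hE : energy Q (strain gamma G M psi) = energy Q (strain gamma G M phi).
  have mS phi0 : H1gamma gamma phi0 ->
      measurable_fun cell (fun p => Q p (strain gamma G M phi0 p)).
    move=> H0; apply: measurable_fun_cell.
    apply: (measurable_energy Qborel QE) => i j.
    exact: (L2field_measurable i j (L2field_strain G M H0)).
  apply: ae_eq_Rintegral; [exact: measurable_cell|exact: mS|exact: mS|].
  have d2 := ae_volume_ord (fun i => corrector_partial_y2 i cor).
  apply: ae_volumeS (ae_volumeI d2 (nabla_ae Hpsi hpsi)) => p [hd hn] cp.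
  have sp := cell_slab cp.
  (* In the y2 column both sides vanish. In the other columns the j-th conjugation sign is 1, and
     the component sign is exactly c times the i-th conjugation sign. *)
  have eW : nabla gamma psi p = c *: sign_conj (diag3 1 (-1) 1) (nabla gamma phi p).
    rewrite hn//; apply/matrixP => i j; rewrite [LHS]mxE [RHS]mxE /sign_conj [in RHS]mxE.
    have [->|j2] := eqVneq j i2.
      have -> : nabla gamma phi p i i2 = 0 by rewrite nablaE [partial _ _ _](hd i sp) mulr0.
      by rewrite !mulr0.
    rewrite mulrA; congr (_ * _); move: j2; rewrite /eta /s1.
    by elim/ord3P: i; elim/ord3P: j => //= _; rewrite /diag3/=; ring.
  have -> : strain gamma G M psi p = c *: sign_conj (diag3 1 (-1) 1) (strain gamma G M phi p).
    rewrite /strain M0 addr0 eW symZ sym_sign_conj sign_conjD scalerDr.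
    by congr (_ + _); exact: Gc.
  rewrite (Q_isotropic QE _ sp) (Q_isotropic QE _ sp) isotropic_formZ.
  rewrite isotropic_form_sign_conj; last by apply: signs_diag3; [left|right|left].
  by case: c1 => ->; rewrite ?sqrrN expr1n mul1r.
have [_ hu] := unique cor MT Hpsi mpsi hE.
apply: ae_volumeS hu => p h sp i.
have := congr1 (fun v : 'cV[R]_3 => v i 0) (h sp).
by rewrite /psi /signed_pullback mxE.
Qed.

Lemma component_zero_partial phi i j : H1gamma gamma phi ->
  {ae volume, forall p, slab p -> component i phi p = 0} ->
  {ae volume, forall p, slab p -> nabla gamma phi p i j = 0}.
Proof.
move=> H h0; have [hl _ _] := H; have [Li hi] := hl i.
have w := partialP (hi (dirs j) (dirsP j)).
have w0 := weak_partial_aeL Li (L2loc_cst 0) h0 w.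
apply: ae_volumeS (weak_partial_unique w0 (weak_partial0 (dirs j))) => p hp sp.
by rewrite nablaE hp// mulr0.
Qed.

End Correctors.

Lemma embed_G12 (R : realType) (G : 'M[R]_2) (x : R) : G = G1 \/ G = G2 ->
  embed (x *: G) = 1 *: sign_conj (diag3 1 (-1) 1) (embed (x *: G)).
Proof.
move=> G12; rewrite scale1r sign_conj_embed; congr embed.
apply/matrixP => i j; rewrite !mxE.
by case: G12 => ->; rewrite !mxE;
  case: i => -[|[|//]] hi; case: j => -[|[|//]] hj; rewrite /diag3/=; ring.
Qed.

(** Being off-diagonal, G3 is reversed by the conjugation and restored by c = -1, while the diagonal
    G1 and G2 go with c = 1. This decides which components of the corrector must vanish. *)
Lemma embed_G3 (R : realType) (x : R) :
  embed (x *: G3) = -1 *: sign_conj (diag3 1 (-1) 1) (embed (x *: G3)).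
Proof.
rewrite sign_conj_embed -embedZ; congr embed.
apply/matrixP => i j; rewrite !mxE.
by case: i => -[|[|//]] hi; case: j => -[|[|//]] hj; rewrite /diag3/=; ring.
Qed.

Lemma embed_G3_diag (R : realType) (x : R) (j : 'I_3) : embed (x *: G3) j j = 0.
Proof.
have := splitP (j : 'I_(2 + 1)) => -[j' jj|j' jj]; last first.
  have -> : j = i3 by apply: val_inj; rewrite /= jj (ord1 j').
  by have [-> _] := embed_3 (x *: G3) i3.
have -> : j = lshift 1 j' by exact: val_inj.
rewrite embed_entry !mxE.
by case: j' {jj} => -[|[|//]] hj /=; ring.
Qed.

(** A matrix with zero diagonal has zero trace and is orthogonal to diagonal matrices, so both cross
    terms disappear. *)
Lemma isotropic_form_delta (R : realType) (l m : R) (A : 'M[R]_3) j :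
  (forall i, A i i = 0) ->
  isotropic_form l m (A + delta_mx j j) =
  isotropic_form l m A + isotropic_form l m (delta_mx j j).
Proof.
move=> A0; have := A0 i1; have := A0 i2; have := A0 i3 => a3 a2 a1.
rewrite /isotropic_form !sqnormE /mxtrace !big_ord_recl !big_ord0 !symE.
have o1 : ord0 = i1 :> 'I_3 by exact: val_inj.
have o2 : lift ord0 ord0 = i2 :> 'I_3 by exact: val_inj.
have o3 : lift ord0 (lift ord0 ord0) = i3 :> 'I_3 by exact: val_inj.
rewrite !o3 !o2 !o1 !mxE a1 a2 a3.
by elim/ord3P: j => /=; ring.
Qed.

Theorem lemma4p2 (R : realType) (gamma alpha beta : R)
    (Q : pt3 R -> 'M[R]_3 -> R) (lambda mu : R -> R -> R)
    (gamma_gt0 : 0 < gamma) (alpha_gt0 : 0 < alpha) (le_ab : alpha <= beta)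
    (Qadm : admissible alpha beta Q)
    (Qy2 : forall (x3 y1 y2 y2' : R) (G : 'M[R]_3), thickness x3 ->
       Q (x3, (y1, y2)) G = Q (x3, (y1, y2')) G)
    (QE : forall (x3 y1 y2 : R) (G : 'M[R]_3), thickness x3 ->
       Q (x3, (y1, y2)) G =
         lambda x3 y1 * (\tr G) ^+ 2 + 2 * mu x3 y1 * sqnorm (sym G))
    (lambda_even : even_coefficient lambda)
    (mu_even : even_coefficient mu) :
  [/\ orthotropic (Qhom gamma Q),
      forall (G M : 'M[R]_2) (phi : pt3 R -> 'cV[R]_3),
        G = G1 \/ G = G2 \/ G = G3 -> corrector gamma Q G M phi ->
        M = 0 /\
        {ae volume, forall p : pt3 R, cell p ->
          forall i, partial dir_y2 (component i phi) p = 0},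
      forall (G M : 'M[R]_2) (phi : pt3 R -> 'cV[R]_3),
        G = G1 \/ G = G2 -> corrector gamma Q G M phi ->
        {ae volume, forall p : pt3 R, cell p -> component i2 phi p = 0} &
      forall (M : 'M[R]_2) (phi : pt3 R -> 'cV[R]_3),
        corrector gamma Q G3 M phi ->
        {ae volume, forall p : pt3 R, cell p ->
          [/\ component i1 phi p = 0,
              component i3 phi p = 0 &
              forall j, tensor (Q p) (strain gamma G3 0 phi p)
                          (delta_mx j j) = 0]}].
Proof.
have [Qborel Qbounds _] := Qadm.
have d2 (G M : 'M[R]_2) phi (cor : corrector gamma Q G M phi) :=
  ae_volume_ord (fun i => corrector_partial_y2 gamma_gt0 alpha_gt0 Qborel Qbounds QE i cor).
split.
- exact: (Qhom_orthotropic gamma alpha_gt0 Qborel Qbounds QE).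
- move=> G M phi _ cor; split.
    exact: (corrector_membrane_eq0 gamma_gt0 alpha_gt0 Qborel Qbounds QE
      lambda_even mu_even cor).
  by apply: ae_volumeS (d2 G M phi cor) => p h /cell_slab sp i; exact: h.
- move=> G M phi G12 cor.
  have := corrector_signs gamma_gt0 alpha_gt0 Qborel Qbounds QE lambda_even
    mu_even (or_introl erefl) (fun x => embed_G12 x G12) cor.
  apply: ae_volumeS => p h /cell_slab sp.
  (* With c = 1 the second component equals its own opposite. *)
  by have := h sp i2; rewrite /diag3/=; lra.
- move=> M phi cor; have [_ H _ _] := cor.
  have hs := corrector_signs gamma_gt0 alpha_gt0 Qborel Qbounds QE lambda_even
    mu_even (or_intror erefl) (fun x => embed_G3 x) cor.
  (* With c = -1 the reversed components are the first and the third. *)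
  have z1 : {ae volume, forall p, slab p -> component i1 phi p = 0}.
    by apply: ae_volumeS hs => p h sp; have := h sp i1; rewrite /diag3/=; lra.
  have z3 : {ae volume, forall p, slab p -> component i3 phi p = 0}.
    by apply: ae_volumeS hs => p h sp; have := h sp i3; rewrite /diag3/=; lra.
  have g1 := component_zero_partial i1 H z1.
  have g3 := component_zero_partial i3 H z3.
  apply: ae_volumeS (ae_volumeI (ae_volumeI z1 z3)
    (ae_volumeI (ae_volumeI g1 g3) (d2 _ _ _ cor))) => p.
  move=> [[k1 k3] [[w1 w3] w2]] /cell_slab sp; split; [exact: k1|exact: k3|] => j.
  (* Entries 1 and 3 are derivatives of vanishing components, entry 2 is a derivative in y2, and G3
     contributes nothing to the diagonal. *)
  have diag0 i : strain gamma G3 0 phi p i i = 0.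
    rewrite /strain addr0 mxE embed_G3_diag add0r symE.
    have -> : nabla gamma phi p i i = 0; last by rewrite addr0 mulr0.
    elim/ord3P: i; [exact: w1| |exact: w3].
    by rewrite nablaE [partial _ _ _](w2 i2 sp) mulr0.
  rewrite /tensor !(Q_isotropic QE _ sp) (isotropic_form_delta _ _ _ diag0).
  by move: (isotropic_form _ _ _) (isotropic_form _ _ _) => a b; ring.
Qed.
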